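(* Let $\alpha\in(0,1)$ and let $\varphi\in\mathcal D_\alpha$ be a holomorphic self-map of $\mathbb D$. Then $D_\varphi$ is Hilbert-Schmidt on $\mathcal D_\alpha$ if and only if $$\int_{\mathbb D}\frac{N_{\varphi,\alpha}(w)}{(1-|w|^2)^{\alpha+4}}\,dA(w)<\infty .$$
   Context: $\mathbb D=\{z\in\mathbb C:|z|<1\}$, $dA$ is the normalized Lebesgue area measure on $\mathbb D$, and $\mathcal H(\mathbb D)$ is the space of complex-valued holomorphic functions on $\mathbb D$. A holomorphic self-map of $\mathbb D$ is a $\varphi\in\mathcal H(\mathbb D)$ with $\varphi(\mathbb D)\subseteq\mathbb D$. The weighted Dirichlet space $\mathcal D_\alpha$ consists of all $f(z)=\sum_{n\ge0}a_nz^n\in\mathcal H(\mathbb D)$ with $\sum_{n\ge0}(n+1)^{1-\alpha}|a_n|^2<\infty$; it is a separable Hilbert space with inner product $\langle f,g\rangle_{\mathcal D_\alpha}=\sum_{n\ge0}(n+1)^{1-\alpha}a_n\overline{b_n}$ for $g(z)=\sum_{n\ge0} b_nz^n$. The composition-differentiation operator is $D_\varphi f=f'\circ\varphi$. A linear operator $T$ on a separable Hilbert space $\mathcal H$ is Hilbert-Schmidt if and only if $\sum_{n}\|Te_n\|_{\mathcal H}^2<\infty$ for some orthonormal basis $\{e_n\}$ of $\mathcal H$. The generalized Nevanlinna counting function is $N_{\varphi,\alpha}(w)=\sum_{z\in\mathbb D:\,\varphi(z)=w}(1-|z|^2)^\alpha\in[0,\infty]$ for $w\in\mathbb D\setminus\{\varphi(0)\}$,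 with the sum equal to $0$ if $w\notin\varphi(\mathbb D)$ (the single point $\varphi(0)$ is a null set for the integral). *)

(* Defs.v *)
From HB Require Import structures.
From mathcomp Require Import all_boot all_order all_algebra.
From mathcomp Require Import all_classical all_reals all_analysis.
From mathcomp Require Import complex.
Import Order.TTheory GRing.Theory Num.Theory.
Import numFieldNormedType.Exports.

Set Implicit Arguments.
Unset Strict Implicit.
Unset Printing Implicit Defensive.

Local Open Scope classical_set_scope.
Local Open Scope ring_scope.

(* The complex numbers over [R]. The topology and the normed-module structure
   of a numeric field such as [R[i]] are attached to its regular module
   [R[i]^o], which is convertible to [R[i]]; derivatives taken with respect to
   it are complex derivatives. *)
Notation Cplx R := ((R[i])^o) (only parsing).

(* [`|z|] lives in [R[i]]; this is the same modulus as an element of [R]. *)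
Notation modC := Normc.normc.

Section DirichletSpace.
Variable R : realType.
Local Notation C := (Cplx R).

Definition disc : set C := [set z | modC z < 1].

(* A function on the disc is represented by a total function [C -> C] whose
   values outside the disc are irrelevant. *)
Definition eq_on_disc (f g : C -> C) : Prop := forall z, disc z -> f z = g z.

Definition holomorphic (f : C -> C) : Prop :=
  forall z, disc z -> derivable f z 1.

Definition holomorphic_self_map (phi : C -> C) : Prop :=
  holomorphic phi /\ forall z, disc z -> disc (phi z).

Definition power_series_on_disc (f : C -> C) (a : nat -> C) : Prop :=
  forall z, disc z -> series (fun n => a n * z ^+ n) @ \oo --> f z.

(* The coefficients of the power series of [f], which are unique when they
   exist; the zero sequence if [f] has no power series on the disc. *)
Definition coef (f : C -> C) : nat -> C :=
  xget (fun=> 0) [set a | power_series_on_disc f a].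

Variable alpha : R.

Definition weight (n : nat) : R := n.+1%:R `^ (1 - alpha).

(* The squared norm <f, f>, with value [+oo] if the series diverges. It is only
   meaningful for functions that have a power series on the disc. *)
Definition dirichlet_norm2 (f : C -> C) : \bar R :=
  (\sum_(0 <= n <oo) (weight n * modC (coef f n) ^+ 2)%:E)%E.

Definition dirichlet : set (C -> C) :=
  [set f | [/\ holomorphic f,
               exists a, power_series_on_disc f a &
               (dirichlet_norm2 f < +oo)%E]].

Definition dirichlet_dot (f g : C -> C) : C :=
  limn (series (fun n => (weight n)%:C%C * coef f n * (coef g n)^*%C : C)).

Definition orthonormal_basis (e : nat -> C -> C) : Prop :=
  [/\ forall n, dirichlet (e n),
      forall m n, dirichlet_dot (e m) (e n) = (m == n)%:R &
      forall f, dirichlet f ->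
        dirichlet_norm2
          (fun z => f z - \sum_(k < n) dirichlet_dot f (e k) * e k z)
        @[n --> \oo] --> 0%E].

(* The first clause says that [T] acts on functions on the disc. *)
Definition linear_operator (T : (C -> C) -> C -> C) : Prop :=
  [/\ forall f g, dirichlet f -> dirichlet g ->
        eq_on_disc f g -> eq_on_disc (T f) (T g),
      forall f, dirichlet f -> dirichlet (T f) &
      forall (c : C) f g, dirichlet f -> dirichlet g ->
        eq_on_disc (T (fun z => c * f z + g z)) (fun z => c * T f z + T g z)].

Definition hilbert_schmidt (T : (C -> C) -> C -> C) : Prop :=
  linear_operator T /\
  exists e, orthonormal_basis e /\
    (\sum_(0 <= n <oo) dirichlet_norm2 (T (e n)) < +oo)%E.

Definition comp_diff (phi : C -> C) (f : C -> C) : C -> C :=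
  fun z => derive1 f (phi z).

(* At [w = phi 0] this takes the value given by the same formula; it is [+oo]
   there if [phi] is constant. *)
Definition nevanlinna (phi : C -> C) (w : C) : \bar R :=
  (\esum_(z in [set z | disc z /\ phi z = w])
     ((1 - modC z ^+ 2) `^ alpha)%:E)%E.

End DirichletSpace.

Section Area.
Variable R : realType.

Definition toC (p : measurableTypeR R * measurableTypeR R) : Cplx R := (p.1 +i* p.2)%C.

Lemma pi_inv_ge0 : 0 <= (pi : R)^-1.
Proof. by rewrite invr_ge0 pi_ge0. Qed.

(* Lebesgue area measure, normalized so that the disc has measure 1. *)
Definition area : {measure set (measurableTypeR R * measurableTypeR R) -> \bar R} :=
  mscale (NngNum pi_inv_ge0)
    (@lebesgue_measure R \x @lebesgue_measure R)%E.

End Area.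

(* Main.v *)
Require Import Defs.
From HB Require Import structures.
From mathcomp Require Import all_boot all_order all_algebra.
From mathcomp Require Import all_classical all_reals all_analysis.
From mathcomp Require Import complex measurable_realfun beta_distribution.
From mathcomp Require Import ring lra zify.
Import Order.TTheory GRing.Theory Num.Theory.
Import numFieldNormedType.Exports.
Local Open Scope classical_set_scope.
Local Open Scope ring_scope.

Set Implicit Arguments.
Unset Strict Implicit.
Unset Printing Implicit Defensive.

(* Write u(z) = (1 - |z|^2)^alpha and g(w) = (1 - |w|^2)^-(alpha + 4), and let J be the integral of
   g(phi) |phi'|^2 u over the disc.

   Parseval's formula on the disc makes the squared norm of f comparable to |f(0)|^2 plus the integral
   of |f'|^2 u. As (f' o phi)' = f''(phi) phi', the Hilbert-Schmidt sum over an orthonormal basis (e_k)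
   is comparable, up to a finite term, to the integral of (sum_k |e_k''(phi)|^2) |phi'|^2 u, and
   sum_k |e_k''(w)|^2, the squared norm of the functional f |-> f''(w), is comparable to g(w). Hence
   D_phi is Hilbert-Schmidt if and only if J is finite. When J is finite, the same estimate shows that
   the Taylor polynomials of f are mapped to a Cauchy sequence, so f' o phi is in the space.

   J is comparable to the counting integral by a change of variables that never needs the counting
   function to be measurable. On a small square where phi is nearly affine, phi is injective, and its
   image contains and is contained in squares of side comparable to |phi'| times the mesh. Both
   integrals are thus compared with step functions, and Fatou's lemma lets the mesh tend to 0: every
   point with phi' <> 0 is eventually in such a square, and the critical values form a null set. *)

(** * Moduli, limits and power series in the complex plane *)

(** The exponent [alpha + 4] is read off the coefficients: the functional f |-> f''(w) has squared
    norm sum_n (n (n-1))^2 |w|^(2n-4) / [weight] n, whose coefficients grow like n^(3 + alpha),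
    hence the order (1 - |w|^2)^-(alpha + 4). The definition of Hilbert-Schmidt supplies one unknown
    orthonormal basis, so necessity requires a lower bound for sum_k |e_k''(w)|^2 valid for every
    basis, whereas sufficiency may choose the normalized monomials. All functions are handled
    through their coefficient sequences, so that differentiation, products and composition rest on
    explicit estimates of series. On the measure side, averages over dyadic roots of unity isolate
    the diagonal terms, and the substitution t = |z|^2 does the work of polar coordinates. Only
    comparability matters: real powers are trapped between polynomials, for which Beta integrals and
    negative binomial series are exact, and the constants 4/25, 30 and 8/15 originate there. *)

Section ComplexModulus.
Variable R : realType.
Local Notation C := R[i].
Implicit Types (x y z : C).

Lemma normc_ge0 x : 0 <= modC x.
Proof. by case: x => a b; exact: sqrtr_ge0. Qed.

Lemma normcM x y : modC (x * y) = modC x * modC y.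
Proof. exact: Normc.normcM. Qed.

Lemma normcX x n : modC (x ^+ n) = modC x ^+ n.
Proof.
by elim: n => [|n IH]; rewrite ?expr0 ?Normc.normc1// !exprS normcM IH.
Qed.

Lemma normcD x y : modC (x + y) <= modC x + modC y.
Proof. exact: le_normcD. Qed.

Lemma normcN x : modC (- x) = modC x.
Proof. exact: normcN. Qed.

Lemma normcB x y : modC (x - y) <= modC x + modC y.
Proof. by rewrite -(normcN y) normcD. Qed.

Lemma normcBC x y : modC (x - y) = modC (y - x).
Proof. by rewrite -normcN opprB. Qed.

Lemma normc_triangle z x y : modC (x - y) <= modC (x - z) + modC (z - y).
Proof. by rewrite -[x - y](subrKA z) normcD. Qed.

Lemma normc_sum (I : Type) (r : seq I) (P : pred I) (F : I -> C) :
  modC (\sum_(i <- r | P i) F i) <= \sum_(i <- r | P i) modC (F i).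
Proof.
elim/big_rec2: _ => [|i a b _ h]; first by rewrite Normc.normc0.
by rewrite (le_trans (normcD _ _))// lerD2l.
Qed.

Lemma normc_real (a : R) : modC a%:C%C = `|a|.
Proof. by rewrite /Normc.normc/= expr0n/= addr0 sqrtr_sqr. Qed.

Lemma normc_nat n : modC (n%:R : C) = n%:R.
Proof.
by rewrite (_ : n%:R = (n%:R : R)%:C%C :> C) ?normc_real ?normr_nat// rmorph_nat.
Qed.

Lemma normc_conj x : modC (x^*)%C = modC x.
Proof. by case: x => a b /=; rewrite sqrrN. Qed.

Lemma sqr_normcE z : modC z ^+ 2 = complex.Re z ^+ 2 + complex.Im z ^+ 2.
Proof. by case: z => a b /=; rewrite sqr_sqrtr// addr_ge0// sqr_ge0. Qed.

Lemma normr_Re_le z : `|complex.Re z| <= modC z.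
Proof.
rewrite -(ler_pXn2r (ltn0Sn 1)) ?nnegrE ?normc_ge0// sqr_normcE real_normK ?num_real//.
by rewrite lerDl sqr_ge0.
Qed.

Lemma normr_Im_le z : `|complex.Im z| <= modC z.
Proof.
rewrite -(ler_pXn2r (ltn0Sn 1)) ?nnegrE ?normc_ge0// sqr_normcE real_normK ?num_real//.
by rewrite lerDr sqr_ge0.
Qed.

Lemma normc_le_ReIm z : modC z <= `|complex.Re z| + `|complex.Im z|.
Proof.
rewrite -(ler_pXn2r (ltn0Sn 1)) ?nnegrE ?normc_ge0 ?addr_ge0// sqr_normcE.
rewrite sqrrD -(real_normK (num_real (complex.Re z))) -(real_normK (num_real (complex.Im z))).
by rewrite lerD2r lerDl mulrn_wge0// mulr_ge0.
Qed.

Lemma mul_conjc z : z * z^*%C = (modC z ^+ 2)%:C%C.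
Proof.
rewrite sqr_normcE; case: z => a b; apply/eqP; rewrite eq_complex /=.
by apply/andP; split; apply/eqP; ring.
Qed.

Lemma normc_eq0 z : (modC z == 0) = (z == 0).
Proof.
apply/eqP/eqP => [/Normc.eq0_normc//|->]; exact: Normc.normc0.
Qed.

Lemma normc_gt0 z : (0 < modC z) = (z != 0).
Proof. by rewrite lt_neqAle normc_ge0 andbT eq_sym normc_eq0. Qed.

End ComplexModulus.

Section ComplexLimits.
Variable R : realType.
Local Notation C := R[i].

(** The norm of [Cplx R] takes values in [R[i]], so its epsilons are complex numbers; a positive one
    has zero imaginary part. Trading them for real epsilons lets later limits be treated as real
    limits of moduli. *)
Lemma cvgCP (u : nat -> Cplx R) (l : Cplx R) :
  u @ \oo --> l <-> (fun n => modC (u n - l)) @ \oo --> (0 : R).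
Proof.
split=> [/cvgrPdist_lt h|/cvgrPdist_lt h].
  apply/cvgrPdist_lt => e e0.
  have /h : 0 < e%:C%C :> C by rewrite ltcR.
  apply: filterS => n /=; rewrite sub0r normrN (ger0_norm (normc_ge0 _)).
  by rewrite normcBC -ltcR.
apply/cvgrPdist_lt => e e0.
have [e' e'0 ->] : exists2 e' : R, 0 < e' & e = e'%:C%C.
  case: e e0 => a b; rewrite ltcE/= => /andP[/eqP-> a0]; by exists a.
have := h _ e'0; apply: filterS => n; rewrite sub0r normrN (ger0_norm (normc_ge0 _)).
by rewrite normcBC -ltcR.
Qed.

Lemma cvgC_unique (u : nat -> C) (l l' : C) :
  (fun n => modC (u n - l)) @ \oo --> (0 : R) ->
  (fun n => modC (u n - l')) @ \oo --> (0 : R) -> l = l'.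
Proof.
move=> h h'; apply/eqP; rewrite -subr_eq0 -normc_eq0; apply/eqP.
have h2 : (fun n => modC (u n - l) + modC (u n - l')) @ \oo --> (0 + 0 : R) by apply: cvgD.
apply/eqP; rewrite eq_le normc_ge0 andbT -[leRHS](addr0 0).
rewrite -(cvg_lim _ h2)//; apply: limr_ge; first by apply/cvg_ex; exists (0+0).
apply: nearW => n; rewrite (normcBC (u n) l); exact: normc_triangle.
Qed.

Lemma cvgC_normc (u : nat -> C) (l : C) :
  (fun n => modC (u n - l)) @ \oo --> (0 : R) -> (fun n => modC (u n)) @ \oo --> modC l.
Proof.
move=> h; apply/cvgrPdist_le => e e0.
move/cvgrPdist_le : h => /(_ _ e0); apply: filterS => n.
rewrite sub0r normrN (ger0_norm (normc_ge0 _)) => h; apply: le_trans h.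
rewrite ler_norml; apply/andP; split.
  rewrite lerBrDr addrC -lerBrDr opprK addrC.
  by have := normcD (u n - l) l; rewrite subrK.
rewrite lerBlDr normcBC.
by have := normcD (l - u n) (u n); rewrite subrK.
Qed.

Lemma cvgC_le (u : nat -> C) (l : C) (B : R) :
  (fun n => modC (u n - l)) @ \oo --> (0 : R) -> (\forall n \near \oo, modC (u n) <= B) -> modC l <= B.
Proof.
move=> /cvgC_normc h hB; rewrite -(cvg_lim _ h)//.
by apply: limr_le => //; apply/cvg_ex; exists (modC l).
Qed.

(** This is the form in which Taylor estimates with a quadratic error deliver a derivative: no
    quotient, and a real tolerance. *)
Lemma derive1C (f : Cplx R -> Cplx R) (z d : Cplx R) :
  (forall e : R, 0 < e -> exists2 del : R, 0 < del & forall h : C, modC h < del ->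
     modC (f (h + z) - f z - d * h) <= e * modC h) ->
  derivable f z 1 /\ derive1 f z = d.
Proof.
move=> H.
have K : (h^-1 *: (f (h + z) - f z)) @[h --> (0 : Cplx R)^'] --> d.
  apply/cvgrPdist_le => e e0.
  have [e' e'0 ->] : exists2 e' : R, 0 < e' & e = e'%:C%C.
    case: e e0 => a b; rewrite ltcE/= => /andP[/eqP-> a0]; by exists a.
  have [del del0 hd] := H _ e'0.
  have d0 : 0 < del%:C%C :> C by rewrite ltcR.
  near=> h.
  have h0 : h != 0 by near: h; exact: nbhs_dnbhs_neq.
  have hdel : modC h < del.
    rewrite -ltcR; near: h; exact: dnbhs0_lt.
  rewrite [X in X <= _](_ : _ = (modC (d - h^-1 *: (f (h + z) - f z)))%:C%C)// lecR.
  have h0' : 0 < modC h by rewrite normc_gt0.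
  rewrite -(ler_pM2r h0') -normcM (le_trans _ (hd _ hdel))//.
  rewrite [X in modC X <= _](_ : _ = - (f (h + z) - f z - d * h)) ?normcN//.
  rewrite mulrBl opprB; congr (_ - _).
  by rewrite /GRing.scale/= mulrAC mulVf// mul1r.
split.
  apply/cvg_ex; exists d.
  rewrite (_ : (fun h : Cplx R => _) = fun h => h^-1 *: (f (h + z) - f z))//.
  by apply/funext => h /=; rewrite /GRing.scale/= mulr1.
by apply/cvg_lim; [exact: norm_hausdorff|exact: K].
Unshelve. all: by end_near. Qed.

End ComplexLimits.

Section ComplexComplete.
Variable R : realType.
Local Notation C := R[i].

Lemma real_cauchy_cvg (u : nat -> R) :
  (forall e, 0 < e -> exists N, forall n, (N <= n)%N -> `|u n - u N| <= e) ->
  exists l : R, u @ \oo --> l.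
Proof.
move=> H; have : cvg (u @ \oo); last by move/cvg_ex.
apply/cauchy_cvgP/cauchy_exP => e e0.
have e2 : 0 < e / 2 by rewrite divr_gt0.
have [N HN] := H _ e2; exists (u N); exists N => // n /= Nn.
by rewrite /ball/= distrC (le_lt_trans (HN _ Nn))// ltr_pdivrMr// ltr_pMr// ltr1n.
Qed.

Lemma cauchyC (u : nat -> C) :
  (forall e : R, 0 < e -> exists N, forall n, (N <= n)%N -> modC (u n - u N) <= e) ->
  exists l, (fun n => modC (u n - l)) @ \oo --> (0 : R).
Proof.
move=> H.
have [a ha] : exists a : R, (fun n => complex.Re (u n)) @ \oo --> a.
  apply: real_cauchy_cvg => e /H[N HN]; exists N => n /HN; apply: le_trans.
  by rewrite (_ : _ - _ = complex.Re (u n - u N)) ?normr_Re_le//; case: (u n); case: (u N).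
have [b hb] : exists b : R, (fun n => complex.Im (u n)) @ \oo --> b.
  apply: real_cauchy_cvg => e /H[N HN]; exists N => n /HN; apply: le_trans.
  by rewrite (_ : _ - _ = complex.Im (u n - u N)) ?normr_Im_le//; case: (u n); case: (u N).
exists (a +i* b)%C.
have h2 : (fun n => `|complex.Re (u n) - a| + `|complex.Im (u n) - b|) @ \oo --> (`|a - a| + `|b - b| : R).
  by apply: cvgD; apply: cvg_norm; apply: cvgB => //; exact: cvg_cst.
rewrite !subrr normr0 addr0 in h2.
apply: (squeeze_cvgr _ (cvg_cst 0) h2); apply: nearW => n; rewrite normc_ge0/=.
apply: (le_trans (normc_le_ReIm _)).
by case: (u n).
Qed.

Lemma normc_summable_cvg (u : nat -> C) (M : R) :
  (forall n, \sum_(i < n) modC (u i) <= M) ->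
  exists l, (fun n => modC (\sum_(i < n) u i - l)) @ \oo --> (0 : R).
Proof.
move=> HM.
have nd : nondecreasing_seq (fun n => \sum_(i < n) modC (u i)).
  by apply/nondecreasing_seqP => n; rewrite big_ord_recr/= lerDl normc_ge0.
have cv : cvg ((fun n => \sum_(i < n) modC (u i)) @ \oo).
  by apply: nondecreasing_is_cvgn => //; exists M => _ [n _ <-].
apply: cauchyC => e e0.
have /cvgrPdist_le /(_ _ e0)[N _ HN] := cv.
exists N => n Nn.
have -> : \sum_(i < n) u i - \sum_(i < N) u i = \sum_(N <= i < n) u i.
  by rewrite -!(big_mkord predT u) (big_cat_nat (leq0n N) Nn)/= addrAC subrr add0r.
apply: (le_trans (normc_sum _ _ _)).
have -> : \sum_(N <= i < n) modC (u i) = \sum_(i < n) modC (u i) - \sum_(i < N) modC (u i).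
  rewrite -!(big_mkord predT (fun i => modC (u i))) (big_cat_nat (leq0n N) Nn)/=.
  by rewrite addrAC subrr add0r.
apply: le_trans (HN N (leqnn N)).
apply: le_trans (ler_norm _); rewrite lerD2r.
exact: (nondecreasing_cvgn_le nd cv).
Qed.

End ComplexComplete.

(** * Power series converging in the unit disc *)

Section PowerSeries.
Variable R : realType.
Local Notation C := R[i].
Implicit Types (a b : nat -> C) (z w : C) (r s : R).

Lemma geometric_sum_le r n : 0 <= r < 1 -> \sum_(i < n) r ^+ i <= (1 - r)^-1.
Proof.
move=> /andP[r0 r1]; have h : 0 < 1 - r by rewrite subr_gt0.
rewrite -(ler_pM2l h) mulfV ?gt_eqF//.
have -> : (1 - r) * \sum_(i < n) r ^+ i = 1 - r ^+ n by rewrite -[LHS]opprK -mulNr opprB -subrX1 opprB.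
by rewrite lerBlDr lerDl exprn_ge0.
Qed.

(** Each of the n + 1 terms of the geometric sum up to r^n is at least r^n. *)
Lemma natX_le r n : 0 <= r < 1 -> n.+1%:R * r ^+ n <= (1 - r)^-1.
Proof.
move=> hr; have /andP[r0 r1] := hr.
apply: le_trans (geometric_sum_le n.+1 hr).
have -> : n.+1%:R * r ^+ n = \sum_(i < n.+1) r ^+ n by rewrite sumr_const card_ord mulr_natl.
apply: ler_sum => i _.
by apply: ler_wiXn2l; rewrite ?(ltW r1)// -ltnS.
Qed.

(* The sequence of coefficients of a power series converging on the unit disc. *)
Definition psd a := forall r, 0 <= r < 1 -> exists M, forall n, modC (a n) * r ^+ n <= M.

Lemma mid_lt1 r : 0 <= r < 1 -> [/\ r < (r + 1) / 2, 0 < (r + 1) / 2 & (r + 1) / 2 < 1].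
Proof. by move=> /andP[? ?]; split; lra. Qed.

Lemma psd_le a b : psd a -> (forall n, modC (b n) <= modC (a n)) -> psd b.
Proof.
move=> ha h r hr; have [M HM] := ha _ hr; exists M => n.
by apply: le_trans (HM n); rewrite ler_wpM2r// exprn_ge0//; case/andP: hr.
Qed.

Lemma exprn_split r n s : 0 < s -> r ^+ n = s ^+ n * (r / s) ^+ n.
Proof. by move=> s0; rewrite -exprMn mulrC divfK// gt_eqF. Qed.

Lemma psd_summable a r : psd a -> 0 <= r < 1 ->
  exists2 M, 0 <= M & forall n, \sum_(i < n) modC (a i) * r ^+ i <= M.
Proof.
move=> ha hr; have [rs s0 s1] := mid_lt1 hr; have /andP[r0 r1] := hr.
set s := (r + 1) / 2 in rs s0 s1 *.
have [|M HM] := ha s; first by rewrite ltW.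
have M0 : 0 <= M by apply: le_trans (HM 0%N); rewrite expr0 mulr1 normc_ge0.
have q01 : 0 <= r / s < 1 by rewrite divr_ge0 ?(ltW s0)//= ltr_pdivrMr// mul1r.
exists (M * (1 - r / s)^-1) => [|n].
  by rewrite mulr_ge0// invr_ge0 subr_ge0 ltW//; case/andP: q01.
apply: le_trans (ler_wpM2l M0 (geometric_sum_le n q01)); rewrite mulr_sumr.
apply: ler_sum => i _; rewrite (exprn_split r i s0) mulrA.
by apply: ler_wpM2r => //; rewrite exprn_ge0// divr_ge0// ltW.
Qed.

(** The factor n + 1 is absorbed by enlarging the radius: for r < s < 1 the numbers (n + 1) (r /
    s)^n are bounded. *)
Lemma psd_natM a : psd a -> psd (fun n => n.+1%:R * a n).
Proof.
move=> ha r hr; have [rs s0 s1] := mid_lt1 hr; have /andP[r0 r1] := hr.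
set s := (r + 1) / 2 in rs s0 s1 *.
have [|M HM] := ha s; first by rewrite ltW.
have M0 : 0 <= M by apply: le_trans (HM 0%N); rewrite expr0 mulr1 normc_ge0.
have q01 : 0 <= r / s < 1 by rewrite divr_ge0 ?(ltW s0)//= ltr_pdivrMr// mul1r.
exists (M * (1 - r / s)^-1) => n; rewrite normcM normc_nat.
rewrite [leLHS](_ : _ = (modC (a n) * s ^+ n) * (n.+1%:R * (r / s) ^+ n)).
  by apply: ler_pM => //; rewrite ?mulr_ge0 ?normc_ge0 ?exprn_ge0 ?(ltW s0)//;
    [case/andP: q01|exact: natX_le].
by rewrite (exprn_split r n s0); ring.
Qed.

Lemma psd_shift a : psd a -> psd (fun n => a n.+1).
Proof.
move=> ha r hr; have [rs s0 s1] := mid_lt1 hr; have /andP[r0 r1] := hr.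
set s := (r + 1) / 2 in rs s0 s1 *.
have [|M HM] := ha s; first by rewrite ltW.
exists (M / s) => n; rewrite ler_pdivlMr//; apply: le_trans (HM n.+1).
rewrite (_ : modC (a n.+1) * s ^+ n.+1 = modC (a n.+1) * s ^+ n * s); last by rewrite exprSr mulrA.
apply: ler_wpM2r; first exact: ltW.
apply: ler_wpM2l; first exact: normc_ge0.
by rewrite lerXn2r ?nnegrE// ltW.
Qed.

Definition psder a : nat -> C := fun n => n.+1%:R * a n.+1.

Lemma psd_der a : psd a -> psd (psder a).
Proof.
move=> /psd_natM/psd_shift h; apply: psd_le h _ => n; rewrite /psder !normcM !normc_nat.
by rewrite ler_wpM2r ?normc_ge0// ler_nat.
Qed.

Lemma psd_lin (c : C) a b : psd a -> psd b -> psd (fun n => c * a n + b n).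
Proof.
move=> ha hb r hr; have [M HM] := ha _ hr; have [M' HM'] := hb _ hr.
have /andP[r0 _] := hr.
exists (modC c * M + M') => n.
apply: (@le_trans _ _ ((modC (c * a n) + modC (b n)) * r ^+ n)).
  by rewrite ler_wpM2r ?normcD// exprn_ge0.
by rewrite normcM mulrDl -mulrA lerD// ler_wpM2l// normc_ge0.
Qed.

Definition psum a z : C := limn (series (fun n => a n * z ^+ n : Cplx R)).

Lemma psum_cvg a z : psd a -> modC z < 1 ->
  (fun n => modC (\sum_(i < n) a i * z ^+ i - psum a z)) @ \oo --> (0 : R).
Proof.
move=> ha z1.
have hz : 0 <= modC z < 1 by rewrite normc_ge0.
have [M M0 HM] := psd_summable ha hz.
have [n|l hl] := @normc_summable_cvg R (fun i => a i * z ^+ i) M.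
  by apply: le_trans (HM n); apply: ler_sum => i _; rewrite normcM normcX.
have hl' : (fun n => \sum_(i < n) a i * z ^+ i : Cplx R) @ \oo --> (l : Cplx R) by apply/cvgCP.
suff -> : psum a z = l by [].
apply: (@cvg_lim (Cplx R)); first exact: norm_hausdorff.
by rewrite /series/=; under eq_fun do rewrite big_mkord.
Qed.

Lemma psum_unique a z l : psd a -> modC z < 1 ->
  (fun n => modC (\sum_(i < n) a i * z ^+ i - l)) @ \oo --> (0 : R) -> psum a z = l.
Proof. by move=> ha z1; apply: cvgC_unique; exact: psum_cvg. Qed.

Lemma psum_le a z (B : R) : psd a -> modC z < 1 ->
  (forall n, modC (\sum_(i < n) a i * z ^+ i) <= B) -> modC (psum a z) <= B.
Proof.
by move=> ha z1 H; apply: (cvgC_le (psum_cvg ha z1)); apply: nearW.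
Qed.

Lemma psum_lin (c : C) a b z : psd a -> psd b -> modC z < 1 ->
  psum (fun n => c * a n + b n) z = c * psum a z + psum b z.
Proof.
move=> ha hb z1; apply: psum_unique => //; first exact: psd_lin.
have h : (fun n => modC c * modC (\sum_(i < n) a i * z ^+ i - psum a z)
    + modC (\sum_(i < n) b i * z ^+ i - psum b z)) @ \oo --> (modC c * 0 + 0 : R).
  by apply: cvgD; [apply: cvgMl_tmp|]; exact: psum_cvg.
rewrite mulr0 addr0 in h.
apply: (squeeze_cvgr _ (cvg_cst 0) h); apply: nearW => n; rewrite normc_ge0/=.
rewrite -normcM; apply: le_trans (normcD _ _); rewrite le_eqVlt; apply/orP; left; apply/eqP.
rewrite mulrBr mulr_sumr addrACA -opprD -big_split/=; congr (modC (_ - _)).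
by apply: eq_bigr => i _; rewrite mulrDl mulrA.
Qed.

(** At a real point r < 1 the general term is a difference of two partial sums, which stay within a
    bounded distance of f(r); this bounds |a_n| r^n. *)
Lemma power_series_psd (f : C -> C) a : power_series_on_disc f a ->
  psd a /\ forall z, modC z < 1 -> f z = psum a z.
Proof.
move=> H.
have H' z : modC z < 1 -> (fun n => modC (\sum_(i < n) a i * z ^+ i - f z)) @ \oo --> (0 : R).
  move=> z1; have /cvgCP := H z z1.
  by rewrite /series/=; under eq_fun do rewrite big_mkord.
have ha : psd a.
  move=> r /andP[r0 r1].
  have z1 : modC (r%:C%C) < 1 by rewrite normc_real ger0_norm.
  have /H' h := z1.
  have /cvg_seq_bounded : cvgn (fun n => modC (\sum_(i < n) a i * r%:C%C ^+ i - f r%:C%C)).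
    by apply/cvg_ex; exists 0.
  move=> [M [_ /(_ (M + 1))]]; rewrite ltrDl => /(_ ltr01) HM.
  exists ((M + 1) + (M + 1)) => n.
  have -> : modC (a n) * r ^+ n = modC (a n * r%:C%C ^+ n).
    by rewrite normcM normcX normc_real ger0_norm.
  have -> : a n * r%:C%C ^+ n = \sum_(i < n.+1) a i * r%:C%C ^+ i - \sum_(i < n) a i * r%:C%C ^+ i.
    by rewrite big_ord_recr/= addrAC subrr add0r.
  apply: (le_trans (normc_triangle (f r%:C%C) _ _)); apply: lerD.
    by have := HM n.+1 I; rewrite /= ger0_norm ?normc_ge0.
  by rewrite normcBC; have := HM n I; rewrite /= ger0_norm ?normc_ge0.
split=> // z z1; apply/esym/psum_unique => //; exact: H'.
Qed.

Lemma psd_power_series (f : C -> C) a : psd a -> (forall z, modC z < 1 -> f z = psum a z) ->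
  power_series_on_disc f a.
Proof.
move=> ha hf z z1; apply/cvgCP; rewrite hf//.
have := psum_cvg ha z1.
by rewrite /series/=; under eq_fun do rewrite -(big_mkord predT (fun i => a i * z ^+ i)).
Qed.

End PowerSeries.

(** * Differentiation and multiplication of power series *)

Section PowerSeriesCalculus.
Variable R : realType.
Local Notation C := R[i].
Implicit Types (a b : nat -> C) (z w : C) (r s : R).

Lemma cvgC_lin (c : C) (u v : nat -> C) (l m : C) :
  (fun n => modC (u n - l)) @ \oo --> (0 : R) ->
  (fun n => modC (v n - m)) @ \oo --> (0 : R) ->
  (fun n => modC (c * u n + v n - (c * l + m))) @ \oo --> (0 : R).
Proof.
move=> hu hv.
have h : (fun n => modC c * modC (u n - l) + modC (v n - m)) @ \oo --> (modC c * 0 + 0 : R).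
  by apply: cvgD => //; exact: cvgMl_tmp.
rewrite mulr0 addr0 in h.
apply: (squeeze_cvgr _ (cvg_cst 0) h); apply: nearW => n; rewrite normc_ge0/=.
by rewrite -normcM opprD addrACA -mulrBr normcD.
Qed.

(** This is the mean value bound n s^(n-1) |z - c|, multiplied by [s] so that the exponent n - 1
    does not occur. *)
Lemma subX_le s z c n : modC z <= s -> modC c <= s ->
  modC (z ^+ n - c ^+ n) * s <= n%:R * s ^+ n * modC (z - c).
Proof.
move=> zs cs; have s0 : 0 <= s := le_trans (normc_ge0 z) zs.
rewrite subrXX normcM; case: n => [|n].
  by rewrite big_ord0 Normc.normc0 mulr0 !mul0r.
rewrite -mulrA mulrC; apply: ler_wpM2r; first exact: normc_ge0.
rewrite exprSr mulrA; apply: ler_wpM2r => //.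
apply: (le_trans (normc_sum _ _ _)).
have -> : n.+1%:R * s ^+ n = \sum_(i < n.+1) s ^+ n by rewrite sumr_const card_ord mulr_natl.
apply: ler_sum => i _; rewrite normcM !normcX /=.
have -> : s ^+ n = s ^+ (n - i) * s ^+ i by rewrite -exprD subnK// -ltnS.
by apply: ler_pM; rewrite ?exprn_ge0 ?normc_ge0//; apply: lerXn2r; rewrite ?nnegrE ?normc_ge0.
Qed.

(** The divided difference of z^(n+1) is a sum of n + 1 products z^(n-i) w^i, and each differs from
    c^n by at most n s^(n-1) D. *)
Lemma monomial_taylor s z w c n (D : R) : modC z <= s -> modC w <= s -> modC c <= s ->
  modC (z - c) <= D -> modC (w - c) <= D ->
  modC (z ^+ n.+1 - w ^+ n.+1 - n.+1%:R * c ^+ n * (z - w)) * s <=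
  n.+1%:R * n.+1%:R * s ^+ n * D * modC (z - w).
Proof.
move=> zs ws cs zD wD; have s0 : 0 <= s := le_trans (normc_ge0 z) zs.
have D0 : 0 <= D := le_trans (normc_ge0 _) zD.
rewrite subrXX /= [_ * (z - w)]mulrC -mulrBr normcM.
rewrite -mulrA mulrC; apply: ler_wpM2r; first exact: normc_ge0.
have -> : n.+1%:R * c ^+ n = \sum_(i < n.+1) c ^+ n by rewrite sumr_const card_ord mulr_natl.
rewrite -sumrB.
apply: (@le_trans _ _ (\sum_(i < n.+1) (modC (z ^+ (n - i) * w ^+ i - c ^+ n) * s))).
  by rewrite -mulr_suml; apply: ler_wpM2r => //; exact: normc_sum.
have -> : n.+1%:R * n.+1%:R * s ^+ n * D = \sum_(i < n.+1) (n.+1%:R * s ^+ n * D).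
  by rewrite sumr_const card_ord -[RHS]mulr_natl !mulrA.
apply: ler_sum => -[i /= ilt] _; have ile : (i <= n)%N by rewrite -ltnS.
have -> : z ^+ (n - i) * w ^+ i - c ^+ n =
   z ^+ (n - i) * (w ^+ i - c ^+ i) + c ^+ i * (z ^+ (n - i) - c ^+ (n - i)).
  have -> : c ^+ n = c ^+ i * c ^+ (n - i) by rewrite -exprD subnKC.
  by rewrite !mulrBr addrA [c ^+ i * z ^+ _]mulrC subrK.
apply: (@le_trans _ _ (s ^+ (n - i) * (i%:R * s ^+ i * D) + s ^+ i * ((n - i)%:R * s ^+ (n - i) * D))).
  apply: (@le_trans _ _ ((modC (z ^+ (n - i) * (w ^+ i - c ^+ i)) + modC (c ^+ i * (z ^+ (n - i) - c ^+ (n - i)))) * s)).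
    by apply: ler_wpM2r => //; exact: normcD.
  rewrite mulrDl !normcM !normcX -!mulrA; apply: lerD.
    apply: ler_pM; rewrite ?exprn_ge0 ?normc_ge0 ?mulr_ge0 ?normc_ge0//.
      by apply: lerXn2r; rewrite ?nnegrE ?normc_ge0.
    apply: (le_trans (subX_le _ ws cs)); rewrite -mulrA; apply: ler_wpM2l => //.
    by apply: ler_wpM2l => //; rewrite exprn_ge0.
  apply: ler_pM; rewrite ?exprn_ge0 ?normc_ge0 ?mulr_ge0 ?normc_ge0//.
    by apply: lerXn2r; rewrite ?nnegrE ?normc_ge0.
  apply: (le_trans (subX_le _ zs cs)); rewrite -mulrA; apply: ler_wpM2l => //.
  by apply: ler_wpM2l => //; rewrite exprn_ge0.
have hs : s ^+ n = s ^+ (n - i) * s ^+ i by rewrite -exprD subnK.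
rewrite [leLHS](_ : _ = (i%:R + (n - i)%:R) * (s ^+ n * D)); last by rewrite hs; ring.
rewrite -natrD subnKC// -mulrA; apply: ler_wpM2r; first by rewrite mulr_ge0// exprn_ge0.
by rewrite ler_nat.
Qed.

(** The derivative is taken at a third point [c]. With [w = c] this gives differentiability; with
    [c] the center of a square it says that the map is uniformly close to an affine one there. *)
Lemma psum_taylor a s : psd a -> 0 < s < 1 -> exists2 K : R, 0 <= K &
  forall z w c D, modC z <= s -> modC w <= s -> modC c <= s ->
    modC (z - c) <= D -> modC (w - c) <= D ->
    modC (psum a z - psum a w - psum (psder a) c * (z - w)) <= K * D * modC (z - w).
Proof.
move=> ha /andP[s0 s1].
have hb := psd_natM (psd_der ha).
have s01 : 0 <= s < 1 by rewrite (ltW s0).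
have [M M0 HM] := psd_summable hb s01.
exists (M / s) => [|z w c D zs ws cs zD wD]; first by rewrite divr_ge0 // ltW.
have D0 : 0 <= D := le_trans (normc_ge0 _) zD.
have lt1 x : modC x <= s -> modC x < 1 by move=> /le_lt_trans; apply.
(* The partial sums of [psum a] run one term further than those of the derivative: once the constant
   terms cancel, both range over the same [i < n]. *)
pose u n := - (z - w) * (\sum_(i < n) psder a i * c ^+ i) +
   (-1 * (\sum_(i < n.+1) a i * w ^+ i) + \sum_(i < n.+1) a i * z ^+ i).
have hu : (fun n => modC (u n - (- (z - w) * psum (psder a) c + (-1 * psum a w + psum a z)))) @ \oo --> (0 : R).
  apply: cvgC_lin; first by apply: psum_cvg; [exact: psd_der|exact: lt1].
  have h := psum_cvg ha (lt1 _ zs); rewrite -cvg_shiftS in h.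
  have h' := psum_cvg ha (lt1 _ ws); rewrite -cvg_shiftS in h'.
  exact: (cvgC_lin (-1) (u := fun n => \sum_(i < n.+1) a i * w ^+ i)
    (v := fun n => \sum_(i < n.+1) a i * z ^+ i) h' h).
rewrite [X in modC X](_ : _ = (- (z - w) * psum (psder a) c + (-1 * psum a w + psum a z))); last first.
  by move: (psum a z) (psum a w) (psum (psder a) c) => x y p; ring.
apply: (cvgC_le hu); apply: nearW => n.
have -> : u n = \sum_(i < n) a i.+1 * (z ^+ i.+1 - w ^+ i.+1 - i.+1%:R * c ^+ i * (z - w)).
  rewrite /u !big_ord_recl/= !expr0 mulrDr addrACA mulN1r addNr add0r mulN1r.
  rewrite mulr_sumr -sumrN -!big_split/=; apply: eq_bigr => i _.
  by rewrite /psder/bump/= !add1n; ring.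
rewrite -(ler_pM2r s0).
rewrite [leRHS](_ : _ = M * D * modC (z - w)); last by field; rewrite gt_eqF.
apply: (@le_trans _ _ (\sum_(i < n) (modC (a i.+1) * (modC (z ^+ i.+1 - w ^+ i.+1 - i.+1%:R * c ^+ i * (z - w)) * s)))).
  apply: (le_trans (ler_wpM2r (ltW s0) (normc_sum _ _ _))); rewrite mulr_suml.
  by apply: ler_sum => i _; rewrite normcM mulrA.
apply: (@le_trans _ _ ((\sum_(i < n) modC (i.+1%:R * psder a i) * s ^+ i) * D * modC (z - w))).
  rewrite -mulrA mulr_suml; apply: ler_sum => i _.
  rewrite !normcM !normc_nat.
  rewrite [leRHS](_ : _ = modC (a i.+1) * (i.+1%:R * i.+1%:R * s ^+ i * D * modC (z - w))); last by ring.
  apply: ler_wpM2l; first exact: normc_ge0.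
  exact: monomial_taylor.
by rewrite -!mulrA; apply: ler_wpM2r; rewrite ?mulr_ge0 ?normc_ge0.
Qed.

Lemma psum_derive a (f : Cplx R -> Cplx R) z : psd a ->
  (forall z, modC z < 1 -> f z = psum a z) -> modC z < 1 ->
  derivable f z 1 /\ derive1 f z = psum (psder a) z.
Proof.
move=> ha hf z1; have z01 : 0 <= modC z < 1 by rewrite normc_ge0.
have [zs s0 s1] := mid_lt1 z01; set s := (modC z + 1) / 2 in zs s0 s1.
have s01 : 0 < s < 1 by rewrite s0.
have [K K0 HK] := psum_taylor ha s01.
apply: derive1C => e e0.
exists (Num.min (s - modC z) (e / (K + 1))) => [|h].
  by rewrite lt_min subr_gt0 zs divr_gt0// ltr_wpDl.
rewrite lt_min => /andP[h1 h2].
have hz : modC (h + z) <= s.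
  by apply: (le_trans (normcD _ _)); rewrite -lerBrDr ltW.
rewrite !hf//; last by rewrite (le_lt_trans hz).
have := HK (h + z) z z (modC h) hz (ltW zs) (ltW zs).
rewrite addrK subrr Normc.normc0 => /(_ (lexx _) (normc_ge0 _)) /le_trans; apply.
apply: ler_wpM2r; first exact: normc_ge0.
apply: (@le_trans _ _ ((K + 1) * modC h)).
  by apply: ler_wpM2r; rewrite ?normc_ge0 ?lerDl.
by rewrite mulrC -ler_pdivlMr ?ltW// ltr_wpDl.
Qed.

Definition psconv a b : nat -> C := fun n => \sum_(i < n.+1) a i * b (n - i)%N.

Lemma psd_conv a b : psd a -> psd b -> psd (psconv a b).
Proof.
move=> ha hb r hr; have [M M0 HM] := psd_summable ha hr; have [M' HM'] := hb r hr.
have /andP[r0 _] := hr.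
have M'0 : 0 <= M' by apply: le_trans (HM' 0%N); rewrite expr0 mulr1 normc_ge0.
exists (M * M') => n; apply: (@le_trans _ _ (\sum_(i < n.+1) modC (a i) * r ^+ i * M')).
  apply: (@le_trans _ _ ((\sum_(i < n.+1) modC (a i * b (n - i)%N)) * r ^+ n)).
    by apply: ler_wpM2r; [exact: exprn_ge0|exact: normc_sum].
  rewrite mulr_suml; apply: ler_sum => i _; rewrite normcM.
  have -> : r ^+ n = r ^+ i * r ^+ (n - i) by rewrite -exprD subnKC// -ltnS.
  rewrite mulrACA; apply: ler_wpM2l => //.
  by rewrite mulr_ge0 ?normc_ge0 ?exprn_ge0.
by rewrite -mulr_suml; apply: ler_wpM2r.
Qed.

Lemma psconv_partial a b z n :
  \sum_(k < n) psconv a b k * z ^+ k =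
  \sum_(i < n) (a i * z ^+ i) * \sum_(j < n - i) b j * z ^+ j.
Proof.
elim: n => [|n IH]; first by rewrite !big_ord0.
rewrite big_ord_recr/= IH [RHS]big_ord_recr/= subSnn big_ord1 expr0 mulr1.
rewrite /psconv big_ord_recr/= subnn mulrDl addrA; congr (_ + _); last by rewrite mulrAC.
rewrite mulr_suml -big_split/=; apply: eq_bigr => -[i /= lin] _.
rewrite subSn ?(ltnW lin)// [in RHS]big_ord_recr/= mulrDr; congr (_ + _).
have -> : z ^+ n = z ^+ i * z ^+ (n - i) by rewrite -exprD subnKC// ltnW.
by rewrite mulrACA.
Qed.

(** The product of the partial sums differs from the partial sum of the Cauchy product by sum_i a_i
    z^i (B_n - B_(n-i)). With q = |z| / s, the factor a_i z^i carries q^i and the tail carries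
    q^(n-i), so the whole defect is at most M M' q^n. *)
Lemma psum_conv a b z : psd a -> psd b -> modC z < 1 ->
  psum (psconv a b) z = psum a z * psum b z.
Proof.
move=> ha hb z1; have z01 : 0 <= modC z < 1 by rewrite normc_ge0.
have [zs s0 s1] := mid_lt1 z01; set s := (modC z + 1) / 2 in zs s0 s1.
have s01 : 0 <= s < 1 by rewrite ltW.
have [M M0 HM] := psd_summable ha s01; have [M' M'0 HM'] := psd_summable hb s01.
set q := modC z / s.
have q0 : 0 <= q by rewrite divr_ge0 ?normc_ge0 ?ltW.
have q1 : q < 1 by rewrite ltr_pdivrMr// mul1r.
pose A n := \sum_(i < n) a i * z ^+ i; pose B n := \sum_(i < n) b i * z ^+ i.
have tail n i : (i <= n)%N -> modC (B n - B (n - i)%N) <= q ^+ (n - i) * M'.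
  move=> lin.
  have -> : B n - B (n - i)%N = \sum_(n - i <= j < n) b j * z ^+ j.
    rewrite /B -!(big_mkord predT (fun i => b i * z ^+ i)).
    by rewrite (big_cat_nat (leq0n (n - i)%N) (leq_subr i n))/= addrAC subrr add0r.
  apply: (le_trans (normc_sum _ _ _)).
  apply: (@le_trans _ _ (q ^+ (n - i) * \sum_(n - i <= j < n) modC (b j) * s ^+ j)).
    rewrite mulr_sumr !big_nat; apply: ler_sum => j /andP[jl jn].
    rewrite (_ : modC (b j * z ^+ j) = q ^+ j * (modC (b j) * s ^+ j)); last first.
      by rewrite normcM normcX (exprn_split (modC z) j s0) -/q; ring.
    apply: ler_wpM2r.
      by rewrite mulr_ge0 ?normc_ge0 ?exprn_ge0 ?ltW.
    by apply: ler_wiXn2l => //; exact: ltW.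
  apply: ler_wpM2l; first exact: exprn_ge0.
  apply: le_trans (HM' n).
  rewrite -(big_mkord predT (fun j => modC (b j) * s ^+ j)).
  rewrite (big_cat_nat (leq0n (n - i)%N) (leq_subr i n))/= lerDr sumr_ge0// => j _.
  by rewrite mulr_ge0 ?normc_ge0 ?exprn_ge0 ?ltW.
have hAB : (fun n => modC (A n * B n - \sum_(k < n) psconv a b k * z ^+ k)) @ \oo --> (0 : R).
  have h : (fun n => M * M' * q ^+ n) @ \oo --> (M * M' * 0 : R).
    by apply: cvgMl_tmp; apply: cvg_expr; rewrite ger0_norm.
  rewrite mulr0 in h.
  apply: (squeeze_cvgr _ (cvg_cst 0) h); apply: nearW => n; rewrite normc_ge0/=.
  rewrite psconv_partial {1}/A mulr_suml -sumrB.
  apply: (le_trans (normc_sum _ _ _)).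
  apply: (@le_trans _ _ (\sum_(i < n) modC (a i) * s ^+ i * (M' * q ^+ n))); last first.
    by rewrite -mulr_suml -mulrA; apply: ler_wpM2r => //; rewrite mulr_ge0// exprn_ge0.
  apply: ler_sum => -[i /= lin] _; rewrite -mulrBr normcM.
  apply: (@le_trans _ _ (modC (a i) * s ^+ i * q ^+ i * (q ^+ (n - i) * M'))).
    apply: ler_pM; rewrite ?normc_ge0//; last by apply: tail; exact: ltnW.
    by rewrite normcM normcX -mulrA -exprn_split.
  have -> : q ^+ n = q ^+ i * q ^+ (n - i) by rewrite -exprD subnKC// ltnW.
  by rewrite le_eqVlt; apply/orP; left; apply/eqP; ring.
have hA := psum_cvg ha z1; have hB := psum_cvg hb z1.
have h1 : (fun n => modC (A n * B n - psum a z * psum b z)) @ \oo --> (0 : R).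
  have h : (fun n => modC (A n - psum a z) * modC (B n) + modC (psum a z) * modC (B n - psum b z)) @ \oo
      --> (0 * modC (psum b z) + modC (psum a z) * 0 : R).
    by apply: cvgD; [apply: cvgM => //; exact: cvgC_normc|exact: cvgMl_tmp].
  rewrite mul0r mulr0 addr0 in h.
  apply: (squeeze_cvgr _ (cvg_cst 0) h); apply: nearW => n; rewrite normc_ge0/=.
  rewrite -!normcM; apply: le_trans (normcD _ _).
  by rewrite le_eqVlt; apply/orP; left; apply/eqP; congr modC; ring.
apply: psum_unique => //; first exact: psd_conv.
have h : (fun n => modC (A n * B n - \sum_(k < n) psconv a b k * z ^+ k) +
   modC (A n * B n - psum a z * psum b z)) @ \oo --> (0 + 0 : R) by apply: cvgD.
rewrite addr0 in h.
apply: (squeeze_cvgr _ (cvg_cst 0) h); apply: nearW => n; rewrite normc_ge0/=.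
by rewrite (normcBC (A n * B n)); exact: normc_triangle.
Qed.

End PowerSeriesCalculus.

(** * Plane Lebesgue measure under rotations and dilations *)

Section Pushforward.
Context d1 d2 (T1 : measurableType d1) (T2 : measurableType d2) (R : realType).
Variables (mu : {measure set T1 -> \bar R}) (f : T1 -> T2) (mf : measurable_fun setT f).

Definition pushm : {measure set T2 -> \bar R} :=
  measure_function_pushforward__canonical__measure_function_Measure mu mf.

Lemma pushmE A : pushm A = mu (f @^-1` A).
Proof. by []. Qed.

Lemma ge0_integral_pushm (D : set T2) (h : T2 -> \bar R) :
  measurable D -> measurable_fun D h -> (forall y, D y -> (0 <= h y)%E) ->
  (\int[pushm]_(y in D) h y = \int[mu]_(x in f @^-1` D) h (f x))%E.
Proof.
move=> mD mh h0; rewrite -(ge0_integral_pushforward mf)//.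
by move=> y; rewrite inE => /h0.
Qed.

End Pushforward.

Section PlaneLebesgue.
Variable R : realType.
Local Notation mR := (measurableTypeR R).
Local Notation leb := (@lebesgue_measure R).
Local Notation leb2 := (@lebesgue_measure R \x @lebesgue_measure R)%E.

Lemma lebesgue_measure_translation (k : R) (A : set mR) : measurable A ->
  leb ((fun x => x + k) @^-1` A) = leb A.
Proof.
move=> mA; have mf : measurable_fun setT ((fun x => x + k) : mR -> mR).
  by apply: measurable_funD.
rewrite -(pushmE leb mf); apply/esym/lebesgue_measure_unique => //= _ [[a b]] _ <-.
rewrite /pushforward/=.
rewrite (_ : _ @^-1` _ = `]a - k, b - k]%classic); last first.
  by apply/seteqP; split => x /=; rewrite !in_itv/= ltrBlDr lerBrDr.
rewrite !lebesgue_measure_itv/= !lte_fin ltrD2r; case: ifP => // _.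
by rewrite -!EFinB; congr (_%:E); ring.
Qed.

Lemma lebesgue_measure_dilation (c : R) (A : set mR) : 0 < c -> measurable A ->
  leb ((fun x => c * x) @^-1` A) = (c^-1%:E * leb A)%E.
Proof.
move=> c0 mA; have mf : measurable_fun setT ((fun x => c * x) : mR -> mR).
  by apply: measurable_funM.
have c0' : 0 <= c by exact: ltW.
rewrite [in RHS](@lebesgue_measure_unique R (mscale (NngNum c0') (pushm leb mf)))//=.
  by rewrite /mscale/= muleA -EFinM mulVf ?gt_eqF// mul1e.
move=> _ [[a b]] _ <-; rewrite /mscale/= /pushforward/=.
rewrite (_ : _ @^-1` _ = `]c^-1 * a, c^-1 * b]%classic); last first.
  apply/seteqP; split => x /=; rewrite !in_itv/=.
    by rewrite ltr_pdivrMl// ler_pdivlMl.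
  by rewrite ltr_pdivrMl// ler_pdivlMl.
rewrite !lebesgue_measure_itv/= !lte_fin ltr_pM2l ?invr_gt0//; case: ifP => _; last by rewrite mule0.
by rewrite -!EFinB -EFinM -mulrBr mulrA mulfV ?gt_eqF// mul1r.
Qed.

Lemma measurable_shear1 (k : R) :
  measurable_fun setT ((fun p => (p.1, p.2 + k * p.1)) : mR * mR -> mR * mR).
Proof.
apply: measurable_fun_pair => //.
by apply: measurable_funD => //; apply: measurable_funM.
Qed.

Lemma measurable_shear2 (k : R) :
  measurable_fun setT ((fun p => (p.1 + k * p.2, p.2)) : mR * mR -> mR * mR).
Proof.
apply: measurable_fun_pair => //.
by apply: measurable_funD => //; apply: measurable_funM.
Qed.

(** Tonelli: the section over x is translated by k x, which leaves its length unchanged. *)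
Lemma leb2_shear1 (k : R) (E : set (mR * mR)) : measurable E ->
  leb2 ((fun p => (p.1, p.2 + k * p.1)) @^-1` E) = leb2 E.
Proof.
move=> mE; rewrite /product_measure1; apply: eq_integral => x _ /=.
rewrite -(@lebesgue_measure_translation (k * x) (xsection E x)); last exact: measurable_xsection.
by congr (leb _); apply/seteqP; split => y; rewrite /xsection/= !inE.
Qed.

(** Integrating in the other order lets horizontal shears be treated by horizontal sections. *)
Lemma leb2_sym (E : set (mR * mR)) : measurable E ->
  leb2 E = (leb \x^ leb)%E E.
Proof.
move=> mE; apply: (@product_measure_unique _ _ _ _ _ leb leb (leb \x^ leb)%E) => //.
by move=> A B mA mB; exact: product_measure2E.
Qed.

Lemma leb2_shear2 (k : R) (E : set (mR * mR)) : measurable E ->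
  leb2 ((fun p => (p.1 + k * p.2, p.2)) @^-1` E) = leb2 E.
Proof.
move=> mE; rewrite !leb2_sym//; last first.
  by rewrite -[_ @^-1` _]setTI; exact: measurable_shear2.
rewrite /product_measure2; apply: eq_integral => y _ /=.
rewrite -(@lebesgue_measure_translation (k * y) (ysection E y)); last exact: measurable_ysection.
by congr (leb _); apply/seteqP; split => x; rewrite /ysection/= !inE.
Qed.

Definition rot (a b : R) (p : mR * mR) : mR * mR := (a * p.1 - b * p.2, b * p.1 + a * p.2).

Lemma measurable_rot a b : measurable_fun setT (rot a b).
Proof.
apply: measurable_fun_pair => /=; first by apply: measurable_funB; apply: measurable_funM.
by apply: measurable_funD; apply: measurable_funM.
Qed.

(** With a = cos t and b = sin t, the outer shear factor (a - 1) / b is minus the tangent of t /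
    2. *)
Lemma rot_shears (a b x y : R) : a ^+ 2 + b ^+ 2 = 1 -> b != 0 ->
  rot a b (x, y) = (x + (a - 1) / b * y + (a - 1) / b * (y + b * (x + (a - 1) / b * y)),
                    y + b * (x + (a - 1) / b * y)).
Proof.
move=> ab b0; have a2 : a ^+ 2 = 1 - b ^+ 2 by rewrite -ab addrK.
by rewrite /rot; congr (_, _) => /=; field: a2.
Qed.

(* A rotation by an angle outside pi Z is a product of three shears. *)
Lemma leb2_rot_neq0 a b (E : set (mR * mR)) : measurable E -> a ^+ 2 + b ^+ 2 = 1 -> b != 0 ->
  leb2 (rot a b @^-1` E) = leb2 E.
Proof.
move=> mE ab b0; set t := (a - 1) / b.
rewrite -[RHS](@leb2_shear2 t E)// -[RHS](leb2_shear1 b); last first.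
  by rewrite -[_ @^-1` _]setTI; exact: measurable_shear2.
rewrite -[RHS](leb2_shear2 t); last first.
  rewrite -[_ @^-1` _]setTI; apply: measurable_shear1 => //.
  by rewrite -[_ @^-1` _]setTI; exact: measurable_shear2.
have e : rot a b = (fun p => (p.1 + t * p.2, p.2)) \o (fun p => (p.1, p.2 + b * p.1)) \o
   (fun p => (p.1 + t * p.2, p.2)).
  by apply/funext => -[x y]; exact: rot_shears.
by rewrite e.
Qed.

Lemma leb2_rot a b (E : set (mR * mR)) : measurable E -> a ^+ 2 + b ^+ 2 = 1 ->
  leb2 (rot a b @^-1` E) = leb2 E.
Proof.
move=> mE ab; have [b0|b0] := eqVneq b 0; last exact: leb2_rot_neq0.
have mi : measurable (rot 0 1 @^-1` E) by rewrite -[_ @^-1` _]setTI; exact: measurable_rot.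
have i1 : 0 ^+ 2 + 1 ^+ 2 = 1 :> R by rewrite expr0n expr1n add0r.
(* With b = 0 only the identity and the half turn remain, and the half turn is a quarter turn
   applied twice. *)
have /orP[/eqP->|/eqP->] : (a == 1) || (a == -1) by rewrite -sqrf_eq1 -ab b0 expr0n addr0.
  rewrite b0.
  by congr leb2; apply/seteqP; split => -[x y]; rewrite /rot/= !mul0r subr0 add0r !mul1r.
rewrite b0 -[RHS](leb2_rot_neq0 mE i1) ?oner_eq0//.
rewrite -[RHS](leb2_rot_neq0 mi i1) ?oner_eq0//.
have -> : rot (-1) 0 = rot 0 1 \o rot 0 1.
  by apply/funext => -[x y]; rewrite /rot/=; congr (_, _); ring.
by [].
Qed.

Lemma leb2_dilation (c : R) (E : set (mR * mR)) : 0 < c -> measurable E ->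
  leb2 ((fun p => (c * p.1, c * p.2)) @^-1` E) = ((c ^- 2)%:E * leb2 E)%E.
Proof.
move=> c0 mE.
have mf : measurable_fun setT ((fun p => (c * p.1, c * p.2)) : mR * mR -> mR * mR).
  by apply: measurable_fun_pair; apply: measurable_funM.
have c0' : 0 <= c ^+ 2 by rewrite exprn_ge0// ltW.
rewrite [in RHS](@product_measure_unique _ _ _ _ _ leb leb (mscale (NngNum c0') (pushm leb2 mf)))//=.
  by rewrite /mscale/= muleA -EFinM mulVf ?expf_neq0 ?gt_eqF// mul1e.
move=> A B mA mB; rewrite /mscale/= /pushforward/=.
rewrite (_ : _ @^-1` _ = ((fun x => c * x) @^-1` A) `*` ((fun x => c * x) @^-1` B)); last first.
  by apply/seteqP; split.
have mc : measurable_fun setT ((fun x => c * x) : mR -> mR) by apply: measurable_funM.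
rewrite [X in (_ * X)%E]product_measure1E//; try by rewrite -[_ @^-1` _]setTI; exact: mc.
rewrite [X in (_ * (X * _))%E](lebesgue_measure_dilation c0 mA)
  [X in (_ * (_ * X))%E](lebesgue_measure_dilation c0 mB).
rewrite muleACA.
have e : c ^+ 2 * (c^-1 * c^-1) = 1 by field; rewrite gt_eqF.
by rewrite -[((c^-1)%:E * _)%E]EFinM (muleA (c ^+ 2)%:E) -[X in (X * _)%E]EFinM e mul1e.
Qed.

End PlaneLebesgue.

(** * Averages over dyadic roots of unity *)

Section DiscreteParseval.
Variable R : realType.
Local Notation C := R[i].
Implicit Types (a b : nat -> C) (z w : C) (r s : R).

(** The bound is uniform on the closed disc of radius [s] because the sample points [w ^+ j * z]
    change with the number of samples while their modulus stays fixed. *)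
Lemma psum_tail b s : psd b -> 0 <= s < 1 ->
  exists t : nat -> R, t @ \oo --> (0 : R) /\
    forall n w, modC w <= s -> modC (psum b w - \sum_(i < n) b i * w ^+ i) <= t n.
Proof.
move=> hb hs; have [ss r0 r1] := mid_lt1 hs; set r := (s + 1) / 2 in ss r0 r1.
have /andP[s0 s1] := hs.
have hr : 0 <= r < 1 by rewrite ltW.
have [M M0 HM] := psd_summable hb hr.
set q := s / r.
have q0 : 0 <= q by rewrite divr_ge0 ?(ltW r0).
have q1 : q < 1 by rewrite ltr_pdivrMr// mul1r.
exists (fun n => q ^+ n * M); split=> [|n w ws].
  have h : (fun n => q ^+ n * M) @ \oo --> (0 * M : R).
    by apply: cvgMr_tmp; apply: cvg_expr; rewrite ger0_norm.
  by rewrite mul0r in h.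
have w1 : modC w < 1 by apply: le_lt_trans s1.
have h : (fun k => modC (\sum_(i < k) b i * w ^+ i - psum b w)) @ \oo --> (0 : R) by exact: psum_cvg.
have h2 : (fun k => modC ((\sum_(i < k) b i * w ^+ i - \sum_(i < n) b i * w ^+ i)
    - (psum b w - \sum_(i < n) b i * w ^+ i))) @ \oo --> (0 : R).
  rewrite (_ : (fun _ => _) = (fun k => modC (\sum_(i < k) b i * w ^+ i - psum b w)))//.
  by apply/funext => k; rewrite opprB addrA subrK.
apply: (cvgC_le h2); near=> k.
have nk : (n <= k)%N by near: k; exists n.
have -> : \sum_(i < k) b i * w ^+ i - \sum_(i < n) b i * w ^+ i = \sum_(n <= i < k) b i * w ^+ i.
  rewrite -!(big_mkord predT (fun i => b i * w ^+ i)).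
  by rewrite (big_cat_nat (leq0n n) nk)/= addrAC subrr add0r.
apply: (le_trans (normc_sum _ _ _)).
apply: (@le_trans _ _ (q ^+ n * \sum_(n <= i < k) modC (b i) * r ^+ i)).
  rewrite mulr_sumr !big_nat; apply: ler_sum => i /andP[il ik].
  rewrite normcM normcX mulrCA; apply: ler_wpM2l; first exact: normc_ge0.
  apply: (@le_trans _ _ (s ^+ i)); first by apply: lerXn2r; rewrite ?nnegrE ?normc_ge0.
  rewrite (exprn_split s i r0) -/q mulrC; apply: ler_wpM2r; first by rewrite exprn_ge0// ltW.
  by apply: ler_wiXn2l => //; exact: ltW.
apply: ler_wpM2l; first exact: exprn_ge0.
apply: le_trans (HM k).
rewrite -(big_mkord predT (fun j => modC (b j) * r ^+ j)).
rewrite (big_cat_nat (leq0n n) nk)/= lerDr sumr_ge0// => j _.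
by rewrite mulr_ge0 ?normc_ge0 ?exprn_ge0 ?ltW.
Unshelve. all: by end_near. Qed.

(** Iterated square roots of -1 produce primitive roots of unity of order 2^(k+1) by pure
    algebra. *)
Lemma root_of_N1 k : exists w : C, w ^+ (2 ^ k) = -1.
Proof.
elim: k => [|k [w hw]]; first by exists (-1).
by exists (sqrtc w); rewrite expnS exprM sqr_sqrtc.
Qed.

(** If d is odd, then w^d raised to the power 2^k is (-1)^d = -1, so w^d is not 1. If d is even,
    replace w by w^2 and d by d / 2. *)
Lemma root_of_N1_order k w d : w ^+ (2 ^ k) = -1 -> (0 < d < 2 ^ k.+1)%N -> w ^+ d != 1.
Proof.
have N11 : (-1 : C) != 1.
  by rewrite -subr_eq0 -opprD oppr_eq0 -[1 + 1]/(2%:R : C) pnatr_eq0.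
elim: k w d => [w d|k IH w d].
  by rewrite expr1 => ->; case: d => [|[|d]]//; rewrite expr1.
move=> hw /andP[d0 dlt]; have [od|ed] := boolP (odd d).
  apply: contra N11 => /eqP wd1; rewrite -hw; apply/eqP.
  have : w ^+ d ^+ (2 ^ k.+1) = 1 by rewrite wd1 expr1n.
  by rewrite -exprM mulnC exprM hw -signr_odd od expr1.
have dE : d = (2 * d./2)%N by rewrite mul2n -[LHS]odd_double_half (negbTE ed).
rewrite dE exprM; apply: IH; first by rewrite -exprM -expnS.
apply/andP; split; first by move: d0; rewrite {1}dE muln_gt0.
by move: dlt; rewrite {1}dE expnS ltn_mul2l.
Qed.

Lemma normc_root w n : (0 < n)%N -> w ^+ n = 1 -> modC w = 1.
Proof.
move=> n0 h; have : modC w ^+ n = 1 by rewrite -normcX h Normc.normc1.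
by move=> /eqP; rewrite pexpr_eq1 ?normc_ge0// => /eqP.
Qed.

(** Orthogonality of characters. The bound [n <= 2 ^ k.+1] prevents aliasing: distinct exponents
    below n give distinct powers of w. *)
Lemma discrete_parseval k w n b z : w ^+ (2 ^ k) = -1 -> (n <= 2 ^ k.+1)%N ->
  \sum_(j < 2 ^ k.+1) modC (\sum_(i < n) b i * (w ^+ j * z) ^+ i) ^+ 2 =
  (2 ^ k.+1)%:R * \sum_(i < n) modC (b i) ^+ 2 * (modC z ^+ 2) ^+ i.
Proof.
move=> hw nM; set M := (2 ^ k.+1)%N.
have M0 : (0 < M)%N by rewrite expn_gt0.
have wM : w ^+ M = 1 by rewrite /M expnSr exprM hw sqrrN expr1n.
have w1 := normc_root M0 wM.
have wwc : w * w^*%C = 1 by rewrite mul_conjc w1 expr1n.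
apply: complexI; rewrite rmorph_sum/= rmorphM/= rmorph_sum/=.
pose c i l : C := b i * (b l)^*%C * (z ^+ i * z^*%C ^+ l).
have E j : (modC (\sum_(i < n) b i * (w ^+ j * z) ^+ i) ^+ 2)%:C%C =
   \sum_(i < n) \sum_(l < n) c i l * (w ^+ i * w^*%C ^+ l) ^+ j.
  rewrite -mul_conjc rmorph_sum/= mulr_suml; apply: eq_bigr => i _.
  rewrite mulr_sumr; apply: eq_bigr => l _.
  rewrite rmorphM/= rmorphXn/= rmorphM/= rmorphXn/= /c.
  rewrite !exprMn -!exprM [(i * j)%N]mulnC [(l * j)%N]mulnC; ring.
under eq_bigr do rewrite E.
rewrite exchange_big/= mulr_sumr; apply: eq_bigr => i _.
rewrite exchange_big/= (bigD1 i)//= [X in _ + X]big1 ?addr0.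
  rewrite -mulr_sumr -exprMn wwc expr1n.
  under eq_bigr do rewrite expr1n.
  rewrite sumr_const card_ord /c -exprMn !mul_conjc.
  have -> : M%:R%:C%C = M%:R :> C by rewrite rmorph_nat.
  rewrite [RHS]mulrC; congr (_ * _).
  by rewrite -rmorphXn/= -rmorphM/=.
(* Off the diagonal the ratio t = w^i conj(w)^l is an M-th root of unity other than 1, so its
   geometric sum over M terms vanishes. *)
move=> l li; rewrite -mulr_sumr.
set t := w ^+ i * w^*%C ^+ l.
suff -> : \sum_(j < M) t ^+ j = 0 by rewrite mulr0.
have tM : t ^+ M = 1.
  rewrite /t exprMn -!exprM [(i * M)%N]mulnC [(l * M)%N]mulnC !exprM wM.
  by rewrite -[w^*%C ^+ M]rmorphXn/= wM rmorph1 !expr1n mulr1.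
have t1 : t != 1.
  apply/eqP => t1.
  have wil : w ^+ i = w ^+ l.
    have : t * w ^+ l = w ^+ l by rewrite t1 mul1r.
    by rewrite /t -mulrA -exprMn [w^*%C * w]mulrC wwc expr1n mulr1.
  have w0 : w != 0 by rewrite -normc_gt0 w1.
  have order x y : (x < y < n)%N -> w ^+ x <> w ^+ y.
    move=> /andP[xy yn] /eqP; apply/negP.
    have -> : w ^+ y = w ^+ x * w ^+ (y - x) by rewrite -exprD subnKC// ltnW.
    rewrite -[X in X == _]mulr1 (inj_eq (mulfI (expf_neq0 x w0))) eq_sym.
    apply: (root_of_N1_order hw); rewrite subn_gt0 xy/=.
    by apply: leq_ltn_trans (leq_subr _ _) _; apply: leq_trans yn nM.
  case: (ltngtP i l) => il.
  - by move: wil; apply: order; rewrite il/=.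
  - by move/esym: wil; apply: order; rewrite il/=.
  - by move/eqP: li; apply; apply: val_inj.
have := subrX1 t M; rewrite tM subrr => /esym/eqP; rewrite mulf_eq0 subr_eq0 (negbTE t1).
by move=> /eqP.
Qed.

End DiscreteParseval.

(** * Areas of discs and radial integrals *)

Section AreaMeasure.
Variable R : realType.
Local Notation mR := (measurableTypeR R).
Local Notation T := (measurableTypeR R * measurableTypeR R)%type.
Local Notation leb := (@lebesgue_measure R).
Local Notation leb2 := (@lebesgue_measure R \x @lebesgue_measure R)%E.
Local Notation area := (@area R).

Lemma areaE (E : set T) : area E = ((pi^-1)%:E * leb2 E)%E.
Proof. by []. Qed.

Lemma areaX (A B : set mR) : measurable A -> measurable B ->
  area (A `*` B) = ((pi^-1)%:E * (leb A * leb B))%E.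
Proof. by move=> mA mB; rewrite areaE; congr (_ * _)%E; exact: product_measure1E. Qed.

Definition nrm2 (p : T) : R := p.1 ^+ 2 + p.2 ^+ 2.

Lemma modC_toC (p : T) : modC (toC p) ^+ 2 = nrm2 p.
Proof. by rewrite sqr_normcE. Qed.

Lemma nrm2_ge0 p : 0 <= nrm2 p.
Proof. by rewrite addr_ge0// sqr_ge0. Qed.

Definition unit_disc : set T := @toC R @^-1` @disc R.

Lemma unit_discE p : unit_disc p <-> nrm2 p < 1.
Proof.
change (modC (toC p) < 1 <-> nrm2 p < 1); rewrite -modC_toC.
move: (modC (toC p)) (normc_ge0 (toC p)) => x x0.
by rewrite -[in X in _ <-> X](expr1n _ 2) ltr_pXn2r ?nnegrE.
Qed.

Lemma measurable_nrm2 : measurable_fun [set: T] (nrm2 : T -> mR).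
Proof. by apply: measurable_funD; apply: measurable_funX. Qed.

Definition ball2 (t : R) : set T := [set p | nrm2 p <= t].

Lemma measurable_nrm2_le (t : R) : measurable (ball2 t).
Proof.
rewrite /ball2 -[X in measurable X]setTI; apply: measurable_fun_le => //; exact: measurable_nrm2.
Qed.

Lemma measurable_unit_disc : measurable unit_disc.
Proof.
rewrite (_ : unit_disc = setT `&` nrm2 @^-1` `]-oo, 1[%classic).
  by apply: measurable_nrm2.
by apply/seteqP; split => p; rewrite /= in_itv/= ?setTI unit_discE// => -[].
Qed.

Lemma area_ball_scale (t : R) : 0 < t ->
  area (ball2 t) = (t%:E * area (ball2 1))%E.
Proof.
move=> t0; have c0 : 0 < Num.sqrt t by rewrite sqrtr_gt0.
have ct : Num.sqrt t ^+ 2 = t by rewrite sqr_sqrtr// ltW.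
have h := leb2_dilation c0 (measurable_nrm2_le t).
have e : (fun p : T => (Num.sqrt t * p.1, Num.sqrt t * p.2)) @^-1` ball2 t =
   ball2 1.
  apply/seteqP; split => -[x y]; rewrite /ball2/nrm2/= !exprMn ct -mulrDr.
    by rewrite -[leRHS]mulr1 ler_pM2l.
  by rewrite -[X in _ -> _ <= X]mulr1 ler_pM2l.
rewrite e ct in h.
rewrite !areaE h muleCA; congr (_ * _)%E.
by rewrite muleA -EFinM mulfV ?gt_eqF// mul1e.
Qed.

Lemma area_ball1_lty : (area (ball2 1) < +oo)%E.
Proof.
apply: (@le_lt_trans _ _ (area (`[-1, 1]%classic `*` `[-1, 1]%classic))).
  apply: le_measure; rewrite ?inE; [exact: measurable_nrm2_le|exact: measurableX|].
  move=> [x y]; rewrite /nrm2/= !in_itv/= => h.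
  have h1 : x ^+ 2 <= 1 by apply: le_trans h; rewrite lerDl sqr_ge0.
  have h2 : y ^+ 2 <= 1 by apply: le_trans h; rewrite lerDr sqr_ge0.
  split; rewrite -ler_norml -(ler_pXn2r (ltn0Sn 1)) ?nnegrE//
    real_normK ?num_real// expr1n//.
rewrite areaX// !lebesgue_measure_itv/= !lte_fin.
by case: ifP => _; rewrite -?EFinB -?EFinM ?mule0 ?ltry.
Qed.

Lemma area_ball1_gt0 : (0 < area (ball2 1))%E.
Proof.
apply: (@lt_le_trans _ _ (area (`[0, 2^-1]%classic `*` `[0, 2^-1]%classic))).
  rewrite areaX// !lebesgue_measure_itv/= !lte_fin invr_gt0 ltr0n.
  by rewrite -?EFinB -?EFinM lte_fin !mulr_gt0 ?invr_gt0 ?pi_gt0// subr0 invr_gt0.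
apply: le_measure; rewrite ?inE; [exact: measurableX|exact: measurable_nrm2_le|].
move=> [x y]; rewrite /ball2/nrm2/= !in_itv/= => -[/andP[x0 x1] /andP[y0 y1]].
have hx : x ^+ 2 <= 2^-1 ^+ 2 by rewrite lerXn2r ?nnegrE.
have hy : y ^+ 2 <= 2^-1 ^+ 2 by rewrite lerXn2r ?nnegrE.
by apply: (le_trans (lerD hx hy)); lra.
Qed.

(** The normalized area of the closed disc is kept as an unevaluated positive number; it only enters
    the constants of the comparisons. *)
Definition area_ball1 : R := fine (area (ball2 1)).

Lemma area_ball1E : area (ball2 1) = area_ball1%:E.
Proof. by rewrite /area_ball1 fineK// ge0_fin_numE// area_ball1_lty. Qed.

Lemma area_ball1_pos : 0 < area_ball1.
Proof. by rewrite -lte_fin -area_ball1E area_ball1_gt0. Qed.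

Lemma area_ball (t : R) : area (ball2 t) = (Num.max t 0 * area_ball1)%:E.
Proof.
have [t0|t0] := ltP 0 t.
  by rewrite area_ball_scale// area_ball1E -EFinM.
rewrite mul0r; apply/eqP; rewrite eq_le measure_ge0 andbT.
apply/lee_addgt0Pr => e e0; rewrite add0e.
have s0 : 0 < e / area_ball1 by rewrite divr_gt0// area_ball1_pos.
rewrite (_ : e%:E = area (ball2 (e / area_ball1))).
  apply: le_measure; rewrite ?inE; try exact: measurable_nrm2_le.
  by move=> p /= /le_trans; apply; rewrite (le_trans t0)// ltW.
by rewrite area_ball_scale// area_ball1E -EFinM divfK// gt_eqF// area_ball1_pos.
Qed.

Let neg_itv : measurable (`]-oo, 0[%classic : set mR). Proof. by []. Qed.

Lemma area_nrm2_itv (a b : R) : a <= b ->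
  area (nrm2 @^-1` `]a, b]%classic) = ((Num.max b 0 - Num.max a 0) * area_ball1)%:E.
Proof.
move=> ab.
have -> : nrm2 @^-1` `]a, b]%classic = ball2 b `\` ball2 a.
  apply/seteqP; split => p; rewrite /= in_itv/=.
    by move=> /andP[ap pb]; split => //; apply/negP; rewrite -ltNge.
  by move=> [pb /negP]; rewrite -ltNge => ->.
rewrite measureD; try exact: measurable_nrm2_le.
  rewrite (_ : _ `&` _ = ball2 a).
    by rewrite [X in (X - _)%E]area_ball [X in (_ - X)%E]area_ball -EFinB mulrBl.
  apply/seteqP; split => p /=; first by case.
  by move=> pa; split => //; exact: le_trans pa ab.
by rewrite [X in (X < _)%E]area_ball ltry.
Qed.

(* On [0, +oo[ the squared modulus is uniformly distributed: areas scale quadratically. *)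
Lemma area_nrm2 (A : set mR) : measurable A -> A `<=` `[0, +oo[%classic ->
  area (nrm2 @^-1` A) = (area_ball1%:E * leb A)%E.
Proof.
move=> mA A0.
have c0 : 0 <= area_ball1^-1 by rewrite invr_ge0 ltW// area_ball1_pos.
(* The image of the area under [nrm2] only charges the half-line from 0 upwards. Adding Lebesgue
   measure restricted to the negative half-line gives a measure on the whole line, to which
   uniqueness of Lebesgue measure applies. *)
have E (B : set mR) : measurable B ->
    leb B = ((area_ball1^-1)%:E * area (nrm2 @^-1` B) + leb (B `&` `]-oo, 0%R[%classic))%E; last first.
  rewrite [in RHS]E// (_ : A `&` _ = set0) ?measure0 ?adde0.
    by rewrite muleA -EFinM mulfV ?mul1e// gt_eqF// area_ball1_pos.
  by apply/seteqP; split => x//= [/A0]; rewrite /= !in_itv/= andbT leNgt => /negP.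
move=> mB; rewrite (@lebesgue_measure_unique R
  (measure_add (mscale (NngNum c0) (pushm area measurable_nrm2)) (mrestr leb neg_itv)))//.
  exact: measure_addE.
move=> _ [[a b]] _ <-; rewrite [RHS](measure_addE (mscale (NngNum c0) (pushm area measurable_nrm2)) (mrestr leb neg_itv)).
rewrite [X in (X + _)%E](_ : _ = (area_ball1^-1)%:E * area (nrm2 @^-1` `]a, b]%classic))%E//.
rewrite [X in (_ + X)%E](_ : _ = leb (`]a, b]%classic `&` `]-oo, 0%R[%classic))//.
have [ab|ba] := leP a b; last first.
  rewrite set_itv_ge ?preimage_set0 ?set0I ?measure0 ?mule0 ?adde0//.
  by rewrite bnd_simp -leNgt ltW.
rewrite area_nrm2_itv// -EFinM mulrCA mulVf ?mulr1 ?gt_eqF ?area_ball1_pos//.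
rewrite lebesgue_measure_itv/= lte_fin.
have -> : `]a, b]%classic `&` `]-oo, 0[%classic = if b < 0 then `]a, b]%classic else `]a, 0[%classic.
  case: ifPn => b0; apply/seteqP; split => x /=; rewrite !in_itv/=.
  - by case.
  - by move=> /andP[-> xb]; rewrite xb; split => //; exact: le_lt_trans b0.
  - by move=> [/andP[-> _] ->].
  - by move=> /andP[-> x0]; split => //; apply: le_trans (ltW x0) _; rewrite leNgt.
case: (ltP b 0) => b0.
  have a0 : a < 0 by apply: le_lt_trans b0.
  rewrite (max_r (ltW a0)) subrr add0e.
  by rewrite lebesgue_measure_itv/= lte_fin.
rewrite lebesgue_measure_itv/= lte_fin.
case: (ltP a 0) => a0.
  by rewrite (lt_le_trans a0 b0) subr0 -!EFinB -EFinD; congr (_%:E); ring.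
rewrite adde0; move: ab; rewrite le_eqVlt => /predU1P[->|ab].
  by rewrite ltxx subrr.
by rewrite ab.
Qed.

(** The substitution t = |z|^2 is linear in area, so no Jacobian and no angle appear. *)
Lemma area_radial (h : mR -> \bar R) : measurable_fun (`[0%R, 1%R[%classic : set mR) h ->
  (forall t, (`[0%R, 1%R[%classic : set mR) t -> (0 <= h t)%E) ->
  (\int[area]_(p in unit_disc) h (nrm2 p) =
   area_ball1%:E * \int[leb]_(t in `[0%R, 1%R[%classic) h t)%E.
Proof.
move=> mh h0.
rewrite (_ : unit_disc = nrm2 @^-1` `[0, 1[%classic); last first.
  by apply/seteqP; split => p; rewrite unit_discE/= in_itv/= nrm2_ge0.
rewrite -(@ge0_integral_pushm _ _ _ _ _ area _ measurable_nrm2)//.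
have c0 : 0 <= area_ball1 by rewrite ltW// area_ball1_pos.
rewrite (eq_measure_integral (mscale (NngNum c0) leb)).
  by rewrite ge0_integral_mscale.
move=> A mA A1; transitivity (area (nrm2 @^-1` A)); first by [].
rewrite area_nrm2//.
by move=> x /A1; rewrite /= !in_itv/= => /andP[->].
Qed.

Lemma nrm2_rot a b p : nrm2 (rot a b p) = (a ^+ 2 + b ^+ 2) * nrm2 p.
Proof.
by case: p => x y; rewrite /nrm2/rot/=; move: a b (x : R) (y : R) => a b u v; ring.
Qed.

Lemma area_rot (h : T -> \bar R) a b : a ^+ 2 + b ^+ 2 = 1 ->
  measurable_fun unit_disc h -> (forall p, unit_disc p -> (0 <= h p)%E) ->
  (\int[area]_(p in unit_disc) h (rot a b p) = \int[area]_(p in unit_disc) h p)%E.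
Proof.
move=> ab mh h0.
have {1}-> : unit_disc = rot a b @^-1` unit_disc.
  by apply/seteqP; split => p; rewrite /= !unit_discE nrm2_rot ab mul1r.
transitivity (\int[pushm area (@measurable_rot R a b)]_(p in unit_disc) h p)%E.
  symmetry; apply: ge0_integral_pushm => //; exact: measurable_unit_disc.
apply: eq_measure_integral => A mA _; rewrite [LHS]pushmE !areaE; congr (_ * _)%E.
exact: leb2_rot.
Qed.

End AreaMeasure.

(** * Parseval's formula on the disc *)

Section MeasurableComplex.
Variable R : realType.
Local Notation C := R[i].
Local Notation mR := (measurableTypeR R).
Local Notation T := (measurableTypeR R * measurableTypeR R)%type.
Variable D : set T.

(** Measurability is asked of the two real components, so that only real-valued functions are ever
    measured. *)
Definition mcfun (f : T -> C) : Prop :=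
  measurable_fun D (fun p => complex.Re (f p)) /\ measurable_fun D (fun p => complex.Im (f p)).

Lemma mcfun_toC : mcfun (@toC R).
Proof. by split; apply: measurable_funTS; [exact: measurable_fst|exact: measurable_snd]. Qed.

Lemma mcfun_cst c : mcfun (fun=> c).
Proof. by split; exact: measurable_cst. Qed.

Lemma mcfunD f g : mcfun f -> mcfun g -> mcfun (fun p => f p + g p).
Proof.
move=> [f1 f2] [g1 g2]; split.
  rewrite (_ : (fun p => _) = (fun p => complex.Re (f p) + complex.Re (g p))).
    exact: measurable_funD.
  by apply/funext => p; case: (f p) (g p) => ? ? [].
rewrite (_ : (fun p => _) = (fun p => complex.Im (f p) + complex.Im (g p))).
  exact: measurable_funD.
by apply/funext => p; case: (f p) (g p) => ? ? [].
Qed.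

Lemma mcfunM f g : mcfun f -> mcfun g -> mcfun (fun p => f p * g p).
Proof.
move=> [f1 f2] [g1 g2]; split.
  rewrite (_ : (fun p => _) = (fun p => complex.Re (f p) * complex.Re (g p) - complex.Im (f p) * complex.Im (g p))).
    by apply: measurable_funB; exact: measurable_funM.
  by apply/funext => p; case: (f p) (g p) => ? ? [].
rewrite (_ : (fun p => _) = (fun p => complex.Re (f p) * complex.Im (g p) + complex.Im (f p) * complex.Re (g p))).
  by apply: measurable_funD; exact: measurable_funM.
by apply/funext => p; case: (f p) (g p) => ? ? [].
Qed.

Lemma mcfunX f n : mcfun f -> mcfun (fun p => f p ^+ n).
Proof.
move=> mf; elim: n => [|n IH].
  by under eq_fun do rewrite expr0; exact: mcfun_cst.
by under eq_fun do rewrite exprS; exact: mcfunM.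
Qed.

Lemma mcfun_sum (F : nat -> T -> C) n : (forall i, mcfun (F i)) ->
  mcfun (fun p => \sum_(i < n) F i p).
Proof.
move=> mF; elim: n => [|n IH].
  by under eq_fun do rewrite big_ord0; exact: mcfun_cst.
by under eq_fun do rewrite big_ord_recr/=; exact: mcfunD.
Qed.

Lemma mcfun_lim (F : nat -> T -> C) f : (forall n, mcfun (F n)) ->
  (forall p, D p -> (fun n => modC (F n p - f p)) @ \oo --> (0 : R)) -> mcfun f.
Proof.
move=> mF hf; split.
  apply: (@measurable_fun_cvg _ _ _ _ (fun n p => complex.Re (F n p))) => [n|p Dp].
    by case: (mF n).
  apply/cvgrPdist_le => e e0; move/cvgrPdist_le : (hf p Dp) => /(_ _ e0); apply: filterS => n.
  rewrite sub0r normrN (ger0_norm (normc_ge0 _)); apply: le_trans.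
  rewrite distrC (_ : _ - _ = complex.Re (F n p - f p)) ?normr_Re_le//.
  by case: (F n p) (f p) => ? ? [].
apply: (@measurable_fun_cvg _ _ _ _ (fun n p => complex.Im (F n p))) => [n|p Dp].
  by case: (mF n).
apply/cvgrPdist_le => e e0; move/cvgrPdist_le : (hf p Dp) => /(_ _ e0); apply: filterS => n.
rewrite sub0r normrN (ger0_norm (normc_ge0 _)); apply: le_trans.
rewrite distrC (_ : _ - _ = complex.Im (F n p - f p)) ?normr_Im_le//.
by case: (F n p) (f p) => ? ? [].
Qed.

Lemma measurable_modC2 f : mcfun f -> measurable_fun D (fun p => modC (f p) ^+ 2).
Proof.
move=> [f1 f2]; under eq_fun do rewrite sqr_normcE.
by apply: measurable_funD; exact: measurable_funX.
Qed.

Lemma mcfun_poly (b : nat -> C) f n : mcfun f -> mcfun (fun p => \sum_(i < n) b i * f p ^+ i).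
Proof.
by move=> mf; apply: (mcfun_sum (F := fun i p => b i * f p ^+ i)) => i; apply: mcfunM; [exact: mcfun_cst|exact: mcfunX].
Qed.

Lemma mcfun_psum (b : nat -> C) f : psd b -> mcfun f -> (forall p, D p -> modC (f p) < 1) ->
  mcfun (fun p => psum b (f p)).
Proof.
move=> hb mf f1; apply: (@mcfun_lim (fun n p => \sum_(i < n) b i * f p ^+ i)).
  by move=> n; exact: mcfun_poly.
by move=> p Dp; apply: psum_cvg => //; exact: f1.
Qed.

End MeasurableComplex.

Lemma mulc_toC (R : realType) (a b : R) (p : measurableTypeR R * measurableTypeR R) :
  (complex.Re ((a +i* b)%C * toC p), complex.Im ((a +i* b)%C * toC p)) = rot a b p.
Proof. by case: p => x y; rewrite /rot/=; congr (_, _); rewrite addrC. Qed.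

Lemma sume_const (R : realType) n (x : \bar R) : (0 <= x)%E ->
  (\sum_(j < n) x = n%:R%:E * x)%E.
Proof.
move=> x0; elim: n => [|n IH]; first by rewrite big_ord0 mul0e.
by rewrite big_ord_recr/= IH -natr1 EFinD ge0_muleDl ?mul1e ?lee_fin.
Qed.

(** Hides the dyadic orders behind abstract [w] and [M]; afterwards only [k <= M k], the root
    property and the averaging identity are seen. *)
Lemma averaging_roots (R : realType) : exists (w : nat -> R[i]) (M : nat -> nat), forall k,
  [/\ (0 < M k)%N, (k <= M k)%N, w k ^+ M k = 1 &
    forall n (b : nat -> R[i]) z, (n <= M k)%N ->
      \sum_(j < M k) modC (\sum_(i < n) b i * (w k ^+ j * z) ^+ i) ^+ 2 =
      (M k)%:R * \sum_(i < n) modC (b i) ^+ 2 * (modC z ^+ 2) ^+ i].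
Proof.
have [w hw] := choice (root_of_N1 R); exists w, (fun k => 2 ^ k.+1)%N => k; split.
- by rewrite expn_gt0.
- by apply: ltnW; apply: (leq_trans (ltn_expl k (ltnSn 1))); rewrite leq_exp2l.
- by rewrite expnSr exprM hw sqrrN expr1n.
- by move=> n b z; exact: discrete_parseval.
Qed.

Section AreaParseval.
Variable R : realType.
Local Notation C := R[i].
Local Notation mR := (measurableTypeR R).
Local Notation T := (measurableTypeR R * measurableTypeR R)%type.
Local Notation area := (@area R).
Local Notation D := (@unit_disc R).
Variable v : R -> R.
Hypothesis v0 : forall t, 0 <= v t.
Hypothesis mv : measurable_fun setT v.

Let mD := @measurable_unit_disc R.

Lemma unit_disc_lt1 (p : T) : D p -> modC (toC p) < 1. Proof. by []. Qed.

Let mvn : measurable_fun D (fun p : T => v (nrm2 p)).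
Proof.
apply: measurable_funTS; apply: (measurableT_comp mv); exact: measurable_nrm2.
Qed.

Let mEv (f : T -> C) : mcfun D f ->
  measurable_fun D (fun p => (modC (f p) ^+ 2 * v (nrm2 p))%:E).
Proof.
move=> mf; apply/measurable_EFinP; apply: measurable_funM => //; exact: measurable_modC2.
Qed.

Definition moment n : \bar R := \int[area]_(p in D) ((nrm2 p ^+ n * v (nrm2 p))%:E).

Let mmom n : measurable_fun D (fun p : T => (nrm2 p ^+ n * v (nrm2 p))%:E).
Proof.
apply/measurable_EFinP; apply: measurable_funM => //.
by apply: measurable_funX; apply: measurable_funTS; exact: measurable_nrm2.
Qed.

Let mom0 n (p : T) : D p -> (0 <= (nrm2 p ^+ n * v (nrm2 p))%:E)%E.
Proof. by move=> _; rewrite lee_fin mulr_ge0// exprn_ge0// nrm2_ge0. Qed.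

Lemma moment_ge0 n : (0 <= moment n)%E.
Proof. by apply: integral_ge0 => p; exact: mom0. Qed.

Lemma integral_rot_root (f : T -> C) (w : C) j n : mcfun D f -> (0 < n)%N -> w ^+ n = 1 ->
  (\int[area]_(p in D) (modC (f (complex.Re (w ^+ j * toC p), complex.Im (w ^+ j * toC p))) ^+ 2
     * v (nrm2 p))%:E =
   \int[area]_(p in D) (modC (f p) ^+ 2 * v (nrm2 p))%:E)%E.
Proof.
move=> mf n0 wn; have w1 : modC (w ^+ j) = 1 by rewrite normcX (normc_root n0 wn) expr1n.
case: (w ^+ j) w1 => a b ab1.
have ab : a ^+ 2 + b ^+ 2 = 1 by rewrite -(sqr_normcE (a +i* b)%C) ab1 expr1n.
rewrite -(area_rot ab (mEv mf)); last first.
  by move=> p _; rewrite lee_fin mulr_ge0// exprn_ge0// normc_ge0.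
by apply: eq_integral => p _; rewrite nrm2_rot ab mul1r mulc_toC.
Qed.

(** By rotation invariance the integral equals each of its M rotated copies; their sum has a radial
    integrand by [discrete_parseval], and the moments come out term by term. *)
Lemma parseval_poly (b : nat -> C) n :
  (\int[area]_(p in D) (modC (\sum_(i < n) b i * toC p ^+ i) ^+ 2 * v (nrm2 p))%:E =
   \sum_(i < n) (modC (b i) ^+ 2)%:E * moment i)%E.
Proof.
have [ws [Ms /(_ n)]] := averaging_roots R; move: (ws n) (Ms n) => w M {ws Ms} [M0 nM wM dp].
set I := (LHS).
have mP : mcfun D (fun p : T => \sum_(i < n) b i * toC p ^+ i).
  by apply: mcfun_poly; exact: mcfun_toC.
have E : (M%:R%:E * I = M%:R%:E * \sum_(i < n) (modC (b i) ^+ 2)%:E * moment i)%E.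
  transitivity (\sum_(j < M) I)%E.
    by rewrite sume_const// integral_ge0// => p _; rewrite lee_fin mulr_ge0// exprn_ge0// normc_ge0.
  transitivity (\sum_(j < M) \int[area]_(p in D)
     (modC (\sum_(i < n) b i * (w ^+ j * toC p) ^+ i) ^+ 2 * v (nrm2 p))%:E)%E.
    apply: eq_bigr => j _; rewrite /I -(integral_rot_root j mP M0 wM).
    apply: eq_integral => p _ /=; congr ((modC _ ^+ 2 * _)%:E); apply: eq_bigr => i _.
    by congr (_ * _ ^+ _); case: (w ^+ j * toC p).
  rewrite -ge0_integral_sum//; first last.
  - by move=> j p _; rewrite lee_fin mulr_ge0// exprn_ge0// normc_ge0.
  - move=> j; apply: mEv; apply: (@mcfun_poly _ _ _ (fun p => w ^+ j * toC p)).
    by apply: mcfunM; [exact: mcfun_cst|exact: mcfun_toC].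
  transitivity (\int[area]_(p in D) (M%:R%:E * \sum_(i < n) (modC (b i) ^+ 2)%:E * (nrm2 p ^+ i * v (nrm2 p))%:E))%E.
    apply: eq_integral => p _.
    rewrite sumEFin -mulr_suml (dp n b (toC p) nM) modC_toC.
    rewrite -mulrA mulr_suml EFinM; congr (_ * _)%E.
    by rewrite -sumEFin; apply: eq_bigr => i _; rewrite -EFinM mulrA.
  rewrite ge0_integralZl_EFin//; first last.
  - apply: emeasurable_sum => i; apply: measurable_funeM; exact: mmom.
  - move=> p Dp; apply: sume_ge0 => i _; by rewrite mule_ge0 ?mom0// lee_fin exprn_ge0// normc_ge0.
  congr (_ * _)%E; rewrite ge0_integral_sum//; first last.
  - by move=> i p Dp; rewrite mule_ge0 ?mom0// lee_fin exprn_ge0// normc_ge0.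
  - by move=> i; apply: measurable_funeM; exact: mmom.
  apply: eq_bigr => i _; rewrite ge0_integralZl_EFin// ?exprn_ge0 ?normc_ge0//.
  by move=> p; exact: mom0.
have MM : M%:R != 0 :> R by rewrite pnatr_eq0 -lt0n.
have := congr1 (fun x => (M%:R^-1)%:E * x)%E E.
by rewrite !muleA -EFinM mulVf// !mul1e.
Qed.

(** Both inequalities are instances of Fatou. For the upper bound it is applied to the polynomial
    truncations. For the lower bound it is applied to averages over more and more rotations: they
    all have the same integral as the function itself and converge pointwise to the radial
    series. *)
Theorem area_parseval (b : nat -> C) : psd b ->
  (\int[area]_(p in D) (modC (psum b (toC p)) ^+ 2 * v (nrm2 p))%:E =
   \sum_(i <oo) (modC (b i) ^+ 2)%:E * moment i)%E.
Proof.
move=> hb.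
have mF : mcfun D (fun p : T => psum b (toC p)) by apply: mcfun_psum => //; exact: mcfun_toC.
have t0 i : (0 <= (modC (b i) ^+ 2)%:E * moment i)%E.
  by rewrite mule_ge0 ?moment_ge0// lee_fin exprn_ge0// normc_ge0.
apply/eqP; rewrite eq_le; apply/andP; split.
  pose P k (p : T) := (modC (\sum_(i < k) b i * toC p ^+ i) ^+ 2 * v (nrm2 p))%:E.
  have mP k : measurable_fun D (P k) by apply: mEv; apply: mcfun_poly; exact: mcfun_toC.
  have P0 k p : D p -> (0 <= P k p)%E by rewrite lee_fin mulr_ge0// exprn_ge0// normc_ge0.
  apply: (@le_trans _ _ (\int[area]_(p in D) limn_einf (P^~ p))%E).
    rewrite le_eqVlt; apply/orP; left; apply/eqP; apply: eq_integral => p.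
    rewrite inE => Dp; have h := cvgC_normc (psum_cvg hb (unit_disc_lt1 Dp)).
    have h2 : P ^~ p @ \oo --> (modC (psum b (toC p)) ^+ 2 * v (nrm2 p))%:E.
      have h2 : (fun k => modC (\sum_(i < k) b i * toC p ^+ i) ^+ 2 * v (nrm2 p)) @ \oo -->
          modC (psum b (toC p)) ^+ 2 * v (nrm2 p).
        apply: cvgMr_tmp; rewrite expr2; under eq_fun do rewrite expr2.
        exact: cvgM.
      by apply: cvg_EFin; [exact: nearW|exact: h2].
    by rewrite (cvg_limn_einf_sup h2).1.
  apply: (le_trans (fatou area mD mP P0)).
  have cv : cvgn (fun k => \sum_(0 <= i < k) (modC (b i) ^+ 2)%:E * moment i)%E by apply: is_cvg_nneseries.
  rewrite le_eqVlt; apply/orP; left; apply/eqP.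
  rewrite (_ : (fun k => _) = (fun k => \sum_(0 <= i < k) (modC (b i) ^+ 2)%:E * moment i)%E).
    by rewrite is_cvg_limn_einfE.
  by apply/funext => k; rewrite big_mkord /P parseval_poly.
have [w [M HM]] := averaging_roots R.
have M0 k : (0 < M k)%N by have [] := HM k.
have wM k : w k ^+ M k = 1 by have [] := HM k.
have kM k : (k <= M k)%N by have [] := HM k.
have dp k z : \sum_(j < M k) modC (\sum_(i < M k) b i * (w k ^+ j * z) ^+ i) ^+ 2 =
    (M k)%:R * \sum_(i < M k) modC (b i) ^+ 2 * (modC z ^+ 2) ^+ i.
  by have [_ _ _ h] := HM k; exact: h.
have M1 k : (M k)%:R != 0 :> R by rewrite pnatr_eq0 -lt0n.
pose A k (p : T) := (((M k)%:R^-1 * \sum_(j < M k) modC (psum b (w k ^+ j * toC p)) ^+ 2) * v (nrm2 p))%:E.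
pose S (p : T) : \bar R := (\sum_(i <oo) (modC (b i) ^+ 2)%:E * (nrm2 p ^+ i * v (nrm2 p))%:E)%E.
have wlt1 k j p : D p -> modC (w k ^+ j * toC p) < 1.
  by move=> Dp; rewrite normcM normcX (normc_root (M0 k) (wM k)) expr1n mul1r.
have mG k j : mcfun D (fun p => psum b (w k ^+ j * toC p)).
  apply: mcfun_psum => //.
    by apply: mcfunM; [exact: mcfun_cst|exact: mcfun_toC].
  by move=> p; exact: wlt1.
have AE k p : A k p = (((M k)%:R^-1)%:E * \sum_(j < M k) (modC (psum b (w k ^+ j * toC p)) ^+ 2 * v (nrm2 p))%:E)%E.
  by rewrite sumEFin -EFinM -mulr_suml mulrA.
have mA k : measurable_fun D (A k).
  rewrite (_ : A k = fun p => (((M k)%:R^-1)%:E * \sum_(j < M k) (modC (psum b (w k ^+ j * toC p)) ^+ 2 * v (nrm2 p))%:E)%E).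
    by apply: measurable_funeM; apply: emeasurable_sum => j; exact: (mEv (mG k j)).
  by apply/funext => p; exact: AE.
have A0 k p : D p -> (0 <= A k p)%E.
  move=> _; rewrite lee_fin mulr_ge0// mulr_ge0 ?invr_ge0//.
  by apply: sumr_ge0 => j _; rewrite exprn_ge0// normc_ge0.
have IR k (j : nat) : (\int[area]_(p in D) (modC (psum b (w k ^+ j * toC p)) ^+ 2 * v (nrm2 p))%:E =
    \int[area]_(p in D) (modC (psum b (toC p)) ^+ 2 * v (nrm2 p))%:E)%E.
  have h := integral_rot_root j mF (M0 k) (wM k).
  transitivity (\int[area]_(p in D) (modC (psum b (toC (complex.Re (w k ^+ j * toC p), complex.Im (w k ^+ j * toC p)))) ^+ 2
     * v (nrm2 p))%:E)%E; last exact: h.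
  have e (p : T) : toC (complex.Re (w k ^+ j * toC p), complex.Im (w k ^+ j * toC p)) = w k ^+ j * toC p.
    by case: (w k ^+ j * toC p).
  by apply: eq_integral => p _; rewrite e.
have IA k : (\int[area]_(p in D) A k p = \int[area]_(p in D) (modC (psum b (toC p)) ^+ 2 * v (nrm2 p))%:E)%E.
  under eq_integral do rewrite AE.
  rewrite ge0_integralZl_EFin//; first last.
  - by apply: emeasurable_sum => j; exact: (mEv (mG k j)).
  - by move=> p Dp; apply: sume_ge0 => j _; rewrite lee_fin mulr_ge0// exprn_ge0// normc_ge0.
  rewrite ge0_integral_sum//; first last.
  - by move=> j p _; rewrite lee_fin mulr_ge0// exprn_ge0// normc_ge0.
  - by move=> j; exact: (mEv (mG k j)).
  rewrite (eq_bigr _ (fun (j : 'I_(M k)) _ => IR k j)).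
  rewrite sume_const; last first.
    by apply: integral_ge0 => p _; rewrite lee_fin mulr_ge0// exprn_ge0// normc_ge0.
  by rewrite muleA -EFinM mulVf ?mul1e.
have cvA p : D p -> A ^~ p @ \oo --> S p.
  move=> Dp; have p1 := unit_disc_lt1 Dp.
  have hp : 0 <= modC (toC p) < 1 by rewrite normc_ge0.
  pose Q k := \sum_(i < k) modC (b i) ^+ 2 * nrm2 p ^+ i * v (nrm2 p).
  have [K K0 HK] := psd_summable hb hp.
  have Bd x : modC x <= modC (toC p) -> modC (psum b x) <= K /\ forall n, modC (\sum_(i < n) b i * x ^+ i) <= K.
    move=> xp.
    have Hn n : modC (\sum_(i < n) b i * x ^+ i) <= K.
      apply: le_trans (HK n); apply: (le_trans (normc_sum _ _ _)); apply: ler_sum => i _.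
      rewrite normcM normcX; apply: ler_wpM2l; first exact: normc_ge0.
      by apply: lerXn2r; rewrite ?nnegrE ?normc_ge0.
    by split => //; apply: psum_le => //; exact: le_lt_trans xp p1.
  have [t [ht Ht]] := psum_tail hb hp.
  have cvM : M k @[k --> \oo] --> \oo.
    move=> B [N _ HN]; exists N => // k /= Nk; apply: HN => /=.
    exact: leq_trans Nk (kM k).
  (* Replacing the full series by its first [M k] terms costs little: |x^2 - y^2| = |x - y| (x + y),
     the first factor being a uniform tail and the second at most 2K. For the truncation the average
     is exactly the radial partial sum. *)
  have diff k : `|(M k)%:R^-1 * (\sum_(j < M k) modC (psum b (w k ^+ j * toC p)) ^+ 2) * v (nrm2 p) - Q (M k)|
      <= t (M k) * (K + K) * v (nrm2 p).
    have -> : Q (M k) = (M k)%:R^-1 * (\sum_(j < M k) modC (\sum_(i < M k) b i * (w k ^+ j * toC p) ^+ i) ^+ 2) * v (nrm2 p).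
      rewrite dp modC_toC mulrA mulVf// mul1r.
      by rewrite /Q mulr_suml.
    rewrite -mulrBl normrM (ger0_norm (v0 _)); apply: ler_wpM2r => //.
    rewrite -mulrBr normrM ger0_norm ?invr_ge0// mulrC ler_pdivrMr ?ltr0n// -sumrB.
    apply: (le_trans (ler_norm_sum _ _ _)).
    have -> : t (M k) * (K + K) * (M k)%:R = \sum_(j < M k) t (M k) * (K + K).
      by rewrite sumr_const card_ord mulr_natr.
    apply: ler_sum => j _; set x := w k ^+ j * toC p.
    have xp : modC x <= modC (toC p).
      by rewrite /x normcM normcX (normc_root (M0 k) (wM k)) expr1n mul1r.
    have [B1 B2] := Bd _ xp; have B3 := Ht (M k) x xp.
    rewrite subr_sqr normrM; apply: ler_pM => //.
      apply: le_trans B3.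
      have := normcD (psum b x - \sum_(i < M k) b i * x ^+ i) (\sum_(i < M k) b i * x ^+ i).
      have := normcD (\sum_(i < M k) b i * x ^+ i - psum b x) (psum b x).
      rewrite !subrK normcBC => h1 h2; rewrite ler_norml; apply/andP; split; lra.
    rewrite ger0_norm ?addr_ge0 ?normc_ge0//; exact: lerD.
  have ndQ : nondecreasing_seq Q.
    apply/nondecreasing_seqP => n; rewrite /Q big_ord_recr/= lerDl.
    by rewrite !mulr_ge0 ?exprn_ge0 ?normc_ge0 ?nrm2_ge0.
  have bQ : forall n, Q n <= K * K * v (nrm2 p).
    move=> n; rewrite /Q -mulr_suml; apply: ler_wpM2r => //.
    apply: (@le_trans _ _ ((\sum_(i < n) modC (b i) * modC (toC p) ^+ i) * K)); last first.
      by apply: ler_wpM2r.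
    rewrite mulr_suml; apply: ler_sum => i _.
    rewrite -modC_toC -exprM mulnC exprM -exprMn expr2; apply: ler_wpM2l.
      by rewrite mulr_ge0 ?exprn_ge0 ?normc_ge0.
    apply: le_trans (HK i.+1); rewrite big_ord_recr/= lerDr.
    by apply: sumr_ge0 => l _; rewrite mulr_ge0 ?exprn_ge0 ?normc_ge0.
  have cQ : cvgn Q by apply: nondecreasing_is_cvgn => //; exists (K * K * v (nrm2 p)) => _ [n _ <-].
  have SE : S p = (limn Q)%:E.
    have eQ : (fun n => \sum_(0 <= i < n) (modC (b i) ^+ 2)%:E * (nrm2 p ^+ i * v (nrm2 p))%:E)%E = EFin \o Q.
      apply/funext => n /=; rewrite big_mkord /Q -sumEFin; apply: eq_bigr => i _.
      by rewrite -EFinM mulrA.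
    by rewrite /S eQ EFin_lim.
  rewrite SE; apply: cvg_EFin; first exact: nearW.
  have cQM : (fun k => Q (M k)) @ \oo --> limn Q by apply: cvg_comp cvM _; exact: cQ.
  have ct : (fun k => t (M k) * (K + K) * v (nrm2 p)) @ \oo --> (0 : R).
    have : (fun k => t (M k) * (K + K) * v (nrm2 p)) @ \oo --> (0 * (K + K) * v (nrm2 p) : R).
      by apply: cvgMr_tmp; apply: cvgMr_tmp; apply: cvg_comp cvM _.
    by rewrite !mul0r.
  apply/cvgrPdist_le => e e0; have e2 : 0 < e / 2 by rewrite divr_gt0.
  near=> k.
  have h1 : `|limn Q - Q (M k)| <= e / 2.
    by near: k; move/cvgrPdist_le : cQM => /(_ _ e2).
  have h2 : t (M k) * (K + K) * v (nrm2 p) <= e / 2.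
    near: k; move/cvgrPdist_le : ct => /(_ _ e2); apply: filterS => k.
    by rewrite sub0r normrN; apply: le_trans; exact: ler_norm.
  rewrite -[X in `|X|](subrKA (Q (M k))) [leRHS](splitr e).
  apply: (le_trans (ler_normD _ _)); apply: lerD => //.
  by rewrite distrC; apply: le_trans h2; exact: diff.
have -> : (\sum_(i <oo) (modC (b i) ^+ 2)%:E * moment i = \int[area]_(p in D) S p)%E.
  rewrite integral_nneseries//; first last.
  - by move=> n p Dp; rewrite mule_ge0 ?mom0// lee_fin exprn_ge0// normc_ge0.
  - by move=> n; apply: measurable_funeM; exact: mmom.
  apply: eq_eseriesr => i _; rewrite ge0_integralZl_EFin// ?exprn_ge0 ?normc_ge0//.
  by move=> p; exact: mom0.
apply: (@le_trans _ _ (\int[area]_(p in D) limn_einf (A^~ p))%E).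
  rewrite le_eqVlt; apply/orP; left; apply/eqP; apply: eq_integral => p.
  by rewrite inE => /cvA h; rewrite (cvg_limn_einf_sup h).1.
apply: (le_trans (fatou area mD mA A0)).
under [X in limn_einf X]eq_fun do rewrite IA.
rewrite le_eqVlt; apply/orP; left; apply/eqP.
by rewrite (cvg_limn_einf_sup (cvg_cst _)).1.
Unshelve. all: by end_near. Qed.

End AreaParseval.

(** * Weighted moments and the kernel of the second derivative *)

Section PowerEstimates.
Variables (R : realType) (al : R).
Hypothesis al0 : 0 < al.
Hypothesis al1 : al < 1.

Lemma powR_le_affine (y : R) : 0 <= y -> y `^ al <= 1 + y.
Proof.
move=> y0; have [y1|y1] := leP 1 y.
  by apply: (le_trans (ler1_powR y1 (ltW al1))); rewrite lerDr.
have : y `^ al <= 1 `^ al by apply: ge0_ler_powR; rewrite ?nnegrE// ltW.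
by rewrite powR1 => /le_trans; apply; rewrite lerDl.
Qed.

(** The concave quadratic has maximum 5/2, at y = 5, which settles y >= 1 since y^al >= 1 there; for
    y < 1 already y <= y^al. With [powR_le_affine] this traps the real power between polynomials. *)
Lemma powR_ge_quadratic (y : R) : 0 <= y -> y - y ^+ 2 / 10 <= 5 / 2 * y `^ al.
Proof.
rewrite le_eqVlt => /predU1P[<-|y0].
  by rewrite powR0 ?gt_eqF//; lra.
have [y1|y1] := leP 1 y.
  have : 1 `^ al <= y `^ al by apply: ge0_ler_powR; rewrite ?nnegrE// ltW// ltW.
  rewrite powR1 => h; have h2 : 0 <= (y - 5) ^+ 2 := sqr_ge0 _; nra.
have : y <= y `^ al by apply: ger1_powR; [rewrite y0 ltW|exact: ltW].
nra.
Qed.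

(** Used in two ways: with [x] a distance to the boundary and [N] an index, for the moments, and
    with the roles exchanged, for the kernel coefficients. *)
Lemma powR_scaled_upper (x N : R) : 0 <= x -> 0 < N -> x `^ al <= N `^ (- al) * (1 + N * x).
Proof.
move=> x0 N0; have Na : 0 < N `^ al by exact: powR_gt0.
rewrite powRN mulrC ler_pdivlMr// -powRM// ?(ltW N0)// [x * N]mulrC.
by apply: powR_le_affine; rewrite mulr_ge0// ltW.
Qed.

Lemma powR_scaled_lower (x N : R) : 0 <= x -> 0 < N ->
  N `^ (- al) * (N * x - (N * x) ^+ 2 / 10) <= 5 / 2 * x `^ al.
Proof.
move=> x0 N0; have Na : 0 < N `^ al by exact: powR_gt0.
rewrite powRN mulrC ler_pdivrMr// [leRHS](_ : _ = 5 / 2 * (N * x) `^ al); last first.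
  by rewrite powRM ?(ltW N0)// mulrAC mulrA.
by apply: powR_ge_quadratic; rewrite mulr_ge0// ltW.
Qed.

Local Notation leb := (@lebesgue_measure R).
Local Notation I01 := (`[0%R, 1%R[%classic : set (measurableTypeR R)).

Let measurable_Xonem n m : measurable_fun I01 (fun t : R => t ^+ n * (1 - t) ^+ m).
Proof.
by apply: measurable_funM; apply: measurable_funX => //; apply: measurable_funB.
Qed.

Lemma integral_X_onemX n m :
  (\int[leb]_(t in I01) (t ^+ n * (1 - t) ^+ m)%:E = ((n`! * m`!)%:R / (n + m).+1`!%:R)%:E)%E.
Proof.
rewrite integral_itv_bndo_bndc; last by apply/measurable_EFinP; exact: measurable_Xonem.
rewrite -beta_fun_fact EFin_beta_fun integral_mkcond; apply: eq_integral => t _ /=.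
by rewrite /patch; case: ifP.
Qed.

Let beta_quotient1 (A N P F : R) : N != 0 -> P != 0 -> F != 0 ->
  A * N * (F / (P * (N * F))) = A * P^-1.
Proof. by move=> *; field; apply/and3P. Qed.

Let beta_quotient2 (A N P Q F : R) : N != 0 -> P != 0 -> Q != 0 -> F != 0 ->
  A * (N ^+ 2 / 10) * (F * 2 / (Q * (P * (N * F)))) = A * (P^-1 * (N / Q / 5)).
Proof. by move=> *; field; apply/and4P. Qed.

(** The constant is 4/25 = 2/5 * 4/5 * 1/2: the inverse of 5/2, the lower bound 4/5 for 1 - Q, and
    the loss 1/2 in passing from M to P. *)
Let moment_arith (A M P Q j : R) : 0 <= A -> 0 <= P -> Q <= 5^-1 -> M / 2 <= P ->
  A * P <= 5 / 2 * j + A * (P * Q) -> 4 / 25 * (A * M) <= j.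
Proof.
move=> A0 P0 Q1 MP h.
have h1 : 0 <= A * P * (5^-1 - Q) by rewrite !mulr_ge0// subr_ge0.
have h2 : 0 <= A * (P - M / 2) by rewrite mulr_ge0// subr_ge0.
nra.
Qed.

Let u (t : R) := (1 - t) `^ al.

Lemma u_ge0 t : 0 <= u t. Proof. exact: powR_ge0. Qed.

Lemma measurable_u : measurable_fun setT u.
Proof.
by apply: (measurableT_comp (measurable_powR al)); apply: measurable_funB.
Qed.

Let in01 (t : R) : I01 t -> 0 <= t /\ 0 <= 1 - t.
Proof. by rewrite /= in_itv/= => /andP[? /ltW ?]; rewrite subr_ge0. Qed.

(** Since t^n concentrates where 1 - t is of order 1 / (n+1), the affine majorant is taken at that
    scale. The two Beta integrals are then 1 / (n+1) and 1 / (n+2), whose sum is at most 2 /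
    (n+1). *)
Lemma integral_Xu_le n :
  (\int[leb]_(t in I01) (t ^+ n * u t)%:E <= (2 * n.+1%:R `^ (- al - 1))%:E)%E.
Proof.
have N0 : 0 < n.+1%:R :> R by rewrite ltr0n.
set N : R := n.+1%:R in N0 *.
have Na : 0 <= N `^ (- al) by exact: powR_ge0.
apply: (@le_trans _ _ (\int[leb]_(t in I01)
   ((N `^ (- al))%:E * ((t ^+ n * (1 - t) ^+ 0)%:E + N%:E * (t ^+ n * (1 - t) ^+ 1)%:E)))%E).
  apply: ge0_le_integral => //.
  - by move=> t /in01[t0 _]; rewrite lee_fin mulr_ge0 ?exprn_ge0 ?u_ge0.
  - apply/measurable_EFinP; apply: measurable_funM; first exact: measurable_funX.
    by apply: measurable_funTS; exact: measurable_u.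
  - apply: measurable_funeM; apply: emeasurable_funD.
      by apply/measurable_EFinP; exact: measurable_Xonem.
    by apply: measurable_funeM; apply/measurable_EFinP; exact: measurable_Xonem.
  move=> t /in01[t0 t1].
  rewrite [leRHS](_ : _ = (N `^ (- al) * (t ^+ n * (1 - t) ^+ 0 + N * (t ^+ n * (1 - t) ^+ 1)))%:E)//.
  rewrite lee_fin expr0 mulr1 expr1.
  rewrite [leRHS](_ : _ = t ^+ n * (N `^ (- al) * (1 + N * (1 - t)))); last by ring.
  by apply: ler_wpM2l; [exact: exprn_ge0|exact: powR_scaled_upper].
have m0 k : measurable_fun I01 (fun t : R => (t ^+ n * (1 - t) ^+ k)%:E).
  by apply/measurable_EFinP; exact: measurable_Xonem.
have p0 k t : I01 t -> (0 <= (t ^+ n * (1 - t) ^+ k)%:E)%E.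
  by move=> /in01[t0 t1]; rewrite lee_fin mulr_ge0 ?exprn_ge0.
rewrite ge0_integralZl_EFin//; first last.
- by apply: emeasurable_funD => //; exact: measurable_funeM.
- by move=> t It; rewrite adde_ge0 ?p0// mule_ge0 ?p0// lee_fin ltW.
rewrite ge0_integralD//; first last.
- exact: measurable_funeM.
- by move=> t It; rewrite mule_ge0 ?p0// lee_fin ltW.
- by move=> t It; rewrite p0.
rewrite ge0_integralZl_EFin//; last by move=> t It; rewrite p0.
rewrite !integral_X_onemX [leLHS](_ : _ = (N `^ (- al) * ((n`! * 0`!)%:R / (n + 0).+1`!%:R
  + N * ((n`! * 1`!)%:R / (n + 1).+1`!%:R)))%:E)// lee_fin.
have f0 k : k`!%:R != 0 :> R by rewrite pnatr_eq0 -lt0n fact_gt0.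
have -> : N `^ (- al - 1) = N `^ (- al) * N^-1.
  by rewrite powRD ?(gt_eqF N0) ?implybT// powR_inv1// ltW.
rewrite [leRHS]mulrCA; apply: ler_wpM2l => //.
rewrite addn0 addn1 !factS fact0 !muln1 !natrM.
rewrite [X in X + _](_ : _ = N^-1); last first.
  by rewrite invfM mulrCA mulfV// mulr1.
have -> : N * (n`!%:R / (n.+2%:R * (n.+1%:R * n`!%:R))) = n.+2%:R^-1.
  rewrite -[LHS]mul1r mulrA -[RHS]mul1r; apply: beta_quotient1; rewrite ?f0 ?pnatr_eq0//.
rewrite mulr_natl mulr2n lerD2l lef_pV2 ?posrE ?ltr0n// ler_nat.
exact: leqnSn.
Qed.

(** The quadratic minorant is taken at the same scale; its negative term is moved to the other side
    so that only nonnegative functions are integrated. *)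
Lemma integral_Xu_ge n :
  ((4 / 25 * n.+1%:R `^ (- al - 1))%:E <= \int[leb]_(t in I01) (t ^+ n * u t)%:E)%E.
Proof.
have N0 : 0 < n.+1%:R :> R by rewrite ltr0n.
set N : R := n.+1%:R in N0 *.
have Na : 0 <= N `^ (- al) by exact: powR_ge0.
have m0 k : measurable_fun I01 (fun t : R => (t ^+ n * (1 - t) ^+ k)%:E).
  by apply/measurable_EFinP; exact: measurable_Xonem.
have p0 k t : I01 t -> (0 <= (t ^+ n * (1 - t) ^+ k)%:E)%E.
  by move=> /in01[t0 t1]; rewrite lee_fin mulr_ge0 ?exprn_ge0.
have mu : measurable_fun I01 (fun t => (t ^+ n * u t)%:E).
  apply/measurable_EFinP; apply: measurable_funM; first exact: measurable_funX.
  by apply: measurable_funTS; exact: measurable_u.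
have pu t : I01 t -> (0 <= (t ^+ n * u t)%:E)%E.
  by move=> /in01[t0 _]; rewrite lee_fin mulr_ge0 ?exprn_ge0 ?u_ge0.
have : (\int[leb]_(t in I01) ((N `^ (- al) * N)%:E * (t ^+ n * (1 - t) ^+ 1)%:E) <=
  \int[leb]_(t in I01) ((5 / 2)%:E * (t ^+ n * u t)%:E +
     (N `^ (- al) * (N ^+ 2 / 10))%:E * (t ^+ n * (1 - t) ^+ 2)%:E))%E.
  apply: ge0_le_integral => //.
  - by move=> t It; rewrite mule_ge0 ?p0// lee_fin mulr_ge0// ltW.
  - exact: measurable_funeM.
  - by apply: emeasurable_funD; exact: measurable_funeM.
  move=> t /in01[t0 t1]; rewrite -!EFinM -EFinD lee_fin expr1.
  have := powR_scaled_lower t1 N0; rewrite -/(u t) => h.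
  have h2 := ler_wpM2l (exprn_ge0 n t0) h.
  rewrite -lerBlDr [leLHS](_ : _ = t ^+ n * (N `^ (- al) * (N * (1 - t) - (N * (1 - t)) ^+ 2 / 10))); last by ring.
  by apply: (le_trans h2); rewrite mulrCA.
have c1 : 0 <= N `^ (- al) * N by rewrite mulr_ge0// ltW.
have c2 : 0 <= N `^ (- al) * (N ^+ 2 / 10) by rewrite mulr_ge0// divr_ge0// sqr_ge0.
have c3 : 0 <= 5 / 2 :> R by lra.
rewrite ge0_integralZl_EFin//; last by move=> t It; rewrite p0.
rewrite ge0_integralD//; first last.
- exact: measurable_funeM.
- by move=> t It; rewrite mule_ge0 ?p0.
- exact: measurable_funeM.
- by move=> t It; rewrite mule_ge0 ?pu.
rewrite ge0_integralZl_EFin// [X in (_ + X)%E]ge0_integralZl_EFin//; last by move=> t It; rewrite p0.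
rewrite !integral_X_onemX.
set J := (\int[leb]_(t in I01) (t ^+ n * u t)%:E)%E.
have J0 : (0 <= J)%E by exact: integral_ge0.
have Jfin : J \is a fin_num.
  by rewrite ge0_fin_numE// (le_lt_trans (integral_Xu_le n))// ltry.
rewrite -(fineK Jfin) -!EFinM -EFinD !lee_fin; move: (fine J) => j.
have f0 k : k`!%:R != 0 :> R by rewrite pnatr_eq0 -lt0n fact_gt0.
have -> : N `^ (- al - 1) = N `^ (- al) * N^-1.
  by rewrite powRD ?(gt_eqF N0) ?implybT// powR_inv1// ltW.
rewrite addn1 addn2 !factS fact0 !muln1 !natrM.
have -> : N `^ (- al) * N * (n`!%:R / (n.+2%:R * (n.+1%:R * n`!%:R))) = N `^ (- al) * n.+2%:R^-1.
  by apply: beta_quotient1; rewrite ?f0 ?pnatr_eq0.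
have -> : N `^ (- al) * (N ^+ 2 / 10) * (n`!%:R * 2 / (n.+3%:R * (n.+2%:R * (n.+1%:R * n`!%:R)))) =
   N `^ (- al) * (n.+2%:R^-1 * (N / n.+3%:R / 5)).
  by apply: beta_quotient2; rewrite ?f0 ?pnatr_eq0.
move=> h.
have h3 : N / n.+3%:R / 5 <= 5^-1.
  rewrite -[leRHS]mul1r ler_pM2r ?invr_gt0// ler_pdivrMr ?ltr0n// mul1r /N ler_nat.
  by rewrite (leq_trans (leqnSn _)).
have h4 : N^-1 / 2 <= n.+2%:R^-1.
  rewrite -invfM lef_pV2 ?posrE ?ltr0n ?mulr_gt0//.
  by rewrite /N -natrM ler_nat muln2 doubleS !ltnS -addnn leq_addr.
by apply: (moment_arith Na _ h3 h4 h); rewrite invr_ge0.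
Qed.

End PowerEstimates.

Lemma nneseries_shift (R : realType) (f : nat -> \bar R) : (forall i, (0 <= f i)%E) ->
  (\sum_(i <oo) f i = f 0%N + \sum_(i <oo) f i.+1)%E.
Proof.
move=> f0; rewrite nneseries_recl//; congr (_ + _)%E.
by rewrite -(nneseries_addn 1)//; apply: eq_eseriesr => i _; rewrite addn1.
Qed.

(** * Negative binomial series *)

Section NegativeBinomial.
Variables (R : realType) (x : R).
Hypothesis x0 : 0 <= x.
Hypothesis x1 : x < 1.

(** Partial sums of the expansion of (1 - x)^-(k+1). *)
Definition negbin k n : R := \sum_(m < n) 'C(m + k, k)%:R * x ^+ m.

(** Pascal's rule makes multiplication by 1 - x lower the order by one, up to the boundary term of
    the truncation. *)
Lemma negbinS k n : (1 - x) * negbin k.+1 n = negbin k n - 'C(n + k, k.+1)%:R * x ^+ n.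
Proof.
elim: n => [|n IH].
  by rewrite /negbin !big_ord0 add0n bin_small// mul0r subr0 mulr0.
rewrite /negbin !big_ord_recr/= mulrDr -/(negbin _ _) IH addSn addnS.
by rewrite !binS !natrD exprS -/(negbin _ _); ring.
Qed.

Let t0 : 0 < 1 - x. Proof. by rewrite subr_gt0. Qed.

Lemma negbin_le k n : negbin k n <= (1 - x) ^- k.+1.
Proof.
elim: k n => [|k IH] n.
  have -> : negbin 0 n = \sum_(i < n) x ^+ i by apply: eq_bigr => i _; rewrite bin0 mul1r.
  by rewrite expr1; apply: geometric_sum_le; rewrite x0.
rewrite exprS invfM mulrC -ler_pdivrMr ?invr_gt0// invrK mulrC negbinS.
by apply: le_trans (IH n); rewrite lerBlDr lerDl mulr_ge0// exprn_ge0.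
Qed.

Lemma negbin_nd k : nondecreasing_seq (negbin k).
Proof.
by apply/nondecreasing_seqP => n; rewrite /negbin big_ord_recr/= lerDl mulr_ge0// exprn_ge0.
Qed.

Lemma negbin_cvg k : negbin k @ \oo --> (1 - x) ^- k.+1.
Proof.
have cv j : cvgn (negbin j).
  by apply: nondecreasing_is_cvgn; [exact: negbin_nd|exists ((1 - x) ^- j.+1) => _ [n _ <-]; exact: negbin_le].
(* The boundary term is dominated by the general term of the convergent series of order [j.+1]. *)
have bin0_cvg j : (fun n => 'C(n + j, j.+1)%:R * x ^+ n) @ \oo --> (0 : R).
  have h : (fun n => 'C(n + j.+1, j.+1)%:R * x ^+ n) @ \oo --> (0 : R).
    apply: cvg_series_cvg_0; rewrite /series/=.
    by under eq_fun do rewrite big_mkord; exact: (cv j.+1).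
  apply: (squeeze_cvgr _ (cvg_cst 0) h); apply: nearW => n.
  rewrite mulr_ge0 ?exprn_ge0//=; apply: ler_wpM2r; first exact: exprn_ge0.
  by rewrite ler_nat addnS binS leq_addr.
elim: k => [|k IH].
  have h : (fun n => (1 - x)^-1 - (1 - x)^-1 * x ^+ n) @ \oo --> ((1 - x)^-1 - (1 - x)^-1 * 0 : R).
    apply: cvgB; first exact: cvg_cst.
    by apply: cvgMl_tmp; apply: cvg_expr; rewrite ger0_norm.
  rewrite mulr0 subr0 in h; rewrite expr1.
  rewrite (_ : negbin 0 = (fun n => (1 - x)^-1 - (1 - x)^-1 * x ^+ n))//.
  apply/funext => n.
  have -> : negbin 0 n = \sum_(i < n) x ^+ i by apply: eq_bigr => i _; rewrite bin0 mul1r.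
  have e : (1 - x) * \sum_(i < n) x ^+ i = 1 - x ^+ n.
    by rewrite -[LHS]opprK -mulNr opprB -subrX1 opprB.
  by apply: (mulfI (negbT (gt_eqF t0))); rewrite e mulrBr mulrA mulfV ?mul1r// gt_eqF.
have h : (fun n => (1 - x)^-1 * (negbin k n - 'C(n + k, k.+1)%:R * x ^+ n)) @ \oo -->
   ((1 - x)^-1 * ((1 - x) ^- k.+1 - 0) : R).
  by apply: cvgMl_tmp; apply: cvgB => //; exact: bin0_cvg.
rewrite subr0 in h; rewrite [(1 - x) ^+ k.+2]exprS invfM.
rewrite (_ : negbin k.+1 = (fun n => (1 - x)^-1 * (negbin k n - 'C(n + k, k.+1)%:R * x ^+ n)))//.
by apply/funext => n; rewrite -negbinS mulrA mulVf ?mul1r// gt_eqF.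
Qed.

End NegativeBinomial.

(** * Size of the kernel of the second derivative *)

Section Kernel.
Variables (R : realType) (al : R).
Hypothesis al0 : 0 < al.
Hypothesis al1 : al < 1.

(* Coefficients of [\sum_n |e_n''(w)|^2] as a power series in [|w|^2], for
   [e_n = z^n / sqrt (weight n)]. *)
Definition kernel_coef m : R := (m.+2%:R * m.+1%:R) ^+ 2 / weight al m.+2.

Lemma kernel_coef_ge0 m : 0 <= kernel_coef m.
Proof. by rewrite divr_ge0 ?sqr_ge0// powR_ge0. Qed.

Lemma kernel_coefE m : kernel_coef m =
  (m.+2%:R * m.+1%:R) ^+ 2 / m.+3%:R * m.+3%:R `^ al.
Proof.
have N0 : 0 < m.+3%:R :> R by rewrite ltr0n.
rewrite /kernel_coef /weight powRB ?(gt_eqF N0) ?implybT// powRr1 ?ltW//.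
by rewrite invf_div mulrA mulrAC.
Qed.

Lemma bin3E m : 'C(m + 3, 3)%:R * 6 = m.+1%:R * m.+2%:R * m.+3%:R :> R.
Proof.
have := bin_ffact (m + 3) 3; rewrite addn3 !ffactSS ffactn0 => /(congr1 (fun k => k%:R : R)).
by rewrite !natrM => ->; ring.
Qed.

Lemma bin4E m : 'C(m + 4, 4)%:R * 24 = m.+1%:R * m.+2%:R * m.+3%:R * m.+4%:R :> R.
Proof.
have := bin_ffact (m + 4) 4; rewrite addn4 !ffactSS ffactn0 => /(congr1 (fun k => k%:R : R)).
by rewrite !natrM => ->; ring.
Qed.

Lemma bin5E m : 'C(m + 5, 5)%:R * 120 = m.+1%:R * m.+2%:R * m.+3%:R * m.+4%:R * m.+4.+1%:R :> R.
Proof.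
have := bin_ffact (m + 5) 5.
rewrite (_ : m + 5 = m.+4.+1)%N ?addnS ?addn0// !ffactSS ffactn0 => /(congr1 (fun k => k%:R : R)).
by rewrite !natrM => ->; ring.
Qed.

Variable x : R.
Hypothesis x0 : 0 <= x.
Hypothesis x1 : x < 1.

Let t0 : 0 < 1 - x. Proof. by rewrite subr_gt0. Qed.
Let ta0 : 0 < (1 - x) `^ (- al). Proof. exact: powR_gt0. Qed.

Let gE : ((1 - x) `^ (al + 4))^-1 = (1 - x) `^ (- al) * (1 - x) ^- 4.
Proof.
rewrite powRD ?(gt_eqF t0) ?implybT// invfM -powRN; congr (_ * _^-1).
by rewrite powR_mulrn// ltW.
Qed.

(** The factor (m+3)^al is bounded by (1-x)^-al (1 + (1-x) (m+3)). What remains is a cubic, at most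
    6 C(m+3,3), plus 1 - x times a quartic, at most 24 C(m+4,4). Their series sum to (1-x)^-4 times
    6 and 24, whence 30. *)
Lemma kernel_upper n :
  \sum_(m < n) kernel_coef m * x ^+ m <= 30 * ((1 - x) `^ (al + 4))^-1.
Proof.
apply: (@le_trans _ _ ((1 - x) `^ (- al) * (6 * negbin x 3 n + 24 * (1 - x) * negbin x 4 n))).
  rewrite /negbin !mulr_sumr -big_split/= mulr_sumr; apply: ler_sum => m _.
  set N : R := m.+3%:R; have N0 : 0 < N by rewrite ltr0n.
  rewrite [leRHS](_ : _ = (1 - x) `^ (- al) * ('C(m + 3, 3)%:R * 6 + (1 - x) * ('C(m + 4, 4)%:R * 24)) * x ^+ m); last by ring.
  apply: ler_wpM2r; first exact: exprn_ge0.
  rewrite bin3E bin4E kernel_coefE -/N.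
  have h := powR_scaled_upper al0 al1 (ltW N0) t0.
  have N3 : N `^ al * N^-1 <= (1 - x) `^ (- al) * (1 + (1 - x) * N) * N^-1.
    by apply: ler_wpM2r => //; rewrite invr_ge0 ltW.
  rewrite [leLHS](_ : _ = (m.+2%:R * m.+1%:R) ^+ 2 * (N `^ al * N^-1)); last by ring.
  apply: (le_trans (ler_wpM2l (sqr_ge0 _) N3)).
  rewrite [leLHS](_ : _ = (1 - x) `^ (- al) * ((m.+2%:R * m.+1%:R) * ((m.+2%:R * m.+1%:R * N^-1) * (1 + (1 - x) * N)))); last by ring.
  apply: ler_wpM2l; first exact: ltW.
  rewrite [leRHS](_ : _ = (m.+2%:R * m.+1%:R) * (N * (1 + (1 - x) * m.+4%:R))); last by rewrite /N; ring.
  apply: ler_wpM2l; first by rewrite mulr_ge0.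
  apply: ler_pM.
  - by rewrite divr_ge0// ltW.
  - by rewrite addr_ge0// mulr_ge0// ltW.
  - rewrite ler_pdivrMr// /N -!natrM ler_nat; apply: leq_mul => //; exact: leqW.
  - by rewrite lerD2l ler_wpM2l ?(ltW t0)// /N ler_nat.
rewrite gE mulrCA; apply: ler_wpM2l; first exact: ltW.
have h3 := negbin_le x0 x1 3 n; have h4 := negbin_le x0 x1 4 n.
have e : (1 - x) * (1 - x) ^- 5 = (1 - x) ^- 4.
  by rewrite [(1 - x) ^+ 5]exprS invfM mulrA mulfV ?mul1r// gt_eqF.
have h5 := ler_wpM2l (ltW t0) h4; rewrite e in h5.
lra.
Qed.

(** Put N = m + 3. The constant 4/45 is 2/9 * 2/5: (m+1)(m+2) >= 2/9 N^2, with equality at m = 0,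
    and 2/5 comes from the quadratic minorant. The factor 3/4 (N + 1) <= N, valid for N >= 3, turns
    powers into binomials, so that 18 = 3/4 * 24 and 12 = 120 / 10. In the limit 4/45 * (18 - 12) =
    8/15. *)
Lemma kernel_lower :
  ((8 / 15 * ((1 - x) `^ (al + 4))^-1)%:E <= \sum_(m <oo) (kernel_coef m * x ^+ m)%:E)%E.
Proof.
pose L n := 4 / 45 * (1 - x) `^ (- al) * (18 * (1 - x) * negbin x 4 n - 12 * (1 - x) ^+ 2 * negbin x 5 n).
have cL : L @ \oo --> 8 / 15 * ((1 - x) `^ (al + 4))^-1.
  have e4 : (1 - x) * (1 - x) ^- 5 = (1 - x) ^- 4.
    by rewrite [(1 - x) ^+ 5]exprS invfM mulrA mulfV ?mul1r// gt_eqF.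
  have e5 : (1 - x) ^+ 2 * (1 - x) ^- 6 = (1 - x) ^- 4.
    by rewrite -[6%N]/(2 + 4)%N exprD invfM mulrA mulfV ?mul1r// expf_neq0// gt_eqF.
  rewrite [X in _ --> X](_ : _ = 4 / 45 * (1 - x) `^ (- al) * (18 * (1 - x) * (1 - x) ^- 5 - 12 * (1 - x) ^+ 2 * (1 - x) ^- 6)).
    apply: cvgMl_tmp; apply: cvgB; apply: cvgMl_tmp; exact: negbin_cvg.
  rewrite gE -(mulrA 18) e4 -(mulrA 12 ((1 - x) ^+ 2)) e5.
  by move: ((1 - x) `^ (- al)) ((1 - x) ^- 4) => a b; field.
have cE : (EFin \o L) @ \oo --> (8 / 15 * ((1 - x) `^ (al + 4))^-1)%:E.
  by apply: cvg_EFin; [exact: nearW|exact: cL].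
rewrite -(cvg_lim _ cE)//; apply: lime_le; first by apply/cvg_ex; eexists; exact: cE.
apply: nearW => n /=.
apply: (@le_trans _ _ (\sum_(0 <= m < n) (kernel_coef m * x ^+ m)%:E)%E); last first.
  apply: (nneseries_lim_ge (P := xpredT)) => m _ _; rewrite lee_fin mulr_ge0 ?exprn_ge0//.
  exact: kernel_coef_ge0.
rewrite big_mkord sumEFin lee_fin /L /negbin !mulr_sumr -sumrB mulr_sumr; apply: ler_sum => m _.
set N : R := m.+3%:R; have N0 : 0 < N by rewrite ltr0n.
rewrite [leLHS](_ : _ = 4 / 45 * (1 - x) `^ (- al) * (3 / 4 * (1 - x) * ('C(m + 4, 4)%:R * 24)
   - (1 - x) ^+ 2 / 10 * ('C(m + 5, 5)%:R * 120)) * x ^+ m); last by field.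
apply: ler_wpM2r; first exact: exprn_ge0.
rewrite bin4E bin5E kernel_coefE -/N.
have h := powR_scaled_lower al0 al1 (ltW N0) t0.
set A : R := m.+2%:R * m.+1%:R.
have A0 : 0 <= A by rewrite mulr_ge0.
have hA : 2 / 9 * N * N <= A.
  have : (2 * (m.+3 * m.+3) <= 9 * (m.+2 * m.+1))%N by lia.
  by rewrite -(ler_nat R) !natrM -/N -/A; lra.
have Nal : 0 <= N `^ al by exact: powR_ge0.
apply: (@le_trans _ _ (A * (2 / 9 * N * N `^ al))); last first.
  rewrite [leRHS](_ : _ = A * (A / N * N `^ al)); last by ring.
  apply: ler_wpM2l => //; apply: ler_wpM2r => //.
  by rewrite ler_pdivlMr.
have h2 : A * N * ((1 - x) `^ (- al) * ((1 - x) * N - ((1 - x) * N) ^+ 2 / 10)) <= A * N * (5 / 2 * N `^ al).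
  by apply: ler_wpM2l => //; rewrite mulr_ge0// ltW.
have h3 : (3 / 4 * (1 - x) * (m.+1%:R * m.+2%:R * N * m.+4%:R) -
  (1 - x) ^+ 2 / 10 * (m.+1%:R * m.+2%:R * N * m.+4%:R * m.+4.+1%:R)) <=
  A * N * ((1 - x) * N - ((1 - x) * N) ^+ 2 / 10).
  have -> : m.+4%:R = N + 1 :> R by rewrite /N -natr1.
  have -> : m.+4.+1%:R = N + 2 :> R by rewrite /N -!natr1; ring.
  rewrite [leLHS](_ : _ = A * N * (3 / 4 * (1 - x) * (N + 1) - (1 - x) ^+ 2 / 10 * ((N + 1) * (N + 2)))); last by rewrite /A; ring.
  apply: ler_wpM2l; first by rewrite mulr_ge0// ltW.
  have N3 : 3 <= N by rewrite /N ler_nat.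
  have t2 : 0 <= (1 - x) ^+ 2 by exact: sqr_ge0.
  apply: lerB.
    rewrite (_ : 3 / 4 * (1 - x) * (N + 1) = (1 - x) * (3 / 4 * (N + 1))); last by ring.
    by apply: ler_wpM2l; [exact: ltW|move: (N) N3 => k; lra].
  rewrite exprMn mulrAC; apply: ler_wpM2l; first by rewrite divr_ge0.
  by move: (N) N3 => k; nra.
have h4 := ler_wpM2l (ltW ta0) h3.
have e : A * N * ((1 - x) `^ (- al) * ((1 - x) * N - ((1 - x) * N) ^+ 2 / 10)) =
  (1 - x) `^ (- al) * (A * N * ((1 - x) * N - ((1 - x) * N) ^+ 2 / 10)) by ring.
rewrite e in h2; have h5 := le_trans h4 h2.
rewrite -(ler_pM2l (_ : 0 < 45 / 4 :> R))//.
apply: le_trans (le_trans h5 _); first by rewrite le_eqVlt; apply/orP; left; apply/eqP; field.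
by rewrite le_eqVlt; apply/orP; left; apply/eqP; field.
Qed.

End Kernel.

(** * The Dirichlet norm as an area integral *)

Section WeightedNorm.
Variables (R : realType) (al : R).
Local Notation C := R[i].
Hypothesis al0 : 0 < al.
Hypothesis al1 : al < 1.
Local Notation mR := (measurableTypeR R).
Local Notation T := (measurableTypeR R * measurableTypeR R)%type.
Local Notation area := (@area R).
Local Notation D := (@unit_disc R).
Local Notation leb := (@lebesgue_measure R).
Implicit Types a b : nat -> C.

Definition wnorm2 a : \bar R := (\sum_(n <oo) (weight al n * modC (a n) ^+ 2)%:E)%E.

Definition dirichlet_integral a : \bar R :=
  (\int[area]_(p in D) (modC (psum (psder a) (toC p)) ^+ 2 * (1 - nrm2 p) `^ al)%:E)%E.

Lemma weight_ge1 n : 1 <= weight al n.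
Proof.
rewrite -[leLHS](powRr0 n.+1%:R); apply: ler_powR; first by rewrite ler1n.
by rewrite subr_ge0 ltW.
Qed.

Lemma weight_gt0 n : 0 < weight al n.
Proof. by apply: lt_le_trans (weight_ge1 n). Qed.

Lemma wterm_ge0 a n : 0 <= weight al n * modC (a n) ^+ 2.
Proof. by rewrite mulr_ge0 ?exprn_ge0 ?normc_ge0 ?ltW ?weight_gt0. Qed.

Lemma wnorm2_ge0 a : (0 <= wnorm2 a)%E.
Proof. by apply: nneseries_ge0 => n _ _; rewrite lee_fin wterm_ge0. Qed.

Lemma wnorm2_ge_partial a n : ((\sum_(i < n) weight al i * modC (a i) ^+ 2)%:E <= wnorm2 a)%E.
Proof.
rewrite -sumEFin -(big_mkord predT (fun i => (weight al i * modC (a i) ^+ 2)%:E)).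
by apply: (nneseries_lim_ge (P := xpredT)) => i _ _; rewrite lee_fin wterm_ge0.
Qed.

Lemma wnorm2_le a (B : R) : (forall n, \sum_(i < n) weight al i * modC (a i) ^+ 2 <= B) ->
  (wnorm2 a <= B%:E)%E.
Proof.
move=> H; apply: lime_le.
  by apply: is_cvg_nneseries => n _ _; rewrite lee_fin wterm_ge0.
by apply: nearW => n; rewrite big_mkord sumEFin lee_fin.
Qed.

Lemma wnorm2_term a n : ((modC (a n) ^+ 2)%:E <= wnorm2 a)%E.
Proof.
apply: le_trans (wnorm2_ge_partial a n.+1); rewrite lee_fin big_ord_recr/=.
apply: (@le_trans _ _ (weight al n * modC (a n) ^+ 2)).
  by rewrite ler_peMl ?weight_ge1// exprn_ge0// normc_ge0.
by rewrite lerDr sumr_ge0// => i _; exact: wterm_ge0.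
Qed.

Lemma psd_bounded a (B : R) : (forall n, modC (a n) <= B) -> psd a.
Proof.
move=> H r /andP[r0 r1]; exists B => n; apply: le_trans (H n).
by rewrite ler_piMr ?normc_ge0// exprn_ile1// ltW.
Qed.

Lemma wnorm2_bound a (e : R) : 0 <= e -> (wnorm2 a <= (e ^+ 2)%:E)%E -> forall n, modC (a n) <= e.
Proof.
move=> e0 h n; have := le_trans (wnorm2_term a n) h; rewrite lee_fin.
by rewrite ler_pXn2r ?nnegrE ?normc_ge0.
Qed.

Lemma wnorm2_psd a : (wnorm2 a < +oo)%E -> psd a.
Proof.
move=> h; have fin : wnorm2 a \is a fin_num by rewrite ge0_fin_numE ?wnorm2_ge0.
apply: (@psd_bounded a (Num.sqrt (fine (wnorm2 a)))).
apply: wnorm2_bound; first exact: sqrtr_ge0.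
by rewrite sqr_sqrtr ?fine_ge0 ?wnorm2_ge0// fineK.
Qed.

Let u (t : R) := (1 - t) `^ al.
Local Notation c0 := (@area_ball1 R).

Lemma moment_radial n :
  (moment u n = c0%:E * \int[leb]_(t in `[0%R, 1%R[%classic) (t ^+ n * u t)%:E)%E.
Proof.
apply: (@area_radial R (fun t => (t ^+ n * u t)%:E)) => [|t].
  apply/measurable_EFinP; apply: measurable_funM; first exact: measurable_funX.
  by apply: measurable_funTS; exact: measurable_u.
by rewrite /= in_itv/= => /andP[t0 _]; rewrite lee_fin mulr_ge0 ?exprn_ge0 ?powR_ge0.
Qed.

Lemma moment_le n : (moment u n <= (2 * c0 * n.+1%:R `^ (- al - 1))%:E)%E.
Proof.
rewrite moment_radial mulrC mulrA [X in (_ <= X)%E](_ : _ = c0%:E * (2 * n.+1%:R `^ (- al - 1))%:E)%E.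
  by apply: lee_wpmul2l; rewrite ?lee_fin ?(ltW (area_ball1_pos R))// integral_Xu_le.
by rewrite -EFinM; congr (_%:E); ring.
Qed.

Lemma moment_ge n : ((4 / 25 * c0 * n.+1%:R `^ (- al - 1))%:E <= moment u n)%E.
Proof.
rewrite moment_radial [X in (X <= _)%E](_ : _ = c0%:E * (4 / 25 * n.+1%:R `^ (- al - 1))%:E)%E.
  by apply: lee_wpmul2l; rewrite ?lee_fin ?(ltW (area_ball1_pos R))// integral_Xu_ge.
by rewrite -EFinM; congr (_%:E); ring.
Qed.

Lemma dirichlet_integralE a : psd a ->
  (dirichlet_integral a = \sum_(n <oo) (modC (psder a n) ^+ 2)%:E * moment u n)%E.
Proof.
move=> /psd_der ha; apply: (@area_parseval R u) => //.
  by move=> t; exact: powR_ge0.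
exact: measurable_u.
Qed.

(** The squared factor n + 1 of the derivative times the order of the n-th moment is the order of
    the weight; this identity ties the norm to the area integral. *)
Lemma powR_weight n : n.+1%:R ^+ 2 * n.+1%:R `^ (- al - 1) = n.+1%:R `^ (1 - al).
Proof.
have N0 : 0 < n.+1%:R :> R by rewrite ltr0n.
rewrite -powR_mulrn ?(ltW N0)// -powRD; first by congr (_ `^ _); ring.
by rewrite (gt_eqF N0) implybT.
Qed.

Lemma weight_prev n : n.+1%:R `^ (1 - al) <= weight al n.+1.
Proof.
apply: ge0_ler_powR; rewrite ?nnegrE ?ler0n ?subr_ge0 ?(ltW al1)//.
by rewrite ler_nat.
Qed.

(** The derivative sees the coefficient [a n.+1], whose weight has base n + 2 while the moment has
    base n + 1; the shift costs a factor 2. *)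
Lemma weight_next n : weight al n.+1 <= 2 * n.+1%:R `^ (1 - al).
Proof.
have h : 0 <= 1 - al by rewrite subr_ge0 ltW.
apply: (@le_trans _ _ ((2 * n.+1%:R) `^ (1 - al))).
  apply: ge0_ler_powR; rewrite ?nnegrE ?mulr_ge0// -natrM ler_nat; lia.
rewrite powRM//; apply: ler_wpM2r; first exact: powR_ge0.
rewrite -[leRHS](powRr1 (_ : 0 <= 2))//; apply: ler_powR; first by rewrite ler1n.
by rewrite lerBlDr lerDl ltW.
Qed.

Lemma dirichlet_integral_le a : psd a ->
  (dirichlet_integral a <= (2 * c0)%:E * wnorm2 a)%E.
Proof.
move=> ha; rewrite dirichlet_integralE// /wnorm2
  (nneseries_shift (f := fun n => (weight al n * modC (a n) ^+ 2)%:E)); last first.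
  by move=> i; rewrite lee_fin wterm_ge0.
have c00 := ltW (area_ball1_pos R).
apply: (@le_trans _ _ ((2 * c0)%:E * \sum_(n <oo) (weight al n.+1 * modC (a n.+1) ^+ 2)%:E)%E).
  rewrite -nneseriesZl; last by move=> i _; rewrite lee_fin wterm_ge0.
  apply: lee_nneseries => [n _ _|n _].
    by rewrite mule_ge0 ?lee_fin ?exprn_ge0 ?normc_ge0 ?moment_ge0//; move=> t; exact: powR_ge0.
  apply: (@le_trans _ _ ((modC (psder a n) ^+ 2)%:E * (2 * c0 * n.+1%:R `^ (- al - 1))%:E)%E).
    by apply: lee_wpmul2l; [rewrite lee_fin exprn_ge0// normc_ge0|exact: moment_le].
  rewrite -!EFinM lee_fin /psder normcM normc_nat exprMn.
  rewrite [leLHS](_ : _ = 2 * c0 * ((n.+1%:R ^+ 2 * n.+1%:R `^ (- al - 1)) * modC (a n.+1) ^+ 2)); last by ring.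
  rewrite powR_weight; apply: ler_wpM2l; first by rewrite mulr_ge0.
  by apply: ler_wpM2r; [rewrite exprn_ge0// normc_ge0|exact: weight_prev].
apply: lee_wpmul2l; first by rewrite lee_fin mulr_ge0.
by apply: leeDr; rewrite lee_fin wterm_ge0.
Qed.

(** The constant coefficient is invisible to the derivative and stands alone. For the others, 25/2
    is the 2 of [weight_next] divided by the 4/25 of [moment_ge]. *)
Lemma wnorm2_dirichlet_integral a : psd a ->
  (wnorm2 a <= (modC (a 0%N) ^+ 2)%:E + (25 / 2 / c0)%:E * dirichlet_integral a)%E.
Proof.
move=> ha; rewrite dirichlet_integralE// /wnorm2
  (nneseries_shift (f := fun n => (weight al n * modC (a n) ^+ 2)%:E)); last first.
  by move=> i; rewrite lee_fin wterm_ge0.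
have c00 := area_ball1_pos R.
apply: leeD; first by rewrite lee_fin /weight powR1 mul1r.
rewrite -nneseriesZl; last first.
  by move=> i _; rewrite mule_ge0 ?lee_fin ?exprn_ge0 ?normc_ge0 ?moment_ge0//; move=> t; exact: powR_ge0.
apply: lee_nneseries => [n _ _|n _]; first by rewrite lee_fin wterm_ge0.
apply: (@le_trans _ _ ((25 / 2 / c0)%:E * ((modC (psder a n) ^+ 2)%:E * (4 / 25 * c0 * n.+1%:R `^ (- al - 1))%:E))%E).
  rewrite -!EFinM lee_fin /psder normcM normc_nat exprMn.
  rewrite [leRHS](_ : _ = 2 * (n.+1%:R ^+ 2 * n.+1%:R `^ (- al - 1)) * modC (a n.+1) ^+ 2); last first.
    by move: (n.+1%:R `^ (- al - 1)) (modC _) (n.+1%:R : R) => x y z; field; rewrite gt_eqF.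
  rewrite powR_weight; apply: ler_wpM2r; first by rewrite exprn_ge0// normc_ge0.
  exact: weight_next.
apply: lee_wpmul2l; first by rewrite lee_fin divr_ge0// ltW.
by apply: lee_wpmul2l; [rewrite lee_fin exprn_ge0// normc_ge0|exact: moment_ge].
Qed.

End WeightedNorm.

(** * Uniqueness of the coefficients *)

Section Coefficients.
Variable R : realType.
Local Notation C := R[i].
Implicit Types a b : nat -> C.

(** Parseval on the disc, with the sample exponent 1/2: the integral is 0, so every term of a
    nonnegative series vanishes, and the moments are positive. *)
Lemma psum_eq0 a : psd a -> (forall z, modC z < 1 -> psum a z = 0) -> forall n, a n = 0.
Proof.
move=> ha H n.
have al01 : 0 < (2^-1 : R) < 1 by apply/andP; split; lra.
have /andP[al0 al1] := al01.
pose v (t : R) := (1 - t) `^ 2^-1.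
have v0 t : 0 <= v t by exact: powR_ge0.
have mv : measurable_fun setT v by exact: measurable_u.
have h := area_parseval v0 mv ha.
rewrite integral0_eq in h; last first.
  by move=> p Dp; rewrite H// Normc.normc0 expr0n/= mul0r.
have mpos : (0 < moment v n)%E.
  apply: lt_le_trans (moment_ge al0 al1 n); rewrite lte_fin.
  by rewrite mulr_gt0 ?powR_gt0// mulr_gt0// area_ball1_pos.
have t0 i : (0 <= (modC (a i) ^+ 2)%:E * moment v i)%E.
  by rewrite mule_ge0 ?moment_ge0 ?lee_fin ?exprn_ge0 ?normc_ge0.
have : ((modC (a n) ^+ 2)%:E * moment v n <= 0)%E.
  rewrite h; apply: (@le_trans _ _ (\sum_(0 <= i < n.+1) (modC (a i) ^+ 2)%:E * moment v i)%E).
    by rewrite big_nat_recr//= leeDr// sume_ge0.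
  exact: (nneseries_lim_ge (P := xpredT)).
have [//|an0] := eqVneq (a n) 0.
have an : 0 < modC (a n) ^+ 2 by rewrite exprn_gt0// normc_gt0.
by rewrite leNgt mule_gt0.
Qed.

Lemma psum_inj a b : psd a -> psd b -> (forall z, modC z < 1 -> psum a z = psum b z) -> a = b.
Proof.
move=> ha hb H; apply/funext => n; apply/eqP; rewrite -subr_eq0; apply/eqP.
rewrite addrC -mulN1r; apply: (@psum_eq0 (fun n => -1 * b n + a n) (psd_lin (-1) hb ha)) => z z1.
by rewrite psum_lin// H// mulN1r addNr.
Qed.

(** [coef] is a choice among all valid sequences; uniqueness identifies the chosen one with any
    explicit expansion. *)
Lemma coefE (f : C -> C) a : psd a -> (forall z, modC z < 1 -> f z = psum a z) -> coef f = a.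
Proof.
move=> ha hf; rewrite /coef.
have h : [set a | power_series_on_disc f a] a by exact: psd_power_series.
have [hb fb] := power_series_psd (xgetPex (fun=> 0) (ex_intro _ a h)).
by apply: psum_inj => // z z1; rewrite -fb// hf.
Qed.

Variable al : R.

Lemma dirichletP (f : C -> C) : dirichlet al f ->
  [/\ psd (coef f), forall z, modC z < 1 -> f z = psum (coef f) z &
      (wnorm2 al (coef f) < +oo)%E].
Proof.
move=> [hol [a ha] fin].
have [pa fa] := power_series_psd ha.
have e := coefE pa fa; rewrite e; split => //.
by move: fin; rewrite /dirichlet_norm2 e.
Qed.

Lemma psd_dirichlet (f : C -> C) a : psd a -> (forall z, modC z < 1 -> f z = psum a z) ->
  (wnorm2 al a < +oo)%E -> dirichlet al f.
Proof.
move=> ha fa fin; split.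
- by move=> z z1; have [] := psum_derive ha fa z1.
- by exists a; exact: psd_power_series.
- by rewrite /dirichlet_norm2 (coefE ha fa).
Qed.

Lemma dirichlet_norm2E (f : C -> C) : dirichlet_norm2 al f = wnorm2 al (coef f).
Proof. by []. Qed.

End Coefficients.

(** * Orthonormal bases of the Dirichlet space *)

Lemma sum_single (R : realType) (F : nat -> R[i]) n M : (n < M)%N ->
  (forall i, i != n -> F i = 0) -> \sum_(i < M) F i = F n.
Proof.
move=> nM H; rewrite (bigD1 (Ordinal nM))//= big1 ?addr0// => i hi; apply: H.
by apply: contra hi => /eqP hi; apply/eqP/val_inj.
Qed.

Section Orthonormal.
Variables (R : realType) (al : R).
Local Notation C := R[i].
Hypothesis al0 : 0 < al.
Hypothesis al1 : al < 1.
Implicit Types (a b : nat -> C) (f g : C -> C).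
Local Notation weight := (weight al).
Local Notation wnorm2 := (wnorm2 al).

Lemma psd0 : psd (fun _ => 0 : C).
Proof. by apply: (@psd_bounded R _ 0) => n; rewrite Normc.normc0. Qed.

Lemma psum0 z : psum (fun _ => 0 : C) z = 0.
Proof.
rewrite /psum; apply: (@cvg_lim (Cplx R)); first exact: norm_hausdorff.
rewrite (_ : series _ = fun=> 0); first exact: cvg_cst.
by apply/funext => n; rewrite /series/= big1// => i _; rewrite mul0r.
Qed.

Lemma psd_sum (c : nat -> C) (A : nat -> nat -> C) N : (forall k, psd (A k)) ->
  psd (fun n => \sum_(k < N) c k * A k n).
Proof.
move=> hA; elim: N => [|N IH].
  by rewrite (_ : (fun _ => _) = fun=> 0); [exact: psd0|apply/funext => n; rewrite big_ord0].
rewrite (_ : (fun _ => _) = fun n => c N * A N n + \sum_(k < N) c k * A k n).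
  exact: psd_lin.
by apply/funext => n; rewrite big_ord_recr/= addrC.
Qed.

Lemma psum_sum (c : nat -> C) (A : nat -> nat -> C) N z : (forall k, psd (A k)) -> modC z < 1 ->
  psum (fun n => \sum_(k < N) c k * A k n) z = \sum_(k < N) c k * psum (A k) z.
Proof.
move=> hA z1; elim: N => [|N IH].
  rewrite big_ord0 (_ : (fun _ => _) = fun=> 0); first exact: psum0.
  by apply/funext => n; rewrite big_ord0.
rewrite (_ : (fun _ => _) = fun n => c N * A N n + \sum_(k < N) c k * A k n).
  by rewrite psum_lin ?IH ?big_ord_recr//= 1?addrC//; exact: psd_sum.
by apply/funext => n; rewrite big_ord_recr/= addrC.
Qed.

Lemma wnorm2_sub_le a b :
  (wnorm2 a <= 2%:E * wnorm2 (fun n => (a n - b n)%R) + 2%:E * wnorm2 b)%E.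
Proof.
have t0 c i : (0 <= (weight i * modC (c i) ^+ 2)%:E)%E by rewrite lee_fin wterm_ge0.
rewrite /wnorm2 -!nneseriesZl; try by move=> n *; first [exact: t0 | exact: (t0 (fun i => a i - b i))].
rewrite -nneseriesD; try by move=> n *; apply: mule_ge0; rewrite ?lee_fin//; first [exact: (t0 (fun i => a i - b i)) | exact: (t0 b)].
apply: lee_nneseries => [n _ _|n _]; first by rewrite lee_fin wterm_ge0.
rewrite -!EFinM -EFinD lee_fin !mulrA ![2 * weight n]mulrC -!mulrA -mulrDr.
apply: ler_wpM2l; first by rewrite ltW// weight_gt0.
have := normcD (a n - b n) (b n); rewrite subrK => h.
have := normc_ge0 (a n); have := normc_ge0 (a n - b n); have := normc_ge0 (b n).
move: (modC (a n)) (modC (a n - b n)) (modC (b n)) h => x y z h z0 y0 x0.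
have : 0 <= (y - z) ^+ 2 by exact: sqr_ge0.
nra.
Qed.

Lemma wnorm2_fin_num a : (wnorm2 a < +oo)%E -> wnorm2 a \is a fin_num.
Proof. by move=> h; rewrite ge0_fin_numE//; exact: (wnorm2_ge0 al1). Qed.

Lemma dot_cvg f g : dirichlet al f -> dirichlet al g ->
  (fun M => modC (\sum_(n < M) (weight n)%:C%C * coef f n * (coef g n)^*%C - dirichlet_dot al f g))
    @ \oo --> (0 : R).
Proof.
move=> /dirichletP[_ _ ff] /dirichletP[_ _ gg].
have fa := wnorm2_fin_num ff.
have fb := wnorm2_fin_num gg.
have [n|l hl] := @normc_summable_cvg R (fun n => (weight n)%:C%C * coef f n * (coef g n)^*%C)
    (fine (wnorm2 (coef f)) + fine (wnorm2 (coef g))).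
  apply: (@le_trans _ _ (\sum_(i < n) weight i * modC (coef f i) ^+ 2 + \sum_(i < n) weight i * modC (coef g i) ^+ 2)).
    rewrite -big_split/=; apply: ler_sum => i _.
    rewrite !normcM normc_conj normc_real ger0_norm ?(ltW (weight_gt0 al1 i))//.
    rewrite -mulrA -mulrDr; apply: ler_wpM2l; first by rewrite ltW// weight_gt0.
    move: (coef f i) (coef g i) => u v; have := normc_ge0 u; have := normc_ge0 v.
    move: (modC u) (modC v) => x y x0 y0.
    by have : 0 <= (x - y) ^+ 2; [exact: sqr_ge0|nra].
  move: (coef f) (coef g) fa fb => u v fa fb.
  by apply: lerD; rewrite -lee_fin fineK//; exact: (wnorm2_ge_partial al1).
have hl' : (fun n => \sum_(i < n) (weight i)%:C%C * coef f i * (coef g i)^*%C : Cplx R) @ \oo --> (l : Cplx R).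
  by apply/cvgCP.
suff -> : dirichlet_dot al f g = l by [].
apply: (@cvg_lim (Cplx R)); first exact: norm_hausdorff.
by rewrite /series/=; under eq_fun do rewrite big_mkord.
Qed.

Lemma cvgC_sum (c : nat -> C) (v : nat -> nat -> C) (l : nat -> C) N :
  (forall k, (fun M => modC (v k M - l k)) @ \oo --> (0 : R)) ->
  (fun M => modC (\sum_(k < N) c k * v k M - \sum_(k < N) c k * l k)) @ \oo --> (0 : R).
Proof.
move=> H; elim: N => [|N IH].
  rewrite (_ : (fun _ => _) = fun=> 0); first exact: cvg_cst.
  by apply/funext => M; rewrite !big_ord0 subrr Normc.normc0.
have h := cvgC_lin (c N) (H N) IH.
rewrite (_ : (fun _ => _) = (fun M => modC (c N * v N M + \sum_(k < N) c k * v k M -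
  (c N * l N + \sum_(k < N) c k * l k))))//.
by apply/funext => M; rewrite !big_ord_recr/= ![_ + c N * _]addrC.
Qed.

Section Basis.
Variable e : nat -> C -> C.
Hypothesis eD : forall n, dirichlet al (e n).
Hypothesis eO : forall m n, dirichlet_dot al (e m) (e n) = (m == n)%:R.

(** Cut after M coordinates, the squared norm is a finite quadratic form in the truncated Gram
    entries [Dt k l M], which tend to the Kronecker delta; it also increases with M. *)
Lemma wnorm2_orthonormal_sum (c : nat -> C) N :
  (wnorm2 (fun n => (\sum_(k < N) c k * coef (e k) n)%R) <= (\sum_(k < N) modC (c k) ^+ 2)%:E)%E.
Proof.
pose X M := \sum_(n < M) weight n * modC (\sum_(k < N) c k * coef (e k) n) ^+ 2.
pose Dt k l M := \sum_(n < M) (weight n)%:C%C * coef (e k) n * (coef (e l) n)^*%C.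
have XE M : (X M)%:C%C = \sum_(k < N) c k * \sum_(l < N) (c l)^*%C * Dt k l M.
  rewrite /X rmorph_sum/=.
  transitivity (\sum_(n < M) \sum_(k < N) \sum_(l < N) c k * (c l)^*%C * ((weight n)%:C%C * coef (e k) n * (coef (e l) n)^*%C)).
    apply: eq_bigr => n _; rewrite rmorphM/= -mul_conjc rmorph_sum/= mulr_suml mulr_sumr.
    apply: eq_bigr => k _; rewrite mulr_sumr mulr_sumr; apply: eq_bigr => l _.
    by rewrite rmorphM/=; ring.
  rewrite exchange_big/=; apply: eq_bigr => k _; rewrite exchange_big/= mulr_sumr.
  by apply: eq_bigr => l _; rewrite /Dt mulrA mulr_sumr.
have cX : X @ \oo --> \sum_(k < N) modC (c k) ^+ 2.
  have h : (fun M => modC (\sum_(k < N) c k * (\sum_(l < N) (c l)^*%C * Dt k l M) -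
      \sum_(k < N) c k * (\sum_(l < N) (c l)^*%C * (k == l :> nat)%:R))) @ \oo --> (0 : R).
    apply: (cvgC_sum c N (v := fun k M => \sum_(l < N) (c l)^*%C * Dt k l M)
       (l := fun k => \sum_(l < N) (c l)^*%C * (k == l :> nat)%:R)) => k.
    apply: (cvgC_sum (fun l => (c l)^*%C) N (v := fun l M => Dt k l M) (l := fun l => (k == l :> nat)%:R)) => l.
    by rewrite -eO; exact: dot_cvg.
  have YE : \sum_(k < N) c k * (\sum_(l < N) (c l)^*%C * (k == l :> nat)%:R) = (\sum_(k < N) modC (c k) ^+ 2)%:C%C.
    rewrite rmorph_sum/=; apply: eq_bigr => k _; rewrite -mul_conjc; congr (_ * _).
    rewrite (sum_single (F := fun l => (c l)^*%C * (k == l :> nat)%:R) (n := k))//.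
      by rewrite eqxx mulr1.
    by move=> l; rewrite eq_sym => /negbTE ->; rewrite mulr0.
  apply/cvgrPdist_le => eps eps0; move/cvgrPdist_le : h => /(_ _ eps0); apply: filterS => M.
  rewrite sub0r normrN -XE YE.
  have -> : (X M)%:C%C - (\sum_(k < N) modC (c k) ^+ 2)%:C%C = (X M - \sum_(k < N) modC (c k) ^+ 2)%:C%C :> C by rewrite rmorphB.
  by rewrite normc_real normr_id distrC.
have ndX : nondecreasing_seq X.
  apply/nondecreasing_seqP => M; rewrite /X big_ord_recr/= lerDl mulr_ge0 ?exprn_ge0 ?normc_ge0//.
  by rewrite ltW// weight_gt0.
apply: (wnorm2_le al1) => M; rewrite -(cvg_lim _ cX)//.
by apply: (nondecreasing_cvgn_le ndX); apply/cvg_ex; eexists; exact: cX.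
Qed.

Hypothesis eC : forall f, dirichlet al f ->
  dirichlet_norm2 al (fun z => f z - \sum_(k < n) dirichlet_dot al f (e k) * e k z) @[n --> \oo] --> 0%E.

(* Parseval up to the factor 2, which is all that is needed. *)
Lemma wnorm2_le_basis r : dirichlet al r ->
  (wnorm2 (coef r) <= 2%:E * \sum_(k <oo) (modC (dirichlet_dot al r (e k)) ^+ 2)%:E)%E.
Proof.
move=> rD; have [pr rE rfin] := dirichletP rD.
pose c k := dirichlet_dot al r (e k).
pose A k := coef (e k).
have pA k : psd (A k) by have [] := dirichletP (eD k).
have EA k z : modC z < 1 -> e k z = psum (A k) z by have [_ h _] := dirichletP (eD k); exact: h.
pose G N n := coef r n - \sum_(k < N) c k * A k n.
have GE N : coef (fun z => r z - \sum_(k < N) dirichlet_dot al r (e k) * e k z) = G N.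
  have pG : psd (fun n => -1 * (\sum_(k < N) c k * A k n) + coef r n).
    by apply: psd_lin => //; exact: psd_sum.
  have gE : G N = fun n => -1 * (\sum_(k < N) c k * A k n) + coef r n.
    by apply/funext => n; rewrite /G mulN1r addrC.
  rewrite gE; apply: coefE => // z z1.
  rewrite psum_lin//; last exact: psd_sum.
  rewrite (rE _ z1) (psum_sum c N pA z1) mulN1r [RHS]addrC; congr (_ - _).
  by apply: eq_bigr => k _; rewrite (EA k z z1).
have T0 k : (0 <= (modC (c k) ^+ 2)%:E)%E by rewrite lee_fin exprn_ge0// normc_ge0.
apply/lee_addgt0Pr => eps eps0.
have e2 : 0 < eps / 2 by rewrite divr_gt0.
have := eC rD => /fine_cvgP[fin /cvgrPdist_le /(_ _ e2)].
move=> h; have [N [Nfin HN]] : exists N, dirichlet_norm2 al (fun z => r z - \sum_(k < N) dirichlet_dot al r (e k) * e k z) \is a fin_num /\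
   fine (dirichlet_norm2 al (fun z => r z - \sum_(k < N) dirichlet_dot al r (e k) * e k z)) <= eps / 2.
  have [N _ HN] := filterI fin h; exists N; have [h1 h2] := HN N (leqnn N); split => //.
  by move: h2; rewrite /= sub0r normrN; apply: le_trans; exact: ler_norm.
(* Split r into remainder and partial expansion: the remainder has squared norm at most eps / 2,
   hence costs eps, and the expansion costs twice the sum of squared coordinates. *)
apply: (le_trans (wnorm2_sub_le (coef r) (fun n => \sum_(k < N) c k * A k n))).
rewrite addeC; apply: leeD.
  apply: lee_wpmul2l; first by rewrite lee_fin.
  apply: (le_trans (wnorm2_orthonormal_sum c N)).
  rewrite -sumEFin -(big_mkord predT (fun k => (modC (c k) ^+ 2)%:E)).
  exact: (nneseries_lim_ge (P := xpredT)).
rewrite -[wnorm2 _](_ : dirichlet_norm2 al (fun z => r z - \sum_(k < N) dirichlet_dot al r (e k) * e k z) = _); last first.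
  by rewrite dirichlet_norm2E GE.
by rewrite -(fineK Nfin) -EFinM lee_fin; lra.
Qed.

End Basis.

(* Coefficients of the function representing the functional [f |-> f''(w)]. *)
Definition eval2_coef (w : C) n : C :=
  if n is m.+2 then (m.+2%:R * m.+1%:R) * (w^*%C) ^+ m * ((weight m.+2)^-1)%:C%C else 0.

Lemma wnorm2_eval2 w :
  wnorm2 (eval2_coef w) = (\sum_(m <oo) (kernel_coef al m * (modC w ^+ 2) ^+ m)%:E)%E.
Proof.
have t0 i : (0 <= (weight i * modC (eval2_coef w i) ^+ 2)%:E)%E by rewrite lee_fin wterm_ge0.
rewrite /wnorm2 (nneseries_shift (f := fun n => (weight n * modC (eval2_coef w n) ^+ 2)%:E))//.
rewrite (nneseries_shift (f := fun n => (weight n.+1 * modC (eval2_coef w n.+1) ^+ 2)%:E))//.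
have -> : eval2_coef w 0 = 0 by [].
have -> : eval2_coef w 1 = 0 by [].
rewrite Normc.normc0 expr0n/= !mulr0 !add0e; apply: eq_eseriesr => m _.
have w0 := weight_gt0 al1 m.+2.
rewrite !normcM normcX normc_conj normc_real !normc_nat ger0_norm ?invr_ge0 ?ltW//.
congr (_%:E); rewrite /kernel_coef -exprM mulnC exprM.
by move: (modC w ^+ m) (m.+2%:R : R) (m.+1%:R : R) => x y z; field; rewrite gt_eqF.
Qed.

Lemma wnorm2_eval2_lty w : modC w < 1 -> (wnorm2 (eval2_coef w) < +oo)%E.
Proof.
move=> w1; have x0 : 0 <= modC w ^+ 2 by exact: sqr_ge0.
have x1 : modC w ^+ 2 < 1 by rewrite exprn_ilt1// normc_ge0.
rewrite wnorm2_eval2; apply: (@le_lt_trans _ _ (30 * ((1 - modC w ^+ 2) `^ (al + 4))^-1)%:E).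
  apply: lime_le.
    by apply: is_cvg_nneseries => n _ _; rewrite lee_fin; apply: mulr_ge0; [exact: kernel_coef_ge0|exact: exprn_ge0].
  by apply: nearW => n; rewrite big_mkord sumEFin lee_fin kernel_upper.
by rewrite ltry.
Qed.

Lemma dot_eval2 w f : modC w < 1 -> dirichlet al f ->
  dirichlet_dot al (psum (eval2_coef w)) f = (psum (psder (psder (coef f))) w)^*%C.
Proof.
move=> w1 fD; have [pf fE _] := dirichletP fD.
have rfin := wnorm2_eval2_lty w1.
have pr : psd (eval2_coef w) by exact: (wnorm2_psd al1).
have rD : dirichlet al (psum (eval2_coef w)) by exact: (psd_dirichlet pr).
have h := dot_cvg rD fD; rewrite (coefE pr)// in h.
have h2 : (fun M => modC (\sum_(m < M) psder (psder (coef f)) m * w ^+ m - psum (psder (psder (coef f))) w)) @ \oo --> (0 : R).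
  by apply: psum_cvg => //; do 2 apply: psd_der.
(* The first two coefficients of the representing function vanish, so M + 2 terms of the inner
   product match M terms of the second derivative, up to conjugation. *)
apply: (cvgC_unique (u := fun M => \sum_(n < M.+2) (weight n)%:C%C * eval2_coef w n * (coef f n)^*%C)).
  move: h; rewrite -cvg_shiftS => h1; move: h1; rewrite -cvg_shiftS; exact.
rewrite (_ : (fun _ => _) = (fun M => modC (\sum_(m < M) psder (psder (coef f)) m * w ^+ m - psum (psder (psder (coef f))) w)))//.
apply/funext => M; rewrite -[RHS]normc_conj rmorphB/= rmorph_sum/=; congr (modC (_ - _)).
rewrite !big_ord_recl/= !mulr0 !mul0r !add0r; apply: eq_bigr => m _.
rewrite /bump/= !add1n /psder !rmorphM/= rmorphXn/= !rmorph_nat.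
have -> : (weight m.+2)%:C%C * (m.+2%:R * m.+1%:R * w^*%C ^+ m * ((weight m.+2)^-1)%:C%C) =
  ((weight m.+2)%:C%C * ((weight m.+2)^-1)%:C%C) * (m.+2%:R * m.+1%:R * w^*%C ^+ m) by ring.
by rewrite -rmorphM/= mulfV ?gt_eqF ?weight_gt0// rmorph1; ring.
Qed.

(** The coordinates of the function representing f |-> f''(w) are the conjugates of the values
    e_k''(w). Parseval up to the factor 2 then leaves half of the 8/15 of [kernel_lower], for every
    basis at once. *)
Lemma kernel_basis_lower (e : nat -> C -> C) w : orthonormal_basis al e -> modC w < 1 ->
  ((4 / 15 * ((1 - modC w ^+ 2) `^ (al + 4))^-1)%:E <=
   \sum_(k <oo) (modC (psum (psder (psder (coef (e k)))) w) ^+ 2)%:E)%E.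
Proof.
move=> [eD eO eC] w1; have x0 : 0 <= modC w ^+ 2 by exact: sqr_ge0.
have x1 : modC w ^+ 2 < 1 by rewrite exprn_ilt1// normc_ge0.
have rfin := wnorm2_eval2_lty w1.
have pr : psd (eval2_coef w) by exact: (wnorm2_psd al1).
have rD : dirichlet al (psum (eval2_coef w)) by exact: (psd_dirichlet pr).
have := wnorm2_le_basis eD eO eC rD; rewrite (coefE pr)// wnorm2_eval2.
have E k : (modC (dirichlet_dot al (psum (eval2_coef w)) (e k)) ^+ 2)%:E =
    (modC (psum (psder (psder (coef (e k)))) w) ^+ 2)%:E by rewrite (dot_eval2 w1 (eD k)) normc_conj.
rewrite (eq_eseriesr (fun k _ => E k)).
move=> /(le_trans (kernel_lower al0 al1 x0 x1)) h.
have h2 := lee_wpmul2l (_ : (0 <= (2^-1)%:E :> \bar R)%E) h.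
rewrite muleA -!EFinM mulVf// mul1e in h2.
apply: le_trans (h2 _); last by rewrite lee_fin.
by rewrite lee_fin; lra.
Qed.

Definition std_coef n m : C := if m == n then ((Num.sqrt (weight n))^-1)%:C%C else 0.

Definition std_basis n : C -> C := psum (std_coef n).

Let sw0 n : 0 < Num.sqrt (weight n). Proof. by rewrite sqrtr_gt0 weight_gt0. Qed.

Lemma std_psd n : psd (std_coef n).
Proof.
apply: (@psd_bounded R _ ((Num.sqrt (weight n))^-1)) => m; rewrite /std_coef.
have h := sw0 n.
by case: ifP => _; rewrite ?Normc.normc0 ?normc_real ?ger0_norm ?invr_ge0 ?(ltW h).
Qed.

Lemma std_coefE n : coef (std_basis n) = std_coef n.
Proof. by apply: coefE => //; exact: std_psd. Qed.

Lemma std_dirichlet n : dirichlet al (std_basis n).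
Proof.
apply: (psd_dirichlet (std_psd n)) => //.
apply: (@le_lt_trans _ _ 1%:E); last by rewrite ltry.
apply: (wnorm2_le al1) => M.
case: (ltnP n M) => nM.
  rewrite (bigD1 (Ordinal nM))//= big1 ?addr0.
    rewrite /std_coef eqxx normc_real ger0_norm ?invr_ge0 ?(ltW (sw0 n))// exprVn sqr_sqrtr ?(ltW (weight_gt0 al1 n))//.
    by rewrite mulfV// gt_eqF// weight_gt0.
  move=> i hi; rewrite /std_coef ifN; first by rewrite Normc.normc0 expr0n mulr0.
  by apply: contra hi => /eqP hi; apply/eqP/val_inj.
rewrite big1// => i _; rewrite /std_coef ifN ?Normc.normc0 ?expr0n ?mulr0//.
by apply/negP => /eqP hi; have := ltn_ord i; rewrite hi ltnNge nM.
Qed.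

Lemma dot_std f n : dirichlet al f ->
  dirichlet_dot al f (std_basis n) = (Num.sqrt (weight n))%:C%C * coef f n.
Proof.
move=> fD; have h := dot_cvg fD (std_dirichlet n).
apply: (cvgC_unique h); rewrite std_coefE.
apply: (@cvg_trans _ ((fun=> 0 : R) @ \oo)); last exact: cvg_cst.
apply: near_eq_cvg; exists n.+1 => // M /= nM.
rewrite (sum_single (F := fun i => (weight i)%:C%C * coef f i * (std_coef n i)^*%C) (n := n))//.
  rewrite /std_coef eqxx [X in modC X](_ : _ = 0) ?Normc.normc0// conjc_real.
  rewrite mulrAC -rmorphM/= -{1}[weight n]sqr_sqrtr ?ltW ?weight_gt0// expr2 mulfK ?gt_eqF//.
  exact: subrr.
by move=> i /negbTE; rewrite /std_coef => ->; rewrite conjc0 mulr0.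
Qed.

Lemma std_basis_onb : orthonormal_basis al std_basis.
Proof.
split; first exact: std_dirichlet.
  move=> m n; rewrite dot_std ?std_coefE /std_coef; last exact: std_dirichlet.
  rewrite eq_sym; case: eqP => [->|_]; last by rewrite mulr0.
  by rewrite -rmorphM/= mulfV ?gt_eqF// rmorph1.
move=> f fD; have [pf fE ffin] := dirichletP fD.
have E n : coef (fun z => f z - \sum_(k < n) dirichlet_dot al f (std_basis k) * std_basis k z) =
    fun m => if (m < n)%N then 0 else coef f m.
  pose c k := dirichlet_dot al f (std_basis k).
  have gE : (fun m => if (m < n)%N then 0 else coef f m) = fun m => -1 * (\sum_(k < n) c k * std_coef k m) + coef f m.
    apply/funext => m; rewrite mulN1r; case: ltnP => mn.
      rewrite (sum_single (F := fun k => c k * std_coef k m) (n := m))//.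
        rewrite /c dot_std// /std_coef eqxx mulrAC -rmorphM/= mulfV ?gt_eqF// rmorph1 mul1r addNr//.
      by move=> k; rewrite /std_coef eq_sym => /negbTE ->; rewrite mulr0.
    rewrite big1 ?oppr0 ?add0r// => k _; rewrite /std_coef ifN ?mulr0//.
    by apply/negP => /eqP km; have := ltn_ord k; rewrite -km ltnNge mn.
  rewrite gE; apply: coefE => [|z z1]; first by apply: psd_lin => //; apply: psd_sum; exact: std_psd.
  rewrite psum_lin//; last by apply: psd_sum; exact: std_psd.
  by rewrite psum_sum// -?fE// ?mulN1r 1?addrC//; exact: std_psd.
have t0 i : (0 <= (weight i * modC (coef f i) ^+ 2)%:E)%E by rewrite lee_fin wterm_ge0.
(* Subtracting the first n terms removes exactly the first n coefficients, so the error is the tail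
   of a convergent series. *)
rewrite (_ : (fun n => _) = fun n => (\sum_(n <= i <oo) (weight i * modC (coef f i) ^+ 2)%:E)%E).
  apply: nneseries_tail_cvg => //; exact: ffin.
apply/funext => n; rewrite dirichlet_norm2E E /wnorm2 (nneseries_split 0 n)//; last first.
  by move=> k _; rewrite lee_fin mulr_ge0 ?exprn_ge0 ?normc_ge0// ltW// weight_gt0.
rewrite add0n big_nat_cond big1 ?add0e.
  by apply: congr_lim; apply/funext => k; apply: eq_big_nat => i /andP[ni _]; rewrite ltnNge ni.
by move=> i /andP[/andP[_ ->] _]; rewrite Normc.normc0 expr0n/= mulr0.
Qed.

End Orthonormal.

(** * Composition with a self-map of the disc *)

Lemma cauchy_schwarz_sum (R : realType) (x y : nat -> R) n :
  (forall i, 0 <= x i) -> (forall i, 0 <= y i) ->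
  (\sum_(i < n) x i * y i) ^+ 2 <= (\sum_(i < n) x i ^+ 2) * (\sum_(i < n) y i ^+ 2).
Proof.
move=> x0 y0; elim: n => [|n IH]; first by rewrite !big_ord0 expr0n/= mul0r.
rewrite !big_ord_recr/=.
have S0 : 0 <= \sum_(i < n) x i * y i by apply: sumr_ge0 => i _; exact: mulr_ge0.
have X0 : 0 <= \sum_(i < n) x i ^+ 2 by apply: sumr_ge0 => i _; exact: sqr_ge0.
have Y0 : 0 <= \sum_(i < n) y i ^+ 2 by apply: sumr_ge0 => i _; exact: sqr_ge0.
move: (\sum_(i < n) x i * y i) (\sum_(i < n) x i ^+ 2) (\sum_(i < n) y i ^+ 2) IH S0 X0 Y0 => S X Y IH S0 X0 Y0.
move: (x n) (y n) (x0 n) (y0 n) => u v u0 v0.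
suff h : 2 * S * (u * v) <= X * v ^+ 2 + Y * u ^+ 2 by move: h IH; rewrite !expr2; nra.
rewrite -(ler_pXn2r (ltn0Sn 1)) ?nnegrE ?mulr_ge0 ?addr_ge0 ?mulr_ge0 ?sqr_ge0//.
apply: (@le_trans _ _ (4 * (X * Y) * (u * v) ^+ 2)).
  rewrite !exprMn (_ : 2 ^+ 2 = 4); last by ring.
  by rewrite ler_wpM2r ?mulr_ge0 ?sqr_ge0// ler_wpM2l.
rewrite -subr_ge0 (_ : _ - _ = (X * v ^+ 2 - Y * u ^+ 2) ^+ 2); last by ring.
exact: sqr_ge0.
Qed.

Section Composition.
Variable R : realType.
Local Notation C := R[i].
Implicit Types (a A B : nat -> C) (z w : C).

(** The chain rule, obtained from two Taylor estimates; as [B] is a power series, its derivative is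
    already known to be [psum (psder B)]. *)
Lemma psum_comp_derive A a B z : psd A -> psd a -> psd B ->
  (forall z, modC z < 1 -> modC (psum a z) < 1) ->
  (forall z, modC z < 1 -> psum B z = psum A (psum a z)) -> modC z < 1 ->
  psum (psder B) z = psum (psder A) (psum a z) * psum (psder a) z.
Proof.
have aux (x y d d' u q : C) : x - y - d * d' * q = (x - y - d * u) + d * (u - d' * q) by ring.
move=> pA pa pB a1 BE z1; have [_ <-] := psum_derive pB (fun _ _ => erefl) z1.
have z01 : 0 <= modC z < 1 by rewrite normc_ge0.
have [zs s0 s1] := mid_lt1 z01; set s := (modC z + 1) / 2 in zs s0 s1.
have w1 := a1 _ z1; set w := psum a z in w1 *.
have w01 : 0 <= modC w < 1 by rewrite normc_ge0.
have [wt t0 t1] := mid_lt1 w01; set t := (modC w + 1) / 2 in wt t0 t1.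
have s01 : 0 < s < 1 by rewrite s0.
have t01 : 0 < t < 1 by rewrite t0.
have [K K0 HK] := psum_taylor pa s01; have [L L0 HL] := psum_taylor pA t01.
set da := psum (psder a) z; set dA := psum (psder A) w.
pose N := modC da + K.
have N0 : 0 <= N by rewrite addr_ge0// normc_ge0.
(* [Q] bounds the quadratic error: the outer Taylor error with |v - w| <= N |h|, plus the inner
   error multiplied by the outer derivative. *)
pose Q := L * N ^+ 2 + modC dA * K.
have Q0 : 0 <= Q by rewrite addr_ge0 ?mulr_ge0 ?sqr_ge0// normc_ge0.
suff [_ //] : derivable (psum B : Cplx R -> Cplx R) z 1 /\ derive1 (psum B : Cplx R -> Cplx R) z = dA * da.
apply: derive1C => eps eps0.
(* The entries keep z + h in the disc of radius [s], keep its image in the disc of radius [t], and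
   make Q |h| smaller than eps. *)
pose del := Num.min (Num.min 1 (s - modC z)) (Num.min ((t - modC w) / (N + 1)) (eps / (Q + 1))).
have del0 : 0 < del.
  by rewrite !lt_min ltr01 subr_gt0 zs !divr_gt0 ?subr_gt0// ltr_pwDr.
exists del => // h; rewrite !lt_min => /andP[/andP[h1 h2] /andP[h3 h4]].
have h0 := normc_ge0 h.
have zhs : modC (h + z) <= s by have := normcD h z; lra.
have zh1 : modC (h + z) < 1 by apply: le_lt_trans zhs _.
have hh : modC (h + z - z) <= modC h by rewrite addrK.
have := HK (h + z) z z (modC h) zhs (ltW zs) (ltW zs) hh.
rewrite subrr Normc.normc0 addrK -/da -/w => /(_ h0).
set v := psum a (h + z); move=> E1.
have dv : modC (v - w) <= N * modC h.
  have -> : v - w = (v - w - da * h) + da * h by rewrite subrK.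
  apply: (le_trans (normcD _ _)); rewrite normcM; move: E1; rewrite /N.
  have : K * modC h * modC h <= K * modC h by rewrite ler_piMr ?mulr_ge0// ltW.
  nra.
have vt : modC v <= t.
  have -> : v = (v - w) + w by rewrite subrK.
  apply: (le_trans (normcD _ _)).
  rewrite -lerBrDr; apply: (le_trans dv); apply: (@le_trans _ _ ((N + 1) * modC h)).
    by apply: ler_wpM2r => //; rewrite lerDl.
  by rewrite mulrC -ler_pdivlMr ?(ltW h3)// ltr_pwDr.
have v0 := normc_ge0 (v - w).
have E2 : modC (psum A v - psum A w - dA * (v - w)) <= L * modC (v - w) * modC (v - w).
  by apply: (HL v w w (modC (v - w)) vt (ltW wt) (ltW wt) (lexx _)); rewrite subrr Normc.normc0.
rewrite !BE// -/v -/w.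
rewrite (aux _ _ _ _ (v - w)).
apply: (le_trans (normcD _ _)); rewrite normcM.
have E3 : L * modC (v - w) * modC (v - w) <= L * N ^+ 2 * modC h * modC h.
  have -> : L * N ^+ 2 * modC h * modC h = L * ((N * modC h) ^+ 2) by ring.
  by rewrite -mulrA -expr2; apply: ler_wpM2l => //; rewrite ler_pXn2r ?nnegrE ?mulr_ge0.
have E4 : modC dA * modC (v - w - da * h) <= modC dA * (K * modC h * modC h).
  by apply: ler_wpM2l => //; exact: normc_ge0.
have E5 : (Q + 1) * modC h < eps by rewrite mulrC -ltr_pdivlMr// ltr_pwDr.
apply: (le_trans (lerD (le_trans E2 E3) E4)).
rewrite [leLHS](_ : _ = Q * modC h * modC h); last by rewrite /Q !mulrDl !mulrA.
apply: ler_wpM2r => //; apply: ltW; apply: le_lt_trans E5; apply: ler_wpM2r => //.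
by rewrite lerDl.
Qed.

Fixpoint pspow a k : nat -> C :=
  if k is k'.+1 then psconv a (pspow a k') else fun n => (n == 0%N)%:R.

Lemma psd_pow a k : psd a -> psd (pspow a k).
Proof.
move=> pa; elim: k => [|k IH]; last exact: psd_conv.
by apply: (@psd_bounded R _ 1) => n /=; rewrite normc_nat; case: (n == 0)%N.
Qed.

Lemma psum_single (c : C) n z : modC z < 1 ->
  psum (fun m => if m == n then c else 0) z = c * z ^+ n.
Proof.
move=> z1; apply: psum_unique => //.
  apply: (@psd_bounded R _ (modC c)) => m; case: ifP => // _.
  by rewrite Normc.normc0 normc_ge0.
apply: (@cvg_trans _ ((fun=> 0 : R) @ \oo)); last exact: cvg_cst.
apply: near_eq_cvg; exists n.+1 => // M /= nM.
rewrite (sum_single (F := fun i => (if i == n then c else 0) * z ^+ i) (n := n))//.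
  by rewrite eqxx subrr Normc.normc0.
by move=> i /negbTE ->; rewrite mul0r.
Qed.

Lemma psum_pow a k z : psd a -> modC z < 1 -> psum (pspow a k) z = psum a z ^+ k.
Proof.
move=> pa z1; elim: k => [|k IH]; last by rewrite /= psum_conv// ?IH ?exprS//; exact: psd_pow.
rewrite expr0 -[RHS]mulr1 -[X in _ * X](expr0 z) -psum_single//; congr (psum _ z).
by apply/funext => n /=; case: eqP.
Qed.

End Composition.

Lemma sum_recl2 (R : realType) (F : nat -> R) M : F 0%N = 0 -> F 1%N = 0 ->
  \sum_(k < M.+2) F k = \sum_(k < M) F k.+2.
Proof. by move=> F0 F1; rewrite !big_ord_recl/= F0 F1 !add0r. Qed.

(** * Bounds for derivatives at a point *)

Section PointEvaluation.
Variables (R : realType) (al : R).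
Local Notation C := R[i].
Hypothesis al0 : 0 < al.
Hypothesis al1 : al < 1.
Implicit Types (a A B : nat -> C) (z w : C).
Local Notation weight := (weight al).
Local Notation wnorm2 := (wnorm2 al).

(** Cauchy-Schwarz after splitting each term by the square root of its weight. Here [j] is the order
    of differentiation and [c] its numerical factor, so that first and second derivatives are
    covered together. *)
Lemma psum_bound_wnorm2 A (c : nat -> R) j w (K : R) : (forall m, 0 <= c m) -> 0 <= K ->
  psd (fun m => (c m)%:C%C * A (m + j)%N) -> modC w < 1 ->
  (forall M, \sum_(m < M) c m ^+ 2 / weight (m + j) * (modC w ^+ 2) ^+ m <= K) ->
  (wnorm2 A < +oo)%E ->
  ((modC (psum (fun m => (c m)%:C%C * A (m + j)%N) w) ^+ 2)%:E <= K%:E * wnorm2 A)%E.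
Proof.
move=> c0 K0 pc w1 HK Afin; have fA := wnorm2_fin_num al1 Afin.
set S := fine (wnorm2 A); have S0 : 0 <= S by rewrite fine_ge0// (wnorm2_ge0 al1).
rewrite -(fineK fA) -EFinM lee_fin -/S.
suff h : modC (psum (fun m => (c m)%:C%C * A (m + j)%N) w) <= Num.sqrt (K * S).
  by rewrite -(@sqr_sqrtr _ (K * S)) ?mulr_ge0// ler_pXn2r ?nnegrE ?sqrtr_ge0 ?normc_ge0.
apply: psum_le => // M; apply: (le_trans (normc_sum _ _ _)).
pose x m := Num.sqrt (weight (m + j)) * modC (A (m + j)%N).
pose y m := c m / Num.sqrt (weight (m + j)) * modC w ^+ m.
have sw m : 0 < Num.sqrt (weight m) by rewrite sqrtr_gt0 weight_gt0.
have x0 m : 0 <= x m by rewrite mulr_ge0 ?normc_ge0 ?ltW.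
have y0 m : 0 <= y m by rewrite mulr_ge0 ?exprn_ge0 ?normc_ge0// divr_ge0// ltW.
rewrite (eq_bigr (fun m : 'I_M => x m * y m)); last first.
  move=> m _; rewrite !normcM normc_real normcX ger0_norm// /x /y.
  by move: (sw (m + j)%N); move: (Num.sqrt (weight (m + j))) => sq h; field; rewrite gt_eqF.
rewrite -(ler_pXn2r (ltn0Sn 1)) ?nnegrE ?sqrtr_ge0 ?sumr_ge0//; last by move=> i _; exact: mulr_ge0.
rewrite sqr_sqrtr ?mulr_ge0//; apply: (le_trans (cauchy_schwarz_sum M x0 y0)).
rewrite mulrC; apply: ler_pM; rewrite ?sumr_ge0//; try by move=> i _; exact: sqr_ge0.
  apply: le_trans (HK M); apply: ler_sum => m _.
  rewrite /y !exprMn exprVn sqr_sqrtr ?(ltW (weight_gt0 al1 _))// -!exprM mulnC//.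
have E : \sum_(i < M) x i ^+ 2 <= \sum_(i < j + M) weight i * modC (A i) ^+ 2.
  rewrite big_split_ord/= addrC; apply: (@le_trans _ _ (\sum_(i < M) weight (j + i) * modC (A (j + i)%N) ^+ 2)).
    apply: ler_sum => m _; rewrite /x exprMn sqr_sqrtr ?(ltW (weight_gt0 al1 _))//.
    by rewrite (addnC m).
  by rewrite lerDl sumr_ge0// => i _; exact: wterm_ge0.
apply: (le_trans E); rewrite -lee_fin (fineK fA); exact: (wnorm2_ge_partial al1).
Qed.

(** The bound [K] may depend on [w] in any way, since it is only applied at the image of the origin;
    replacing the weights by 1 is enough. *)
Lemma psder_bound w : modC w < 1 -> exists2 K, 0 <= K &
  forall M, \sum_(m < M) m.+1%:R ^+ 2 / weight (m + 1) * (modC w ^+ 2) ^+ m <= K.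
Proof.
move=> w1; have x0 : 0 <= modC w ^+ 2 by exact: sqr_ge0.
have x1 : modC w ^+ 2 < 1 by rewrite exprn_ilt1// normc_ge0.
have p1 : psd (fun=> 1 : C) by apply: (@psd_bounded R _ 1) => n; rewrite Normc.normc1.
have x01 : 0 <= modC w ^+ 2 < 1 by rewrite x0.
have [K K0 HK] := psd_summable (psd_natM (psd_natM p1)) x01.
exists K => // M; apply: le_trans (HK M); apply: ler_sum => m _.
apply: ler_wpM2r; first exact: exprn_ge0.
rewrite !normcM !normc_nat Normc.normc1 mulr1 -expr2 ler_pdivrMr ?weight_gt0//.
by rewrite ler_peMr ?sqr_ge0// weight_ge1.
Qed.

Lemma psum_der_bound w : modC w < 1 -> exists2 K, 0 <= K & forall A, (wnorm2 A < +oo)%E ->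
  ((modC (psum (psder A) w) ^+ 2)%:E <= K%:E * wnorm2 A)%E.
Proof.
move=> w1; have [K K0 HK] := psder_bound w1; exists K => // A Af.
have E : psder A = fun m => (m.+1%:R)%:C%C * A (m + 1)%N.
  by apply/funext => m; rewrite /psder addn1 rmorph_nat.
rewrite E; apply: psum_bound_wnorm2 => //.
by rewrite -E; apply: psd_der; exact: (wnorm2_psd al1).
Qed.

Definition dker w : R := ((1 - modC w ^+ 2) `^ (al + 4))^-1.

Lemma dker_ge0 w : 0 <= dker w.
Proof. by rewrite invr_ge0 powR_ge0. Qed.

Lemma psum_der2_bound w A : modC w < 1 -> (wnorm2 A < +oo)%E ->
  ((modC (psum (psder (psder A)) w) ^+ 2)%:E <= (30 * dker w)%:E * wnorm2 A)%E.
Proof.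
move=> w1 Af; have x0 : 0 <= modC w ^+ 2 by exact: sqr_ge0.
have x1 : modC w ^+ 2 < 1 by rewrite exprn_ilt1// normc_ge0.
have E : psder (psder A) = fun m => (m.+2%:R * m.+1%:R)%:C%C * A (m + 2)%N.
  by apply/funext => m; rewrite /psder addn2 rmorphM/= !rmorph_nat mulrA [_%:R * _%:R]mulrC.
rewrite E; apply: psum_bound_wnorm2 => //.
- by rewrite mulr_ge0 ?dker_ge0.
- by rewrite -E; apply: psd_der; apply: psd_der; exact: (wnorm2_psd al1).
move=> M; apply: le_trans (kernel_upper al0 al1 x0 x1 M); apply: ler_sum => m _.
by rewrite addn2.
Qed.

Lemma psder_std k : psder (std_coef al k.+1) =
  fun m => if m == k then k.+1%:R * ((Num.sqrt (weight k.+1))^-1)%:C%C else 0.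
Proof.
apply/funext => m; rewrite /psder /std_coef eqSS.
by case: eqP => [->|]//; rewrite mulr0.
Qed.

Lemma psder_std0 : psder (std_coef al 0) = fun=> 0.
Proof. by apply/funext => m; rewrite /psder /std_coef mulr0. Qed.

Lemma psder2_std k : psder (psder (std_coef al k.+2)) =
  fun m => if m == k then k.+1%:R * (k.+2%:R * ((Num.sqrt (weight k.+2))^-1)%:C%C) else 0.
Proof.
rewrite psder_std; apply/funext => m; rewrite /psder eqSS.
by case: eqP => [->|]//; rewrite mulr0.
Qed.

Lemma sqr_normc_std n : modC (((Num.sqrt (weight n))^-1)%:C%C : C) ^+ 2 = (weight n)^-1.
Proof. by rewrite normc_real real_normK ?num_real// exprVn sqr_sqrtr// ltW// weight_gt0. Qed.

Lemma std_der_sum w : modC w < 1 -> exists2 K, 0 <= K &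
  forall M, \sum_(k < M) modC (psum (psder (std_coef al k)) w) ^+ 2 <= K.
Proof.
move=> w1; have [K K0 HK] := psder_bound w1; exists K => // M.
case: M => [|M]; first by rewrite big_ord0.
rewrite big_ord_recl/= psder_std0 psum0 Normc.normc0 expr0n add0r.
apply: le_trans (HK M); apply: ler_sum => m _.
have -> : (modC w ^+ 2) ^+ m = modC (w ^+ m) ^+ 2 by rewrite normcX -!exprM mulnC.
rewrite /bump/= add1n psder_std psum_single// !normcM normc_nat addn1 -(sqr_normc_std m.+1).
by rewrite -!exprMn.
Qed.

Lemma std_der2_sum w M : modC w < 1 ->
  \sum_(k < M) modC (psum (psder (psder (std_coef al k))) w) ^+ 2 <= 30 * dker w.
Proof.
move=> w1; have x0 : 0 <= modC w ^+ 2 by exact: sqr_ge0.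
have x1 : modC w ^+ 2 < 1 by rewrite exprn_ilt1// normc_ge0.
have Z0 k : (k < 2)%N -> modC (psum (psder (psder (std_coef al k))) w) ^+ 2 = 0.
  move=> k2; have -> : psder (psder (std_coef al k)) = fun=> 0.
    apply/funext => m; rewrite /psder /std_coef; case: eqP k2 => [<-//|]; rewrite !mulr0//.
  by rewrite psum0 Normc.normc0 expr0n.
have k0 : 0 <= 30 * dker w by rewrite mulr_ge0 ?dker_ge0.
case: M => [|[|M]]; first by rewrite big_ord0.
  by rewrite big_ord1 Z0.
rewrite (sum_recl2 (F := fun k => modC (psum (psder (psder (std_coef al k))) w) ^+ 2)) ?Z0//.
apply: le_trans (kernel_upper al0 al1 x0 x1 M); apply: ler_sum => m _.
have -> : (modC w ^+ 2) ^+ m = modC (w ^+ m) ^+ 2 by rewrite normcX -!exprM mulnC.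
rewrite psder2_std psum_single// !normcM !normc_nat /kernel_coef -(sqr_normc_std m.+2).
by rewrite -!exprMn mulrA [m.+1%:R * _]mulrC.
Qed.

End PointEvaluation.

Lemma cvg_sum_sqr (R : realType) (c : nat -> R) (v : nat -> nat -> R) (l : nat -> R) M :
  (forall i, v i @ \oo --> l i) ->
  (fun K => \sum_(i < M) c i * v i K ^+ 2) @ \oo --> \sum_(i < M) c i * l i ^+ 2.
Proof.
move=> h; elim: M => [|M IH].
  by rewrite big_ord0; under eq_fun do rewrite big_ord0; exact: cvg_cst.
rewrite big_ord_recr/=; under eq_fun do rewrite big_ord_recr/=.
apply: cvgD => //; apply: cvgM; first exact: cvg_cst.
by rewrite expr2; under eq_fun do rewrite expr2; exact: cvgM.
Qed.

Lemma sum_diff (V : pzRingType) (F G : nat -> V) L N : (L <= N)%N ->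
  (forall k, (k < L)%N -> G k = 0) -> (forall k, (L <= k)%N -> (k < N)%N -> G k = F k) ->
  -1 * (\sum_(k < L) F k) + \sum_(k < N) F k = \sum_(k < N) G k.
Proof.
move=> LN G0 GF; rewrite mulN1r -!(big_mkord xpredT F) -(big_mkord xpredT G).
rewrite (big_cat_nat (leq0n L) LN)/= addrA addNr add0r [RHS](big_cat_nat (leq0n L) LN)/=.
rewrite [X in _ = X + _]big_nat_cond [X in _ = X + _]big1 ?add0r; last by move=> k /andP[/andP[_ kL] _]; exact: G0.
by apply: eq_big_nat => k /andP[Lk kN]; rewrite GF.
Qed.

(** * The energy integral and the existence of the composed series *)

Section CompositionEnergy.
Variables (R : realType) (al : R).
Local Notation C := R[i].
Hypothesis al0 : 0 < al.
Hypothesis al1 : al < 1.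
Local Notation T := (measurableTypeR R * measurableTypeR R)%type.
Local Notation area := (@area R).
Local Notation D := (@unit_disc R).
Local Notation c0 := (@area_ball1 R).
Local Notation weight := (weight al).
Local Notation wnorm2 := (wnorm2 al).
Variable a : nat -> C.
Hypothesis pa : psd a.
Hypothesis a1 : forall z, modC z < 1 -> modC (psum a z) < 1.
Implicit Types (A B : nat -> C) (z w : C).

Let mD := @measurable_unit_disc R.

Definition energy_density (p : T) : R :=
  modC (psum (psder a) (toC p)) ^+ 2 * (1 - nrm2 p) `^ al.

Lemma energy_density_ge0 p : 0 <= energy_density p.
Proof. by rewrite mulr_ge0 ?powR_ge0 ?sqr_ge0. Qed.

Lemma toC_lt1 p : D p -> modC (toC p : C) < 1.
Proof. by []. Qed.

Lemma measurable_energy_density : measurable_fun D energy_density.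
Proof.
apply: measurable_funM; last first.
  apply: (measurableT_comp (@measurable_u R al)); apply: measurable_funTS; exact: measurable_nrm2.
apply: measurable_modC2; apply: mcfun_psum; [exact: psd_der|exact: mcfun_toC|exact: toC_lt1].
Qed.

Lemma measurable_dker_comp : measurable_fun D (fun p : T => dker al (psum a (toC p))).
Proof.
rewrite (_ : (fun _ => _) = (fun p : T => (1 - modC (psum a (toC p)) ^+ 2) `^ (- (al + 4)))); last first.
  by apply/funext => p; rewrite powRN.
apply: (measurableT_comp (measurable_powR _)); apply: measurable_funB; first exact: measurable_cst.
apply: measurable_modC2; apply: mcfun_psum; [exact: pa|exact: mcfun_toC|exact: toC_lt1].
Qed.

(** The quantity J, written with the power series of the self-map. *)
Definition comp_energy : \bar R :=
  (\int[area]_(p in D) (dker al (psum a (toC p)) * energy_density p)%:E)%E.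

Lemma comp_energy_ge0 : (0 <= comp_energy)%E.
Proof.
by apply: integral_ge0 => p _; rewrite lee_fin mulr_ge0 ?dker_ge0 ?energy_density_ge0.
Qed.

Lemma measurable_comp_energy :
  measurable_fun D (fun p : T => (dker al (psum a (toC p)) * energy_density p)%:E).
Proof.
apply/measurable_EFinP; apply: measurable_funM; first exact: measurable_dker_comp.
exact: measurable_energy_density.
Qed.

Lemma dirichlet_integral_comp A B : psd A -> psd B ->
  (forall z, modC z < 1 -> psum B z = psum (psder A) (psum a z)) ->
  (dirichlet_integral al B =
   \int[area]_(p in D) (modC (psum (psder (psder A)) (psum a (toC p))) ^+ 2 * energy_density p)%:E)%E.
Proof.
move=> hA hB BE; apply: eq_integral => p; rewrite inE => Dp; congr (_%:E).
rewrite (psum_comp_derive (psd_der hA) pa hB a1 BE (toC_lt1 Dp)).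
by rewrite normcM exprMn -[LHS]mulrA.
Qed.

Lemma psum_at0 B : psum B 0 = B 0%N.
Proof.
apply: (@cvg_lim (Cplx R)); first exact: norm_hausdorff.
apply: (@cvg_trans _ ((fun=> B 0%N : Cplx R) @ \oo)); last exact: cvg_cst.
apply: near_eq_cvg; exists 1%N => // -[//|M] _.
rewrite /series/= big_nat_recl//= expr0 mulr1 big1 ?addr0// => i _.
by rewrite expr0n mulr0.
Qed.

Lemma dirichlet_integral_comp_le A B : psd A -> psd B -> (wnorm2 A < +oo)%E ->
  (forall z, modC z < 1 -> psum B z = psum (psder A) (psum a z)) ->
  (dirichlet_integral al B <= 30%:E * comp_energy * wnorm2 A)%E.
Proof.
move=> hA hB Af BE; rewrite (dirichlet_integral_comp hA hB BE).
have fA := wnorm2_fin_num al1 Af; set S := fine (wnorm2 A).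
have S0 : 0 <= S by rewrite fine_ge0// (wnorm2_ge0 al1).
have -> : (30%:E * comp_energy * wnorm2 A = (30 * S)%:E * comp_energy)%E.
  by rewrite -(fineK fA) -/S muleAC -EFinM.
rewrite /comp_energy -ge0_integralZl_EFin//; last 3 first.
- by move=> p _; rewrite lee_fin mulr_ge0 ?dker_ge0 ?energy_density_ge0.
- exact: measurable_comp_energy.
- by rewrite mulr_ge0.
apply: ge0_le_integral => //.
- by move=> p _; rewrite lee_fin mulr_ge0 ?sqr_ge0 ?energy_density_ge0.
- apply/measurable_EFinP; apply: measurable_funM; last exact: measurable_energy_density.
  apply: measurable_modC2; apply: mcfun_psum; first by do 2 apply: psd_der.
    by apply: mcfun_psum; [exact: pa|exact: mcfun_toC|exact: toC_lt1].
  by move=> p Dp; apply: a1; exact: toC_lt1.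
- apply: measurable_funeM; exact: measurable_comp_energy.
move=> p Dp; rewrite -EFinM lee_fin [leRHS]mulrA; apply: ler_wpM2r; first exact: energy_density_ge0.
have := psum_der2_bound al0 al1 (a1 (toC_lt1 Dp)) Af.
by rewrite -(fineK fA) -EFinM lee_fin -/S mulrAC.
Qed.

Lemma wnorm2_comp_le A B K : psd A -> psd B -> (wnorm2 A < +oo)%E ->
  (forall z, modC z < 1 -> psum B z = psum (psder A) (psum a z)) ->
  ((modC (psum (psder A) (psum a 0)) ^+ 2)%:E <= K%:E * wnorm2 A)%E -> 0 <= K ->
  (wnorm2 B <= (K%:E + (25 / 2 / c0 * 30)%:E * comp_energy) * wnorm2 A)%E.
Proof.
move=> hA hB Af BE HK K0; apply: (le_trans (wnorm2_dirichlet_integral al0 al1 hB)).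
have c00 := area_ball1_pos R.
have W0 : (0 <= wnorm2 A)%E by exact: (wnorm2_ge0 al1).
rewrite ge0_muleDl; last 2 first.
- by rewrite lee_fin.
- by rewrite mule_ge0 ?comp_energy_ge0// lee_fin !mulr_ge0// invr_ge0 ltW.
apply: leeD; first by rewrite -psum_at0 BE// Normc.normc0.
rewrite (EFinM (25 / 2 / c0)) -!muleA; apply: lee_wpmul2l.
  by rewrite lee_fin !mulr_ge0// invr_ge0 ltW.
by rewrite muleA; exact: dirichlet_integral_comp_le.
Qed.

Lemma psum_finite B N z : (forall n, (N <= n)%N -> B n = 0) -> modC z < 1 ->
  psum B z = \sum_(i < N) B i * z ^+ i.
Proof.
move=> BN z1; apply: (@cvg_lim (Cplx R)); first exact: norm_hausdorff.
apply: (@cvg_trans _ ((fun=> (\sum_(i < N) B i * z ^+ i) : Cplx R) @ \oo)); last exact: cvg_cst.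
apply: near_eq_cvg; exists N => // M /= NM.
rewrite /series/= (big_cat_nat (leq0n N) NM)/= big_mkord [X in _ + X]big_nat_cond [X in _ + X]big1 ?addr0//.
by move=> i /andP[/andP[Ni _] _]; rewrite BN// mul0r.
Qed.

Lemma wnorm2_tail_le A B L : (forall n, (n < L)%N -> B n = 0) ->
  (forall n, modC (B n) <= modC (A n)) ->
  (wnorm2 B <= \sum_(L <= n <oo) (weight n * modC (A n) ^+ 2)%:E)%E.
Proof.
move=> B0 BA; rewrite /wnorm2 (nneseries_split 0 L); last first.
  by move=> k _; rewrite lee_fin wterm_ge0.
rewrite add0n big_nat_cond big1 ?add0e; last first.
  by move=> i /andP[/andP[_ iL] _]; rewrite B0// Normc.normc0 expr0n/= mulr0.
apply: lee_nneseries => [n _ _|n _]; first by rewrite lee_fin wterm_ge0.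
rewrite lee_fin; apply: ler_wpM2l; first exact: (ltW (weight_gt0 al1 n)).
by rewrite ler_pXn2r ?nnegrE ?normc_ge0.
Qed.

(** The coefficients of the composition are obtained as limits in the norm, so no double series has
    to be rearranged. *)
Lemma comp_series A : (wnorm2 A < +oo)%E -> (comp_energy < +oo)%E ->
  exists B, [/\ psd B, forall z, modC z < 1 -> psum B z = psum (psder A) (psum a z) &
    (wnorm2 B < +oo)%E].
Proof.
move=> Af Jf; have hA := wnorm2_psd al1 Af; have hdA := psd_der hA.
have fJ : comp_energy \is a fin_num by rewrite ge0_fin_numE// comp_energy_ge0.
have w01 : modC (psum a 0) < 1 by apply: a1; rewrite Normc.normc0.
have [K K0 HK] := psum_der_bound al1 w01.
have c00 := area_ball1_pos R.
pose M := K + (25 / 2 / c0 * 30) * fine comp_energy.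
have M0 : 0 <= M.
  by rewrite addr_ge0// mulr_ge0 ?fine_ge0 ?comp_energy_ge0// !mulr_ge0// invr_ge0 ltW.
(* For a polynomial outer function, composition is a finite combination of powers of the inner
   series. *)
pose b N n := \sum_(k < N) psder A k * pspow a k n.
have pb N : psd (b N) by apply: (psd_sum (psder A)) => k; exact: psd_pow.
have bE N z : modC z < 1 -> psum (b N) z = \sum_(k < N) psder A k * psum a z ^+ k.
  move=> z1; rewrite (psum_sum (psder A) N (fun k => psd_pow k pa) z1).
  by apply: eq_bigr => k _; rewrite psum_pow.
pose t N := (\sum_(N <= n <oo) (weight n * modC (A n) ^+ 2)%:E)%E.
have bdiff L N : (L <= N)%N -> (wnorm2 (fun n => (b N n - b L n)%R) <= M%:E * t L)%E.
  (* The difference of two approximants is the image of a block of [A]. The range is [L < n <= N]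
     because [psder] lowers the index by one. *)
  move=> LN; pose d n := if (L < n <= N)%N then A n else 0.
  have dle n : modC (d n) <= modC (A n).
    by rewrite /d; case: ifP => // _; rewrite Normc.normc0 normc_ge0.
  have dt : (wnorm2 d <= t L)%E.
    apply: wnorm2_tail_le => // n nL; rewrite /d ifN// negb_and -leqNgt ltnW//.
  have tf : (t L <= wnorm2 A)%E.
    rewrite /wnorm2 (nneseries_split 0 L); last by move=> k _; rewrite lee_fin wterm_ge0.
    rewrite leeDr// sume_ge0// => i _; by rewrite lee_fin wterm_ge0.
  have df : (wnorm2 d < +oo)%E by apply: le_lt_trans dt (le_lt_trans tf Af).
  have pd := wnorm2_psd al1 df.
  have BE z : modC z < 1 -> psum (fun n => b N n - b L n) z = psum (psder d) (psum a z).
    move=> z1; have -> : (fun n => b N n - b L n) = (fun n => -1 * b L n + b N n).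
      by apply/funext => n; rewrite mulN1r addrC.
    rewrite (psum_lin (-1) (pb L) (pb N) z1) (bE L _ z1) (bE N _ z1) (@psum_finite (psder d) N); last 2 first.
    - by move=> n Nn; rewrite /psder /d [(n < N)%N]ltnNge Nn andbF mulr0.
    - exact: a1.
    apply: (sum_diff (F := fun k => psder A k * psum a z ^+ k) (G := fun k => psder d k * psum a z ^+ k) LN) => k.
      by move=> kL; rewrite /psder /d ltnS leqNgt kL/= mulr0 mul0r.
    by move=> Lk kN; rewrite /psder /d ltnS Lk kN.
  have pdiff : psd (fun n => b N n - b L n).
    rewrite (_ : (fun n => _) = (fun n => -1 * b L n + b N n)); first exact: psd_lin.
    by apply/funext => n; rewrite mulN1r addrC.
  apply: (le_trans (wnorm2_comp_le pd pdiff df BE (HK _ df) K0)).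
  rewrite -(fineK fJ) -EFinM -EFinD -/M; apply: lee_wpmul2l => //.
have t_cvg : t @ \oo --> 0%E by apply: nneseries_tail_cvg => // n *; rewrite lee_fin; exact: wterm_ge0.
have small eps : 0 < eps -> exists N, forall L, (N <= L)%N -> forall K, (L <= K)%N ->
    (wnorm2 (fun n => (b K n - b L n)%R) <= (eps ^+ 2)%:E)%E.
  move=> eps0; have e' : 0 < eps ^+ 2 / (M + 1) by rewrite divr_gt0 ?exprn_gt0 ?ltr_wpDl.
  move/fine_cvgP : t_cvg => [fin /cvgrPdist_le /(_ _ e') h].
  have [N _ HN] := filterI fin h; exists N => L NL k Lk.
  have [tf tle] := HN L NL; apply: (le_trans (bdiff L k Lk)).
  move: tle; rewrite /= sub0r normrN => /(le_trans (ler_norm _)) tle.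
  rewrite -(fineK tf) -EFinM lee_fin; apply: (@le_trans _ _ ((M + 1) * (eps ^+ 2 / (M + 1)))).
    apply: ler_pM => //; last by rewrite lerDl.
    apply: fine_ge0; apply: nneseries_ge0 => n _ _; rewrite lee_fin; exact: wterm_ge0.
  by rewrite mulrC divfK// gt_eqF// ltr_wpDl.
have cb n : exists l, (fun N => modC (b N n - l)) @ \oo --> (0 : R).
  apply: cauchyC => eps eps0; have [N HN] := small _ eps0; exists N => k Nk.
  exact: (wnorm2_bound al1 (ltW eps0) (HN N (leqnn N) k Nk) n).
have [B HB] := choice cb; exists B.
(* The norm is a supremum of finite partial sums, so the bound passes to the limit finitely many
   coordinates at a time. *)
have Bsmall eps : 0 < eps -> exists N, forall L, (N <= L)%N ->
    (wnorm2 (fun n => (B n - b L n)%R) <= (eps ^+ 2)%:E)%E.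
  move=> eps0; have [N HN] := small _ eps0; exists N => L NL.
  apply: (wnorm2_le al1) => m.
  have h : (fun k => \sum_(i < m) weight i * modC (b k i - b L i) ^+ 2) @ \oo -->
     \sum_(i < m) weight i * modC (B i - b L i) ^+ 2.
    apply: (@cvg_sum_sqr _ weight (fun i k => modC (b k i - b L i)) (fun i => modC (B i - b L i))) => i.
    apply: cvgC_normc; rewrite (_ : (fun _ => _) = (fun N => modC (b N i - B i)))//.
    by apply/funext => k; rewrite opprB addrA subrK.
  rewrite -(cvg_lim _ h)//; apply: limr_le; first by apply/cvg_ex; eexists; exact: h.
  exists L => // k /= Lk; rewrite -lee_fin; apply: le_trans (HN L NL k Lk).
  exact: (wnorm2_ge_partial al1 (fun n => b k n - b L n)).
have Bf : (wnorm2 B < +oo)%E.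
  have [N /(_ N (leqnn N)) HN] := Bsmall 1 ltr01.
  apply: (le_lt_trans (wnorm2_sub_le al1 B (b N))).
  have bf : (wnorm2 (b N) < +oo)%E.
    have := bdiff 0%N N (leq0n _); rewrite (_ : (fun n => _) = b N); last first.
      by apply/funext => n; rewrite /b big_ord0 subr0.
    move/le_lt_trans; apply; rewrite -(fineK (wnorm2_fin_num al1 Af : t 0%N \is a fin_num)) -EFinM.
    exact: ltry.
  apply: lte_add_pinfty; apply: lte_mul_pinfty => //.
  by apply: le_lt_trans HN _; rewrite ltry.
have hB := wnorm2_psd al1 Bf; split; [exact: hB| |exact: Bf].
move=> z z1.
apply: (cvgC_unique (u := fun N => psum (b N) z)); last first.
  rewrite (_ : (fun N => _) = (fun N => modC (\sum_(k < N) psder A k * psum a z ^+ k - psum (psder A) (psum a z)))).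
    exact: (psum_cvg hdA (a1 z1)).
  by apply/funext => N; rewrite bE.
apply/cvgrPdist_le => eps eps0; have r0 : 0 < 1 - modC z by rewrite subr_gt0.
(* A bound eps (1 - |z|) on all coefficients sums, against the geometric series in |z|, to at most
   eps. *)
have e' : 0 < eps * (1 - modC z) by rewrite mulr_gt0.
have [N HN] := Bsmall _ e'; exists N => // L /= NL.
have := wnorm2_bound al1 (ltW e') (HN L NL) => hb.
rewrite sub0r normrN ger0_norm ?normc_ge0// normcBC.
have pdiff : psd (fun n => B n - b L n) by apply: psd_bounded hb.
have -> : psum B z - psum (b L) z = psum (fun n => B n - b L n) z.
  rewrite (_ : (fun n => _) = (fun n => -1 * b L n + B n)); last by apply/funext => n; rewrite mulN1r addrC.
  by rewrite psum_lin// mulN1r addrC.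
apply: psum_le => // m; apply: (le_trans (normc_sum _ _ _)).
apply: (@le_trans _ _ (\sum_(i < m) eps * (1 - modC z) * modC z ^+ i)).
  apply: ler_sum => i _; rewrite normcM normcX; apply: ler_wpM2r => //; exact: exprn_ge0 (normc_ge0 _).
rewrite -mulr_sumr; apply: (@le_trans _ _ (eps * (1 - modC z) * (1 - modC z)^-1)).
  by apply: ler_wpM2l; [exact: ltW|apply: geometric_sum_le; rewrite normc_ge0].
by rewrite mulfK// gt_eqF.
Qed.

End CompositionEnergy.

(** * Squares on which the map is nearly affine *)

Section Squares.
Variable R : realType.
Local Notation C := R[i].
Implicit Types (z w c m : C) (h : R).

(** Half-open sides make the squares of a mesh disjoint without losing any point. *)
Definition csquare c h : set C :=
  [set z | [/\ complex.Re c - h <= complex.Re z, complex.Re z < complex.Re c + h,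
               complex.Im c - h <= complex.Im z & complex.Im z < complex.Im c + h]].

Lemma csquare_le c h z : csquare c h z -> modC (z - c) <= 2 * h.
Proof.
have eR : complex.Re (z - c) = complex.Re z - complex.Re c by move: (z) (c) => [? ?] [? ?].
have eI : complex.Im (z - c) = complex.Im z - complex.Im c by move: (z) (c) => [? ?] [? ?].
move=> [h1 h2 h3 h4]; apply: (le_trans (normc_le_ReIm _)); rewrite eR eI.
rewrite mulr_natl mulr2n; apply: lerD; rewrite ler_norml; apply/andP; split; lra.
Qed.

Lemma csquare_ball c h z : modC (z - c) < h -> csquare c h z.
Proof.
move=> H; have := le_lt_trans (normr_Re_le _) H; have := le_lt_trans (normr_Im_le _) H.
case: c z {H} => [c1 c2] [z1 z2] /=; rewrite !ltr_norml => /andP[a1 a2] /andP[b1 b2].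
by split => /=; lra.
Qed.

Lemma csquare_center c h : 0 < h -> csquare c h c.
Proof. by move=> h0; apply: csquare_ball; rewrite subrr Normc.normc0. Qed.

Lemma measurable_csquare c h : measurable (@toC R @^-1` csquare c h).
Proof.
rewrite (_ : _ @^-1` _ = `[complex.Re c - h, complex.Re c + h[%classic `*` `[complex.Im c - h, complex.Im c + h[%classic).
  by apply: measurableX; exact: measurable_itv.
apply/seteqP; split => [[x y] [/= h1 h2 h3 h4]|[x y] [/=]].
  by split; rewrite /= in_itv/= ?h1 ?h2 ?h3 ?h4.
by rewrite !in_itv/= => /andP[h1 h2] /andP[h3 h4].
Qed.

Lemma area_csquare c h : 0 <= h -> area R (@toC R @^-1` csquare c h) = (pi^-1 * (2 * h) ^+ 2)%:E.
Proof.
move=> h0.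
rewrite (_ : _ @^-1` _ = `[complex.Re c - h, complex.Re c + h[%classic `*` `[complex.Im c - h, complex.Im c + h[%classic).
  rewrite areaX; try exact: measurable_itv.
  rewrite !lebesgue_measure_itv/= !lte_fin.
  have [->|hn0] := eqVneq h 0.
    by rewrite !subr0 !addr0 !ltxx mul0e mule0 mulr0 expr0n/= mulr0.
  have hp : 0 < h by rewrite lt_neqAle eq_sym hn0.
  rewrite ifT; last by lra.
  rewrite ifT; last by lra.
  by rewrite -!EFinB -!EFinM; congr (_%:E); ring.
apply/seteqP; split => [[x y] [/= h1 h2 h3 h4]|[x y] [/=]].
  by split; rewrite /= in_itv/= ?h1 ?h2 ?h3 ?h4.
by rewrite !in_itv/= => /andP[h1 h2] /andP[h3 h4].
Qed.

End Squares.

Lemma psum_continuous (R : realType) (b : nat -> R[i]) z (eps : R) : psd b -> modC z < 1 -> 0 < eps ->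
  exists2 r : R, 0 < r & forall x, modC (x - z) < r ->
    modC x < 1 /\ modC (psum b x - psum b z) <= eps.
Proof.
move=> pb z1 eps0; have z01 : 0 <= modC z < 1 by rewrite normc_ge0.
have [zs s0 s1] := mid_lt1 z01; set s := (modC z + 1) / 2 in zs s0 s1.
have s01 : 0 < s < 1 by rewrite s0.
have [K K0 HK] := psum_taylor pb s01.
pose N := modC (psum (psder b) z) + K.
have N0 : 0 <= N by rewrite addr_ge0// normc_ge0.
exists (Num.min (Num.min 1 (s - modC z)) (eps / (N + 1))) => [|x].
  by rewrite !lt_min ltr01 subr_gt0 zs divr_gt0// ltr_wpDl.
rewrite !lt_min => /andP[/andP[h1 h2] h3]; have d0 := normc_ge0 (x - z).
have xs : modC x <= s.
  by rewrite -[x](subrK z); apply: (le_trans (normcD _ _)); rewrite -lerBrDr ltW.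
split; first exact: le_lt_trans xs _.
have E : modC (psum b x - psum b z - psum (psder b) z * (x - z)) <= K * modC (x - z) * modC (x - z).
  by apply: (HK x z z _ xs (ltW zs) (ltW zs) (lexx _)); rewrite subrr Normc.normc0.
have -> : psum b x - psum b z = (psum b x - psum b z - psum (psder b) z * (x - z)) + psum (psder b) z * (x - z) by rewrite subrK.
apply: (le_trans (normcD _ _)); rewrite normcM; apply: (le_trans (lerD E (lexx _))).
apply: (@le_trans _ _ ((N + 1) * modC (x - z))); last by rewrite mulrC -ler_pdivlMr ?ltr_wpDl// ltW.
rewrite -mulrDl; apply: ler_wpM2r => //; rewrite /N.
have : K * modC (x - z) <= K by rewrite ler_piMr// ltW.
by lra.
Qed.

(** Since (10/9)^5 < 2, a ratio of 10/9 stays below 2 for all exponents up to 5, which covers both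
    [al] and [al + 4]. *)
Lemma powR_ratio (R : realType) (x y t : R) : 0 < x -> 0 < y -> 9 * x <= 10 * y -> 0 <= t <= 5 ->
  x `^ t <= 2 * y `^ t.
Proof.
move=> x0 y0 xy /andP[t0 t5].
have xy' : x <= (10 / 9) * y by lra.
apply: (@le_trans _ _ (((10 / 9) * y) `^ t)).
  by apply: ge0_ler_powR => //; rewrite nnegrE ?mulr_ge0// ltW.
rewrite powRM ?(ltW y0)//; apply: ler_wpM2r; first exact: powR_ge0.
apply: (@le_trans _ _ ((10 / 9) `^ 5%:R)); first by apply: ler_powR => //; lra.
by rewrite powR_mulrn//; lra.
Qed.

Lemma normc_subD (R : realType) (x y : R[i]) : modC x <= modC (x - y) + modC y.
Proof. by rewrite -{1}[x](subrK y) normcD. Qed.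

Lemma normc_close (R : realType) (x y : R[i]) : modC (x - y) <= modC y / 10 ->
  9 / 10 * modC y <= modC x /\ modC x <= 11 / 10 * modC y.
Proof.
move: (normc_subD x y) (normc_subD y x); rewrite [modC (y - x)]normcBC.
by move: (modC x) (modC y) (modC (x - y)) => p q r *; split; lra.
Qed.

Lemma disc_gap_gt0 (R : realType) (v : R[i]) : modC v < 1 -> 0 < 1 - modC v ^+ 2.
Proof. by move=> v1; rewrite subr_gt0 exprn_ilt1// normc_ge0. Qed.

Lemma invr_le_double (R : realFieldType) (x y : R) : 0 < x -> 0 < y -> y <= 2 * x -> x^-1 <= 2 * y^-1.
Proof.
by move=> x0 y0 h; rewrite -(ler_pM2r x0) mulVf ?gt_eqF// mulrAC ler_pdivlMr// mul1r.
Qed.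

Lemma le_double (R : realFieldType) (r p q : R) : 0 <= r -> 9 / 10 * r <= p -> p <= 11 / 10 * r ->
  9 / 10 * r <= q -> q <= 11 / 10 * r -> p <= 2 * q /\ q <= 2 * p.
Proof. by move=> *; split; lra. Qed.

Lemma cvg0_le (R : realType) (x y : nat -> R) : (forall n, 0 <= x n <= y n) ->
  y @ \oo --> (0 : R) -> x @ \oo --> (0 : R).
Proof.
move=> h hy; apply: (@squeeze_cvgr _ _ _ _ (fun=> 0) y) => //; last exact: cvg_cst.
exact: nearW.
Qed.

(** * Good squares and their images *)

Section GoodSquares.
Variables (R : realType) (al : R).
Local Notation C := R[i].
Hypothesis al0 : 0 < al.
Hypothesis al1 : al < 1.
Variable a : nat -> C.
Hypothesis pa : psd a.
Hypothesis a1 : forall z, modC z < 1 -> modC (psum a z) < 1.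
Local Notation phi := (psum a).
Local Notation dphi := (psum (psder a)).
Local Notation g := (dker al).
Implicit Types (z w c m : C) (h : R).

Definition disc_weight z : R := (1 - modC z ^+ 2) `^ al.
Local Notation u := disc_weight.

(** The relative error 1/4 gives injectivity and a Newton contraction; the factors 2 say that
    derivative, weight and kernel are nearly constant on the square. *)
Record good_square m h : Prop := GoodSquare {
  good_side : 0 < h;
  good_deriv : 0 < modC (dphi m);
  good_disc : forall z, csquare m h z -> modC z < 1;
  good_linear : forall z w, csquare m h z -> csquare m h w ->
    modC (phi z - phi w - dphi m * (z - w)) <= 4^-1 * modC (dphi m) * modC (z - w);
  good_dphi : forall z, csquare m h z -> modC (dphi z) <= 2 * modC (dphi m) /\ modC (dphi m) <= 2 * modC (dphi z);
  good_weight : forall z, csquare m h z -> u z <= 2 * u m /\ u m <= 2 * u z;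
  good_kernel : forall z, csquare m h z -> g (phi z) <= 2 * g (phi m) /\ g (phi m) <= 2 * g (phi z) }.

Lemma good_center m h : good_square m h -> csquare m h m.
Proof. by move=> G; apply: csquare_center; exact: good_side G. Qed.

Lemma good_lower m h z w : good_square m h -> csquare m h z -> csquare m h w ->
  modC (z - w) <= 2 / modC (dphi m) * modC (phi z - phi w).
Proof.
move=> G hz hw; have L0 := good_deriv G; have E := good_linear G hz hw.
have E2 : modC (dphi m) * modC (z - w) <= modC (phi z - phi w) + 4^-1 * modC (dphi m) * modC (z - w).
  rewrite -normcM; have -> : dphi m * (z - w) = (phi z - phi w) - (phi z - phi w - dphi m * (z - w)).
    by rewrite opprB [RHS]addrC subrK.
  by apply: (le_trans (normcB _ _)); rewrite lerD2l.
rewrite mulrAC ler_pdivlMr//.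
move: (normc_ge0 (z - w)) E2; move: (modC (z - w)) (modC (dphi m)) (modC (phi z - phi w)) L0 => d L f L0 d0 E2.
have : 0 <= L * d by rewrite mulr_ge0// ltW.
by move: E2; rewrite -mulrA [d * L]mulrC; move: (L * d) => e; lra.
Qed.

Lemma good_upper m h z w : good_square m h -> csquare m h z -> csquare m h w ->
  modC (phi z - phi w) <= 5 / 4 * modC (dphi m) * modC (z - w).
Proof.
move=> G hz hw; have E := good_linear G hz hw.
have -> : phi z - phi w = (phi z - phi w - dphi m * (z - w)) + dphi m * (z - w) by rewrite subrK.
apply: (le_trans (normcD _ _)); rewrite normcM; apply: (le_trans (lerD E (lexx _))).
by rewrite -!mulrA; move: (_ * modC (z - w)) => e; lra.
Qed.

Lemma good_inj m h z w : good_square m h -> csquare m h z -> csquare m h w ->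
  phi z = phi w -> z = w.
Proof.
move=> G hz hw e; have := good_lower G hz hw; rewrite e subrr Normc.normc0 mulr0 => d0.
apply/eqP; rewrite -subr_eq0 -normc_eq0; apply/eqP/le_anti; rewrite d0/=; exact: normc_ge0.
Qed.

(** The Lipschitz constant 5/4 |phi'(m)| times the distance 2h gives 5/2, which is below 3. *)
Lemma good_image_sub m h z : good_square m h -> csquare m h z ->
  csquare (phi m) (3 * modC (dphi m) * h) (phi z).
Proof.
move=> G hz; apply: csquare_ball; apply: (le_lt_trans (good_upper G hz (good_center G))).
have L0 := good_deriv G; have h0 := good_side G.
apply: (@le_lt_trans _ _ (5 / 4 * modC (dphi m) * (2 * h))).
  apply: ler_wpM2l; first by rewrite !mulr_ge0// ltW.
  exact: csquare_le.
have : 0 < modC (dphi m) * h by rewrite mulr_gt0.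
have -> : 5 / 4 * modC (dphi m) * (2 * h) = 5 / 2 * (modC (dphi m) * h) by field.
by move=> e0; rewrite -subr_gt0 [ltRHS](_ : _ = 2^-1 * (modC (dphi m) * h)) ?mulr_gt0//; field.
Qed.

(* Newton's iteration [z - (phi z - w) / phi'(m)] converges inside the square. *)
Lemma good_image_sup m h w : good_square m h ->
  csquare (phi m) (4^-1 * modC (dphi m) * h) w -> exists2 z, csquare m h z & phi z = w.
Proof.
have i4 : 0 <= (4^-1 : R) <= 1 by apply/andP; split; lra.
move=> G /csquare_le hw; have L0 := good_deriv G; have h0 := good_side G.
set d := dphi m in hw L0 *; set L := modC d in hw L0 *.
have dn0 : d != 0 by rewrite -normc_gt0.
pose z n : C := iter n (fun z => z - (phi z - w) / d) m.
have zS n : z n.+1 = z n - (phi (z n) - w) / d by [].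
have dV : modC d^-1 = L^-1.
  by apply: (mulfI (lt0r_neq0 L0)); rewrite -normcM !mulfV// ?Normc.normc1// lt0r_neq0.
have step n : modC (z n.+1 - z n) = modC (phi (z n) - w) / L.
  by rewrite zS addrC addKr normcN normcM dV.
(* The initial residual is at most L h / 2 and each step multiplies it by 1/4. The steps have
   lengths at most h/2, h/8, and so on, with total 2/3 h, so the iterates stay in the square. *)
have key n : [/\ modC (phi (z n) - w) <= 4^-1 ^+ n * (L * h / 2),
    modC (z n - m) <= 2 / 3 * (1 - 4^-1 ^+ n) * h & csquare m h (z n)].
  elim: n => [|n [IH1 IH2 IH3]].
    rewrite /z/= expr0 mul1r normcBC !subrr Normc.normc0 mulr0 mul0r; split => //.
      by apply: (le_trans hw); lra.
    exact: csquare_center.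
  have st : modC (z n.+1 - z n) <= 4^-1 ^+ n * (h / 2).
    rewrite step ler_pdivrMr//; apply: (le_trans IH1).
    by rewrite [L * h]mulrC -[h * L / 2]mulrA [L / 2]mulrC !mulrA.
  have e2 : modC (z n.+1 - m) <= 2 / 3 * (1 - 4^-1 ^+ n.+1) * h.
    apply: (le_trans (normc_triangle (z n) _ _)); apply: (le_trans (lerD st IH2)).
    by rewrite exprS; move: (4^-1 ^+ n) => q; lra.
  have sq : csquare m h (z n.+1).
    apply: csquare_ball; apply: (le_lt_trans e2).
    have : 0 <= 4^-1 ^+ n.+1 :> R by rewrite exprn_ge0.
    by move: (4^-1 ^+ n.+1) => q q0; have := mulr_ge0 q0 (ltW h0); move: h0; lra.
  split => //.
  have := good_linear G sq IH3.
  have -> : phi (z n.+1) - phi (z n) - d * (z n.+1 - z n) = phi (z n.+1) - w.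
    have -> : z n.+1 - z n = - ((phi (z n) - w) / d) by rewrite zS addrC addKr.
    by rewrite mulrN opprK mulrCA mulfV// mulr1 addrA subrK.
  move/le_trans; apply; rewrite exprS -!mulrA; apply: ler_wpM2l => //.
  rewrite -/L; apply: (@le_trans _ _ (L * (4^-1 ^+ n * (h / 2)))); first by apply: ler_wpM2l => //; exact: ltW.
  by rewrite mulrCA !mulrA.
have cauchy : exists l, (fun n => modC (z n - l)) @ \oo --> (0 : R).
  apply: cauchyC => eps eps0.
  have : (fun n => 4^-1 ^+ n * h) @ \oo --> (0 * h : R).
    apply: cvgM; last exact: cvg_cst.
    by apply: cvg_expr; rewrite ger0_norm//; lra.
  have e2 : 0 < eps / 2 by rewrite divr_gt0.
  rewrite mul0r => /cvgrPdist_le /(_ _ e2) [N _ HN]; exists N => n Nn.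
  have /= := HN N (leqnn N); rewrite sub0r normrN ger0_norm ?mulr_ge0 ?exprn_ge0 ?(ltW h0)//.
  move=> hN; apply: (@le_trans _ _ (2 * (4^-1 ^+ N * h))); last by rewrite mulrC -ler_pdivlMr.
  have [_ _ sN] := key N; have [_ _ sn] := key n.
  have [fN _ _] := key N; have [fn _ _] := key n.
  apply: (le_trans (good_lower G sn sN)); rewrite -/d -/L.
  rewrite -mulrA; apply: ler_wpM2l => //; rewrite mulrC ler_pdivrMr// -mulrA [h * L]mulrC.
  have q : 4^-1 ^+ n <= 4^-1 ^+ N :> R by rewrite ler_wiXn2l//; case/andP: i4.
  have fn' : modC (phi (z n) - w) <= 4^-1 ^+ N * (L * h / 2).
    by apply: (le_trans fn); apply: ler_wpM2r => //; rewrite !mulr_ge0// ltW.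
  have := normc_triangle w (phi (z n)) (phi (z N)); rewrite [modC (w - _)]normcBC => h1.
  have := le_trans h1 (lerD fn' fN); by rewrite -mulrDr -splitr.
have [l hl] := cauchy.
have sl : csquare m h l.
  apply: csquare_ball; apply: (@le_lt_trans _ _ (2 / 3 * h)); last by lra.
  apply: (cvgC_le (u := fun n => z n - m)).
    rewrite (_ : (fun n => _) = (fun n => modC (z n - l)))//.
    by apply/funext => n; rewrite opprB addrA subrK.
  apply: nearW => n; have [_ zm _] := key n; apply: (le_trans zm).
  apply: ler_wpM2r; first exact: ltW.
  by rewrite ler_piMr// lerBlDr lerDl exprn_ge0.
exists l => //; apply: (cvgC_unique (u := fun n => phi (z n))).
  apply: (@cvg0_le _ _ (fun n => 5 / 4 * L * modC (z n - l))) => [n|].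
    by rewrite normc_ge0/=; have [_ _ sn] := key n; exact: good_upper G sn sl.
  by rewrite -(mulr0 (5 / 4 * L)); apply: cvgM => //; exact: cvg_cst.
apply: (@cvg0_le _ _ (fun n => 4^-1 ^+ n * (L * h / 2))) => [n|].
  by rewrite normc_ge0/=; have [] := key n.
rewrite -(mul0r (L * h / 2)); apply: cvgM; last exact: cvg_cst.
by apply: cvg_expr; rewrite ger0_norm//; lra.
Qed.

(** The gap 1 - |z|^2 changes by at most 2 |x - z|, that is by 1/50 of itself. The ratio 20/19 is
    chosen so that two comparisons through [z] compose to less than 10/9, as [powR_ratio]
    demands. *)
Lemma disc_gap_close (x z : C) : modC z < 1 -> modC x < 1 ->
  modC (x - z) <= (1 - modC z ^+ 2) / 100 ->
  19 * (1 - modC x ^+ 2) <= 20 * (1 - modC z ^+ 2) /\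
  19 * (1 - modC z ^+ 2) <= 20 * (1 - modC x ^+ 2).
Proof.
have := normc_subD x z; have := normc_subD z x; rewrite [modC (z - x)]normcBC.
move: (normc_ge0 x) (normc_ge0 z).
move: (modC x) (modC z) (modC (x - z)) => X Z d X0 Z0 h1 h2 Z1 X1 hd.
have q0 : 0 < 1 - Z ^+ 2 by rewrite subr_gt0 exprn_ilt1.
have e1 : X ^+ 2 - Z ^+ 2 = (X - Z) * (X + Z) by ring.
have [hXZ|hXZ] := leP X Z.
  have : 0 <= (Z - X) * (X + Z) by rewrite mulr_ge0 ?subr_ge0// addr_ge0.
  have : (Z - X) * (X + Z) <= (Z - X) * 2 by apply: ler_wpM2l; lra.
  by lra.
have : 0 <= (X - Z) * (X + Z) by rewrite mulr_ge0 ?subr_ge0 ?addr_ge0// ltW.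
have : (X - Z) * (X + Z) <= (X - Z) * 2 by apply: ler_wpM2l; lra.
by lra.
Qed.

Lemma good_near z : modC z < 1 -> dphi z != 0 -> exists2 r, 0 < r &
  forall m h, 0 < h -> h < r -> csquare m h z -> good_square m h.
Proof.
have al5 : al <= 5 by rewrite (le_trans (ltW al1))// ler1n.
have ale : 0 <= al <= 5 by rewrite (ltW al0).
have ale4 : 0 <= al + 4 <= 5.
  rewrite addr_ge0 ?(ltW al0)//= -lerBrDr (le_trans (ltW al1))//.
  by rewrite lerBrDr -(natrD _ 1 4) ler_nat.
move=> z1 dz; pose L0 := modC (dphi z); have L00 : 0 < L0 by rewrite normc_gt0.
pose q1 := 1 - modC z ^+ 2; pose q2 := 1 - modC (phi z) ^+ 2.
have q10 : 0 < q1 by rewrite subr_gt0 exprn_ilt1// normc_ge0.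
have q20 : 0 < q2 by rewrite subr_gt0 exprn_ilt1 ?normc_ge0// a1.
have z01 : 0 <= modC z < 1 by rewrite normc_ge0.
have [zs s0 s1] := mid_lt1 z01; set s := (modC z + 1) / 2 in zs s0 s1.
have s01 : 0 < s < 1 by rewrite s0.
have [K K0 HK] := psum_taylor pa s01.
have e1 : 0 < L0 / 10 by rewrite divr_gt0.
have e2 : 0 < q2 / 100 by rewrite divr_gt0.
have [r1 r10 H1] := psum_continuous (psd_der pa) z1 e1.
have [r2 r20 H2] := psum_continuous pa z1 e2.
pose r0 := Num.min (Num.min r1 r2) (Num.min (s - modC z) (q1 / 100)).
have r00 : 0 < r0 by rewrite !lt_min r10 r20 subr_gt0 zs divr_gt0.
pose ball x := [/\ modC x <= s, modC (dphi x - dphi z) <= L0 / 10, modC (phi x - phi z) <= q2 / 100 & modC (x - z) <= q1 / 100].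
have near x : modC (x - z) < r0 -> ball x.
  rewrite !lt_min => /andP[/andP[x1 x2] /andP[x3 x4]]; split.
  - by rewrite -[x](subrK z); apply: (le_trans (normcD _ _)); rewrite -lerBrDr ltW.
  - by have [] := H1 _ x1.
  - by have [] := H2 _ x2.
  - exact: ltW.
(* Points of the square are within 4h < r0 of z. The second entry gives 2 K h <= L0 / 5, which is
   below 1/4 * 9/10 * L0, hence the tolerance 1/4 relative to the derivative at the center. *)
exists (Num.min (r0 / 4) (L0 / (10 * (K + 1)))).
  by rewrite lt_min !divr_gt0// mulr_gt0// ltr_wpDl.
move=> m h h0; rewrite lt_min => /andP[hr hK] hz.
have bx x : csquare m h x -> ball x.
  move=> hx; apply: near; apply: (le_lt_trans (normc_triangle m _ _)).
  rewrite [modC (m - z)]normcBC; have := csquare_le hx; have := csquare_le hz; lra.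
have hm : csquare m h m by exact: csquare_center.
have [ms mL mphi mz] := bx m hm.
have Lm x : ball x -> 9 / 10 * L0 <= modC (dphi x) /\ modC (dphi x) <= 11 / 10 * L0.
  by move=> [_ xL _ _]; exact: normc_close xL.
have ratio (psi : C -> C) x y t : 0 <= t <= 5 -> modC (psi z) < 1 -> modC (psi x) < 1 -> modC (psi y) < 1 ->
    modC (psi x - psi z) <= (1 - modC (psi z) ^+ 2) / 100 ->
    modC (psi y - psi z) <= (1 - modC (psi z) ^+ 2) / 100 ->
    (1 - modC (psi x) ^+ 2) `^ t <= 2 * (1 - modC (psi y) ^+ 2) `^ t.
  move=> t05 Z1 X1 Y1 dx dy.
  have [A1 A2] := disc_gap_close Z1 X1 dx; have [B1 B2] := disc_gap_close Z1 Y1 dy.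
  have p1 := disc_gap_gt0 X1; have p2 := disc_gap_gt0 Y1; have p3 := disc_gap_gt0 Z1.
  by apply: powR_ratio => //; lra.
have lt1 x : ball x -> modC x < 1 by move=> [xs _ _ _]; exact: le_lt_trans xs s1.
have bm := bx m hm; have [Lm1 Lm2] := Lm m bm.
have kratio x y : ball x -> ball y -> g (phi x) <= 2 * g (phi y).
  move=> hx hy; have [_ _ x3 _] := hx; have [_ _ y3 _] := hy.
  have h1 := ratio phi y x (al + 4) ale4 (a1 z1) (a1 (lt1 _ hy)) (a1 (lt1 _ hx)) y3 x3.
  have p1 : 0 < (1 - modC (phi x) ^+ 2) `^ (al + 4) by apply: powR_gt0; apply: disc_gap_gt0; apply: a1; exact: lt1.
  have p2 : 0 < (1 - modC (phi y) ^+ 2) `^ (al + 4) by apply: powR_gt0; apply: disc_gap_gt0; apply: a1; exact: lt1.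
  exact: invr_le_double p1 p2 h1.
split; first exact: h0.
- by apply: lt_le_trans Lm1; rewrite mulr_gt0.
- by move=> x /bx/lt1.
- move=> x y hx hy; have [xs _ _ _] := bx x hx; have [ys _ _ _] := bx y hy.
  apply: (le_trans (HK x y m (2 * h) xs ys ms (csquare_le hx) (csquare_le hy))).
  apply: ler_wpM2r; first exact: normc_ge0.
  move: hK; rewrite ltr_pdivlMr; last by rewrite mulr_gt0// ltr_wpDl.
  by nra.
- by move=> x /bx/Lm [x1 x2]; exact: (le_double (ltW L00) x1 x2 Lm1 Lm2).
- move=> x /bx hx; have [_ _ _ x3] := hx.
  by split; apply: (ratio id) => //; exact: lt1.
- by move=> x /bx hx; split; exact: kratio.
Qed.

End GoodSquares.

(** * Change of variables with the counting function *)

(** The predicate lets at most one index of the list through, so the sum has at most one term. *)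
Lemma sum_uniq_le (R : numDomainType) (I : eqType) (s : seq I) (P : pred I) (F : I -> R) (M : R) :
  uniq s -> 0 <= M -> (forall x y, x \in s -> y \in s -> P x -> P y -> x = y) ->
  (forall x, x \in s -> P x -> F x <= M) -> \sum_(x <- s | P x) F x <= M.
Proof.
elim: s => [|x s IH]; first by rewrite big_nil.
move=> /= /andP[xs us] M0 H1 H2; rewrite big_cons; case: ifP => Px.
  rewrite big_seq_cond big1 ?addr0; first by apply: H2 => //; rewrite inE eqxx.
  move=> y /andP[ys Py]; have := H1 x y; rewrite !inE eqxx ys orbT => /(_ isT isT Px Py) xy.
  by rewrite xy ys in xs.
by apply: IH => // [y z ys zs|y ys]; [apply: H1|apply: H2]; rewrite ?inE ?ys ?zs orbT.
Qed.

(** * Upper bounds for integrals of possibly non-measurable functions *)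

Section IntegralTools.
Variables (d : measure_display) (T : measurableType d) (R : realType).
Variable mu : {measure set T -> \bar R}.
Local Open Scope ereal_scope.

(* The integral of a nonnegative function is a supremum over the simple functions below it, so monotonicity needs no measurability. *)
Lemma ge0_le_integral_sup (D : set T) (f g : T -> \bar R) : (forall x, D x -> 0 <= f x) ->
  (forall x, D x -> f x <= g x) -> \int[mu]_(x in D) f x <= \int[mu]_(x in D) g x.
Proof.
move=> f0 fg; have g0 x : D x -> 0 <= g x by move=> Dx; exact: le_trans (f0 x Dx) (fg x Dx).
rewrite !ge0_integralE//; apply: ereal_sup_le => _ [h hf <-].
exists h => // x; apply: (le_trans (hf x)).
by rewrite /patch; case: ifP => // xD; apply: fg; rewrite inE in xD.
Qed.

Lemma limn_einf_ge (u : nat -> \bar R) x : (exists N, forall n, (N <= n)%N -> x <= u n) ->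
  x <= limn_einf u.
Proof.
move=> [N HN]; rewrite limn_einf_lim (cvg_lim _ (@cvg_einfs_sup _ u))//.
apply: (@le_trans _ _ (einfs u N)); last by apply: ereal_sup_ubound; exists N.
by apply: le_ereal_inf_tmp => _ [n /= Nn <-]; exact: HN.
Qed.

Lemma limn_einf_le (u : nat -> \bar R) B : (forall n, u n <= B) -> limn_einf u <= B.
Proof.
move=> uB; rewrite limn_einf_lim (cvg_lim _ (@cvg_einfs_sup _ u))//.
apply: ge_ereal_sup => _ [n _ <-]; apply: le_trans (uB n).
by apply: ereal_inf_lbound; exists n => /=.
Qed.

Lemma measurable_limn_einf (D : set T) (F : nat -> T -> \bar R) : measurable D ->
  (forall n, measurable_fun D (F n)) -> measurable_fun D (fun x => limn_einf (F ^~ x)).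
Proof.
move=> mD mF; rewrite /limn_einf; apply: measurableT_comp => //.
apply: (measurable_fun_limn_esup (f := fun n x => - F n x)) => // n.
exact: measurableT_comp.
Qed.

(** Fatou for a function [f] that need not be measurable: a measurable majorant is put between [f]
    and the lower limit, from which it differs only on a null set. *)
Lemma integral_le_einf (D V : set T) (F : nat -> T -> \bar R) (f : T -> \bar R) (B : \bar R) :
  measurable D -> measurable V -> mu V = 0 ->
  (forall n, measurable_fun D (F n)) -> (forall n x, D x -> 0 <= F n x) ->
  (forall x, D x -> 0 <= f x) -> (forall x, D x -> ~ V x -> f x <= limn_einf (F ^~ x)) ->
  (forall n, \int[mu]_(x in D) F n x <= B) -> \int[mu]_(x in D) f x <= B.
Proof.
move=> mD mV V0 mF F0 f0 fF FB.
have mL := measurable_limn_einf mD mF.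
have L0 x : D x -> 0 <= limn_einf (F ^~ x).
  by move=> Dx; apply: limn_einf_ge; exists 0%N => n _; exact: F0.
(* On the exceptional set nothing is known about [f], so the majorant is infinite there; the set is
   null and the integral does not change. *)
pose H x := limn_einf (F ^~ x) + (\1_V x)%:E * +oo.
have mH : measurable_fun D H.
  apply: emeasurable_funD => //; apply: emeasurable_funM; last exact: measurable_cst.
  by apply/measurable_EFinP; apply: measurable_indic.
have I0 x : 0 <= (\1_V x)%:E * +oo :> \bar R by rewrite mule_ge0// lee_fin.
apply: (@le_trans _ _ (\int[mu]_(x in D) H x)).
  apply: ge0_le_integral_sup => // x Dx; rewrite /H indicE; case: (boolP (x \in V)) => xV.
    by rewrite mul1e addey ?leey// gt_eqF// (lt_le_trans _ (L0 x Dx))// ltNy0.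
  by rewrite mul0e adde0; apply: fF => // Vx; rewrite notin_setE in xV.
rewrite (@ge0_ae_eq_integral _ _ _ mu D H (fun x => limn_einf (F ^~ x)))//.
- by apply: (le_trans (fatou mu mD mF F0)); exact: limn_einf_le.
- by move=> x Dx; rewrite adde_ge0 ?L0.
exists V; split => // x /= /not_implyP[Dx]; rewrite /H indicE.
by case: (boolP (x \in V)) => [/set_mem//|_]; rewrite mul0e adde0.
Qed.

End IntegralTools.

Section StepFunctions.
Variable R : realType.
Local Notation C := R[i].
Local Notation T := (measurableTypeR R * measurableTypeR R)%type.
Local Notation area := (@area R).
Local Notation D := (@unit_disc R).
Variables (I : finType) (c : I -> R) (m : I -> C) (s : I -> R).
Hypothesis c0 : forall q, 0 <= c q.
Hypothesis s0 : forall q, 0 <= s q.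
Let mD := @measurable_unit_disc R.

Definition step (p : T) : R := \sum_q c q * \1_(@toC R @^-1` csquare (m q) (s q)) p.

Lemma step_ge0 p : 0 <= step p.
Proof. by apply: sumr_ge0 => q _; rewrite mulr_ge0. Qed.

Lemma measurable_step : measurable_fun D step.
Proof.
apply: measurable_sum => q; apply: measurable_funM; first exact: measurable_cst.
by apply: measurable_indic; exact: measurable_csquare.
Qed.

Lemma integral_stepE : (\int[area]_(p in D) (step p)%:E =
  \sum_q (c q)%:E * area (@toC R @^-1` csquare (m q) (s q) `&` D))%E.
Proof.
rewrite (eq_integral (fun p => (\sum_q (c q)%:E * (\1_(@toC R @^-1` csquare (m q) (s q)) p)%:E)%E)); last first.
  by move=> p _; rewrite /step -sumEFin; apply: eq_bigr => q _; rewrite EFinM.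
rewrite (@ge0_integral_sum _ _ _ area D mD I (fun q p => ((c q)%:E * (\1_(@toC R @^-1` csquare (m q) (s q)) p)%:E)%E))//.
- apply: eq_bigr => q _; rewrite ge0_integralZl_EFin//; last first.
    by apply/measurable_EFinP; apply: measurable_indic; exact: measurable_csquare.
  by rewrite integral_indic//; exact: measurable_csquare.
- move=> q; apply: measurable_funeM; apply/measurable_EFinP.
  by apply: measurable_indic; exact: measurable_csquare.
- by move=> q p _; rewrite mule_ge0// lee_fin.
Qed.

Lemma integral_step_le : (\int[area]_(p in D) (step p)%:E <=
  (\sum_q c q * (pi^-1 * (2 * s q) ^+ 2))%:E)%E.
Proof.
rewrite integral_stepE -sumEFin; apply: lee_sum => q _; rewrite EFinM.
apply: lee_wpmul2l; first by rewrite lee_fin.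
rewrite -(area_csquare (m q) (s0 q)); apply: le_measure; rewrite ?inE; [|exact: measurable_csquare|exact: subIsetl].
by apply: measurableI => //; exact: measurable_csquare.
Qed.

Lemma integral_step_eq : (forall q z, c q != 0 -> csquare (m q) (s q) z -> modC z < 1) ->
  (\int[area]_(p in D) (step p)%:E = (\sum_q c q * (pi^-1 * (2 * s q) ^+ 2))%:E)%E.
Proof.
move=> H; rewrite integral_stepE -sumEFin; apply: eq_bigr => q _.
have [->|cq] := eqVneq (c q) 0; first by rewrite mul0e mul0r.
rewrite EFinM -(area_csquare (m q) (s0 q)); congr (_ * area _)%E.
by apply/setIidPl => p; exact: H.
Qed.

End StepFunctions.

(** * Meshes of squares covering the disc *)

Section Mesh.
Variable R : realType.
Local Notation C := R[i].
Implicit Types (z : C) (n : nat).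

(** Half the side of a cell when the square [-1, 1[ x [-1, 1[ is cut into 2(n+1) rows and 2(n+1)
    columns. *)
Definition mesh_half n : R := (2 * n.+1%:R)^-1.

Definition mesh_index n := ('I_(n.+1.*2) * 'I_(n.+1.*2))%type.

Definition mesh_center n (q : mesh_index n) : C :=
  (((2 * q.1%:R + 1) * mesh_half n - 1)%R +i* ((2 * q.2%:R + 1) * mesh_half n - 1)%R)%C.

Lemma mesh_half_gt0 n : 0 < mesh_half n.
Proof. by rewrite invr_gt0 mulr_gt0. Qed.

Lemma mesh_halfE n : 2 * mesh_half n * n.+1%:R = 1.
Proof. by rewrite /mesh_half; move: (n.+1%:R : R) (ltr0Sn R n) => N N0; field; rewrite gt_eqF. Qed.

(** Belonging to the i-th strip means that i is the integer part of (x + 1)(n + 1); disjointness and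
    covering both follow from this. *)
Lemma mesh_itv n (x : R) (i : nat) :
  ((2 * i%:R + 1) * mesh_half n - 1 - mesh_half n <= x) &&
  (x < (2 * i%:R + 1) * mesh_half n - 1 + mesh_half n) =
  (i%:R <= (x + 1) * n.+1%:R) && ((x + 1) * n.+1%:R < i.+1%:R).
Proof.
have h0 := mesh_half_gt0 n; have e := mesh_halfE n.
have N0 : 0 < n.+1%:R :> R by [].
congr (_ && _).
  rewrite -(ler_pM2r N0) -[RHS](lerD2r (- n.+1%:R)).
  congr (_ <= _); last by ring.
  rewrite (_ : (_ * _ - 1 - _) * _ = i%:R * (2 * mesh_half n * n.+1%:R) - n.+1%:R); last by ring.
  by rewrite e mulr1.
rewrite -(ltr_pM2r N0) -[RHS](ltrD2r (- n.+1%:R)).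
congr (_ < _); first by ring.
rewrite (_ : (_ * _ - 1 + _) * _ = (i%:R + 1) * (2 * mesh_half n * n.+1%:R) - n.+1%:R); last by ring.
by rewrite e mulr1 natr1.
Qed.

Lemma mesh_disjoint n (q q' : mesh_index n) z :
  csquare (mesh_center q) (mesh_half n) z -> csquare (mesh_center q') (mesh_half n) z -> q = q'.
Proof.
have one (x : R) (i j : 'I_(n.+1.*2)) :
    (i%:R <= (x + 1) * n.+1%:R) && ((x + 1) * n.+1%:R < i.+1%:R) ->
    (j%:R <= (x + 1) * n.+1%:R) && ((x + 1) * n.+1%:R < j.+1%:R) -> i = j.
  move=> /andP[a b] /andP[c d]; apply/val_inj/eqP; rewrite eqn_leq -ltnS -(ltnS j).
  by rewrite -!(ltr_nat R) (le_lt_trans a d) (le_lt_trans c b).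
case: q q' z => [i j] [i' j'] [x y] [/= a1 a2 a3 a4] [/= b1 b2 b3 b4].
congr (_, _); [apply: (one x)|apply: (one y)]; rewrite -mesh_itv; exact/andP.
Qed.

Lemma mesh_cover n z : modC z < 1 -> exists q : mesh_index n, csquare (mesh_center q) (mesh_half n) z.
Proof.
have one (x : R) : `|x| < 1 -> exists i : 'I_(n.+1.*2),
    (i%:R <= (x + 1) * n.+1%:R) && ((x + 1) * n.+1%:R < i.+1%:R).
  rewrite ltr_norml => /andP[x1 x2].
  have y0 : 0 <= (x + 1) * n.+1%:R by rewrite mulr_ge0//; lra.
  have := Num.Theory.truncn_itv y0; set i := Num.truncn _ => hi.
  have i2 : (i < n.+1.*2)%N.
    rewrite -(ltr_nat R); case/andP: hi => h _; apply: (le_lt_trans h).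
    by rewrite -muln2 natrM [ltRHS]mulrC ltr_pM2r//; lra.
  by exists (Ordinal i2).
move=> z1; have [i hi] := one _ (le_lt_trans (normr_Re_le z) z1).
have [j hj] := one _ (le_lt_trans (normr_Im_le z) z1).
exists (i, j); move: hi hj; rewrite -!mesh_itv => /andP[a1 a2] /andP[a3 a4].
by split.
Qed.

Lemma mesh_half_small (r : R) : 0 < r -> exists N, forall n, (N <= n)%N -> mesh_half n < r.
Proof.
move=> r0; exists (Num.truncn r^-1) => n Nn.
rewrite /mesh_half -[r]invrK ltf_pV2 ?posrE ?invr_gt0 ?mulr_gt0//.
have r1 : 0 <= r^-1 by rewrite invr_ge0 ltW.
have /andP[_ h] := Num.Theory.truncn_itv r1.
apply: (lt_le_trans h); apply: (@le_trans _ _ n.+1%:R); first by rewrite ler_nat.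
by rewrite ler_peMl// ler1n.
Qed.

End Mesh.

Lemma step_ge_term (R : realType) (I : finType) (c : I -> R) (m : I -> R[i]) (s : I -> R) q p :
  (forall q, 0 <= c q) -> csquare (m q) (s q) (toC p) -> c q <= step c m s p.
Proof.
move=> c0 hq; rewrite /step (bigD1 q)//= indicE mem_set// mulr1 lerDl sumr_ge0// => i _.
exact: mulr_ge0.
Qed.

Lemma fsum_seq (R : realType) (I : choiceType) (F : I -> \bar R) (X : set I) : finite_set X ->
  exists l : seq I, [/\ uniq l, forall z, z \in l -> X z &
    (\sum_(z \in X) F z = \sum_(z <- l) F z)%E].
Proof.
move=> fX; exists (finmap.enum_fset (fset_set X)); split.
- exact: finmap.fset_uniq.
- by move=> z; rewrite in_fset_set// => /set_mem.
- by rewrite fsbig_finite.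
Qed.

(** * The critical values form a null set *)

Section CriticalValues.
Variable R : realType.
Local Notation C := R[i].
Local Notation T := (measurableTypeR R * measurableTypeR R)%type.
Local Notation area := (@area R).
Local Notation D := (@unit_disc R).
Variable a : nat -> C.
Hypothesis pa : psd a.
Hypothesis a1 : forall z, modC z < 1 -> modC (psum a z) < 1.
Local Notation phi := (psum a).
Local Notation dphi := (psum (psder a)).
Let mD := @measurable_unit_disc R.

Lemma card_mesh n : \sum_(q : mesh_index n) (1 : R) = (mesh_half R n)^-2.
Proof.
rewrite sumr_const card_prod card_ord -exprVn /mesh_half invrK -natrM -natrX.
by congr (_%:R); rewrite -muln2 -mulnn mulnC.
Qed.

(* On a square of side [2h] containing a critical point, [phi] varies by [O(h^2)]. *)
Lemma critical_values_cover (s : R) : 0 < s < 1 -> exists2 M, 0 < M & forall n,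
  exists c : mesh_index n -> C, forall z, modC z <= s -> dphi z = 0 ->
    exists q, csquare (c q) (M * mesh_half R n ^+ 2) (phi z).
Proof.
move=> s01; have [K K0 HK] := psum_taylor pa s01.
(* Two points of one cell are at distance at most 4h, so the quadratic error is at most 16 K h^2;
   the extra 1 makes the inequality strict. *)
exists (16 * K + 1); first by rewrite ltr_wpDl// mulr_ge0.
move=> n; pose h := mesh_half R n; have h0 : 0 < h by exact: mesh_half_gt0.
pose Z (q : mesh_index n) : set C := [set z | [/\ modC z <= s, dphi z = 0 & csquare (mesh_center R q) h z]].
(* The image square is centered at the value of an arbitrary critical point of the cell; the default
   0 occurs only for cells without one, which never serve as witnesses. *)
exists (fun q => phi (xget 0 (Z q))) => z zs dz.
have z1 : modC z < 1 by apply: (le_lt_trans zs); case/andP: s01.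
have [q hq] := mesh_cover n z1; exists q.
have : Z q (xget 0 (Z q)) by apply: (xgetPex 0); exists z.
move: (xget 0 (Z q)) => c [cs dc hc]; apply: csquare_ball.
have zc : modC (z - c) <= 4 * h.
  apply: (le_trans (normc_triangle (mesh_center R q) _ _)); rewrite [modC (_ - c)]normcBC.
  have e1 : _ <= 2 * h := csquare_le hq; have e2 := csquare_le hc.
  by apply: (le_trans (lerD e1 e2)); rewrite -mulrDl; apply: ler_wpM2r; [exact: ltW|rewrite -natrD].
have c0 : modC (c - c) <= 4 * h by rewrite subrr Normc.normc0 mulr_ge0// ltW.
have := HK z c c (4 * h) zs cs cs zc c0; rewrite dc mul0r subr0 => /le_lt_trans; apply.
apply: (@le_lt_trans _ _ (K * (4 * h) * (4 * h))).
  by apply: ler_wpM2l => //; rewrite !mulr_ge0// ltW.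
rewrite [ltLHS](_ : _ = 16 * K * h ^+ 2); last by ring.
by rewrite ltr_pM2r ?exprn_gt0// ltrDl.
Qed.

(** There are h^-2 cells and each covering square has area of order h^4, so the total is of order
    h^2. The set [V] of points where all the step functions are at least 1 is a measurable set
    containing the critical values. *)
Lemma critical_values_null (s : R) : 0 < s < 1 -> exists V : set T,
  [/\ measurable V, area V = 0%E &
    forall p z, modC z <= s -> dphi z = 0 -> phi z = toC p -> V p].
Proof.
move=> s01; have [M M0 HM] := critical_values_cover s01.
pose c n := projT1 (cid (HM n)); have Hc n := projT2 (cid (HM n)).
pose h n := mesh_half R n; pose F n := step (fun=> 1 : R) (c n) (fun=> M * h n ^+ 2).
have h0 n : 0 < h n by exact: mesh_half_gt0.
have r0 n : 0 <= M * h n ^+ 2 by rewrite mulr_ge0 ?sqr_ge0// ltW.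
pose V := \bigcap_n (D `&` F n @^-1` `[1, +oo[%classic).
have mF n : measurable_fun D (F n) by exact: measurable_step.
have mV : measurable V.
  by apply: bigcapT_measurable => n; apply: mF => //; exact: measurable_itv.
have VD : V `<=` D by move=> p /(_ 0%N I) [].
pose A := 4 * pi^-1 * M ^+ 2.
have A0 : 0 < A by rewrite !mulr_gt0 ?invr_gt0 ?pi_gt0 ?exprn_gt0.
have bound n : (area V <= (A * h n ^+ 2)%:E)%E.
  rewrite -[V](setIidl VD) -integral_indic//.
  apply: (@le_trans _ _ (\int[area]_(p in D) (F n p)%:E)%E).
    apply: ge0_le_integral_sup => p Dp; rewrite lee_fin// indicE.
    case: (boolP (p \in V)) => [/set_mem /(_ n I) [_]|_]; last by apply: step_ge0.
    by rewrite /= in_itv/= andbT.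
  apply: (le_trans (integral_step_le _ _ _)) => //; rewrite lee_fin.
  rewrite -mulr_suml card_mesh -/(h n).
  rewrite (_ : _ * (pi^-1 * _ ^+ 2) = A * h n ^+ 2)//.
  rewrite /A; have := lt0r_neq0 (h0 n); move: (h n) (pi^-1) => x P x0; by field.
exists V; split => //.
  apply/eqP; rewrite eq_le measure_ge0 andbT; apply/lee_addgt0Pr => eps eps0; rewrite add0e.
  have e1 : 0 < Num.min 1 (eps / A) by rewrite lt_min ltr01 divr_gt0.
  have [N /(_ N (leqnn N))] := mesh_half_small e1; rewrite lt_min -/(h N) => /andP[h1 h2].
  apply: (le_trans (bound N)); rewrite lee_fin.
  apply: (@le_trans _ _ (A * h N)); last by rewrite mulrC -ler_pdivlMr// ltW.
  by apply: ler_wpM2l; [exact: ltW|rewrite expr2 ler_piMr// ltW].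
move=> p z zs dz pz n _; split.
  have z1 : modC z < 1 by apply: (le_lt_trans zs); case/andP: s01.
  by have := a1 z1; rewrite pz.
rewrite /= in_itv/= andbT; have [q hq] := Hc n z zs dz; rewrite pz in hq.
by apply: (@step_ge_term R _ (fun=> 1) (c n) (fun=> M * h n ^+ 2) q p _ hq) => _; exact: ler01.
Qed.

Lemma sard : exists V : set T, [/\ measurable V, area V = 0%E &
  forall p z, modC z < 1 -> dphi z = 0 -> phi z = toC p -> V p].
Proof.
pose s k : R := 1 - k.+2%:R^-1.
have s01 k : 0 < s k < 1.
  by rewrite subr_gt0 invf_lt1// ltr1n/= ltrBlDr ltrDl invr_gt0.
have [V HV] := choice (fun k => critical_values_null (s01 k)).
exists (\bigcup_k V k); split.
- by apply: bigcupT_measurable => k; case: (HV k).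
- apply/eqP; rewrite eq_le measure_ge0 andbT.
  apply: (@le_trans _ _ (\sum_(k <oo) area (V k))%E).
    apply: measure_sigma_subadditive => //; first by move=> k; case: (HV k).
    by apply: bigcupT_measurable => k; case: (HV k).
  by rewrite eseries0// => k _ _; case: (HV k).
move=> p z z1 dz pz; have z0 : 0 < 1 - modC z by rewrite subr_gt0.
have [N /(_ N (leqnn N)) hN] := mesh_half_small z0.
(* The radius with index 2N is 1 - 1/(2N + 2), and 1/(2N + 2) is [mesh_half] at N. *)
exists N.*2 => //; have [_ _ H] := HV N.*2; apply: (H p z _ dz pz).
rewrite /s lerBrDr -lerBrDl; apply: (le_trans _ (ltW hN)).
by rewrite /mesh_half -doubleS -muln2 natrM mulrC.
Qed.

End CriticalValues.

(** * Comparing the energy with the counting integral *)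

Section Comparison.
Variables (R : realType) (al : R).
Local Notation C := R[i].
Hypothesis al0 : 0 < al.
Hypothesis al1 : al < 1.
Local Notation T := (measurableTypeR R * measurableTypeR R)%type.
Local Notation area := (@area R).
Local Notation D := (@unit_disc R).
Variable a : nat -> C.
Hypothesis pa : psd a.
Hypothesis a1 : forall z, modC z < 1 -> modC (psum a z) < 1.
Local Notation phi := (psum a).
Local Notation dphi := (psum (psder a)).
Local Notation g := (dker al).
Local Notation u := (disc_weight al).
Local Notation h := (mesh_half R).
Local Notation cen := (mesh_center R).
Let mD := @measurable_unit_disc R.

Definition good n (q : mesh_index n) : bool := `[< good_square al a (cen q) (h n) >].

Definition mass n (q : mesh_index n) : R :=
  if good q then g (phi (cen q)) * (modC (dphi (cen q)) ^+ 2 * u (cen q)) else 0.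

(** The common discretization: up to constants it is bounded by each of the two integrals, and a
    bound uniform in [n] bounds each of them in turn. *)
Definition total_mass n : R := \sum_(q : mesh_index n) mass q * (pi^-1 * (2 * h n) ^+ 2).

Lemma disc_weight_ge0 z : 0 <= u z. Proof. exact: powR_ge0. Qed.

Lemma mass_ge0 n (q : mesh_index n) : 0 <= mass q.
Proof. by rewrite /mass; case: ifP => // _; exact: mulr_ge0 (dker_ge0 _ _) (mulr_ge0 (sqr_ge0 _) (disc_weight_ge0 _)). Qed.

(** The derivative enters squared, so the three factors 2 combine to 2 * 4 * 2 = 16. *)
Lemma product_double (x y z x' y' z' : R) : 0 <= x -> 0 <= y -> 0 <= z ->
  x <= 2 * x' -> y <= 2 * y' -> z <= 2 * z' ->
  x * (y ^+ 2 * z) <= 16 * (x' * (y' ^+ 2 * z')).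
Proof.
move=> x0 y0 z0 hx hy hz; rewrite [leRHS](_ : _ = (2 * x') * ((2 * y') ^+ 2 * (2 * z'))); last by ring.
by rewrite ler_pM ?mulr_ge0 ?sqr_ge0// ler_pM ?sqr_ge0// ler_pXn2r ?nnegrE// (le_trans y0).
Qed.

Definition comp_density (p : T) : R := g (phi (toC p)) * energy_density al a p.

Lemma comp_densityE p : comp_density p = g (phi (toC p)) * (modC (dphi (toC p)) ^+ 2 * u (toC p)).
Proof. by rewrite /comp_density /energy_density /disc_weight modC_toC. Qed.

Lemma comp_density_mass n (q : mesh_index n) p : good q -> csquare (cen q) (h n) (toC p) ->
  comp_density p <= 16 * mass q /\ mass q <= 16 * comp_density p.
Proof.
move=> gq hp; rewrite comp_densityE /mass gq; move/asboolP : gq => G.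
have [d1 d2] := good_dphi G hp; have [w1 w2] := good_weight G hp; have [k1 k2] := good_kernel G hp.
split.
  exact: product_double (dker_ge0 _ _) (normc_ge0 _) (disc_weight_ge0 _) k1 d1 w1.
exact: product_double (dker_ge0 _ _) (normc_ge0 _) (disc_weight_ge0 _) k2 d2 w2.
Qed.

Lemma comp_density_ge0 p : 0 <= comp_density p.
Proof. by rewrite comp_densityE; exact: mulr_ge0 (dker_ge0 _ _) (mulr_ge0 (sqr_ge0 _) (disc_weight_ge0 _)). Qed.

(** Finitely many points are treated with one threshold, because the counting function will be
    approached through finite parts of a fibre. *)
Lemma good_eventually (s : seq C) : (forall z, z \in s -> modC z < 1 /\ dphi z != 0) ->
  exists N, forall n, (N <= n)%N -> forall z, z \in s ->
    exists q : mesh_index n, good q /\ csquare (cen q) (h n) z.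
Proof.
elim: s => [|z s IH] H; first by exists 0%N.
have [|N HN] := IH; first by move=> y ys; apply: H; rewrite inE ys orbT.
have [z1 dz] := H z (mem_head _ _).
have [r r0 Hr] := good_near al0 al1 pa a1 z1 dz; have [N' HN'] := mesh_half_small r0.
exists (maxn N N') => n; rewrite geq_max => /andP[n1 n2] y; rewrite inE => /orP[/eqP ->|ys]; last exact: HN.
have [q hq] := mesh_cover n z1; exists q; split => //; apply/asboolP.
by apply: Hr => //; [exact: mesh_half_gt0|exact: HN'].
Qed.

Lemma comp_energy_le (B : R) : (forall n, total_mass n <= B) ->
  (comp_energy al a <= (16 * B)%:E)%E.
Proof.
move=> HB.
pose F n p := step (fun q => 16 * mass q) (cen (n := n)) (fun=> h n) p.
have c0 n (q : mesh_index n) : 0 <= 16 * mass q by rewrite mulr_ge0// mass_ge0.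
have h0 n := ltW (mesh_half_gt0 R n).
apply: (@integral_le_einf _ _ _ area D set0 (fun n p => (F n p)%:E)) => //.
- by move=> n; apply/measurable_EFinP; exact: measurable_step.
- by move=> n p _; rewrite lee_fin; exact: step_ge0.
- by move=> p _; rewrite lee_fin; exact: comp_density_ge0.
- move=> p Dp _; apply: limn_einf_ge.
  (* At a critical point the density itself is 0, so the exceptional set can be empty here. *)
  have [d0|d0] := eqVneq (dphi (toC p)) 0.
    exists 0%N => n _; rewrite lee_fin -/(comp_density p) comp_densityE d0 Normc.normc0 expr0n/= mul0r mulr0.
    exact: step_ge0.
  have [z|N HN] := @good_eventually [:: toC p]; first by rewrite inE => /eqP ->.
  exists N => n Nn; have [q [gq hq]] := HN n Nn _ (mem_head _ _).
  have [h1 _] := comp_density_mass gq hq.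
  rewrite lee_fin -/(comp_density p); apply: (le_trans h1).
  exact: (@step_ge_term R _ (fun q => 16 * mass q) (cen (n := n)) (fun=> h n) q p (c0 n) hq).
move=> n; apply: (le_trans (integral_step_le _ _ _)) => //; rewrite lee_fin.
under eq_bigr do rewrite -mulrA.
by rewrite -mulr_sumr; apply: ler_wpM2l => //; exact: HB.
Qed.

Lemma total_mass_le n : ((total_mass n)%:E <= 16%:E * comp_energy al a)%E.
Proof.
have h0 := ltW (mesh_half_gt0 R n).
rewrite /total_mass -(@integral_step_eq R _ (@mass n) (cen (n := n)) (fun=> h n))//; last 2 first.
- exact: mass_ge0.
- move=> q z; rewrite /mass; case: ifP => [/asboolP G _|]; last by rewrite eqxx.
  exact: good_disc G z.
rewrite /comp_energy -ge0_integralZl_EFin//; last 2 first.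
- by move=> p _; rewrite lee_fin; exact: comp_density_ge0.
- exact: measurable_comp_energy.
apply: ge0_le_integral_sup => p Dp; first by rewrite lee_fin step_ge0//; exact: mass_ge0.
rewrite -EFinM lee_fin -/(comp_density p) /step.
under eq_bigr do rewrite indicE.
have [[q hq]|hn] := pselect (exists q, csquare (cen (n := n) q) (h n) (toC p)).
  rewrite (bigD1 q)//= big1 ?addr0 => [|i iq].
    rewrite mem_set// mulr1; case: (boolP (good q)) => gq; last first.
      rewrite /mass ifN//; exact: (mulr_ge0 _ (comp_density_ge0 p)).
    by have [] := comp_density_mass gq hq.
  rewrite memNset ?mulr0// => hi; move/eqP: iq; apply.
  exact: mesh_disjoint hi hq.
rewrite big1; [exact: (mulr_ge0 _ (comp_density_ge0 p))|] => i _; rewrite memNset ?mulr0// => hi.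
by apply: hn; exists i.
Qed.

Local Notation N w := (nevanlinna al phi w).

Lemma nevanlinna_ge0 w : (0 <= N w)%E.
Proof. by apply: esum_ge0 => z _; rewrite lee_fin; exact: disc_weight_ge0. Qed.

Definition counting_integral : \bar R :=
  (\int[area]_(p in D) (N (toC p) * (g (toC p))%:E))%E.

(** Cells are disjoint, so different cells provide different preimages of w. The weight of each
    preimage is at least half of that at the center. *)
Lemma nevanlinna_lower n (P : pred (mesh_index n)) w :
  (forall q, P q -> good q /\ exists2 z, csquare (cen q) (h n) z & phi z = w) ->
  (\sum_(q | P q) (u (cen q) / 2)%:E <= N w)%E.
Proof.
move=> HP; pose t z (q : mesh_index n) : R := if `[< csquare (cen q) (h n) z >] then u z else 0.
have t0 z q : 0 <= t z q by rewrite /t; case: ifP => // _; exact: disc_weight_ge0.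
pose F := [set z | disc z /\ phi z = w].
apply: (@le_trans _ _ (\sum_(q | P q) \esum_(z in F) (t z q)%:E)%E).
  apply: lee_sum => q /HP[gq [z hz pz]]; move/asboolP : gq => G.
  apply: esum_ge; exists [set z].
    by split; [exact: finite_set1|move=> _ ->; split => //; exact: good_disc G z hz].
  rewrite fsbig_set1 lee_fin /t asboolT//.
  have [_ w2] := good_weight G hz; by rewrite ler_pdivrMr// mulrC.
rewrite -(@esum_sum R _ _ F (index_enum _) P (fun z q => (t z q)%:E)); last by move=> z q _ _; rewrite lee_fin.
apply: le_esum => z _; rewrite sumEFin lee_fin /t -big_mkcondr/=.
apply: sum_uniq_le => //; first exact: index_enum_uniq.
  exact: disc_weight_ge0.
move=> q q' _ _ /andP[_ /asboolP hq] /andP[_ /asboolP hq']; exact: mesh_disjoint hq hq'.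
Qed.

(** The small image squares are covered by the values of [phi]. The 1/4 in [c] pays the two factors
    2 of weight and kernel, and the 1/4 in the side enters squared: 4 * 16 = 64. *)
Lemma total_mass_counting n : ((total_mass n)%:E <= 64%:E * counting_integral)%E.
Proof.
pose c (q : mesh_index n) := if good q then g (phi (cen q)) * u (cen q) / 4 else 0.
pose m (q : mesh_index n) := phi (cen q).
pose s (q : mesh_index n) := 4^-1 * modC (dphi (cen q)) * h n.
have c0 q : 0 <= c q.
  rewrite /c; case: ifP => // _; apply: mulr_ge0 => //; exact: mulr_ge0 (dker_ge0 _ _) (disc_weight_ge0 _).
have s0 q : 0 <= s q.
  by rewrite /s mulr_ge0 ?(ltW (mesh_half_gt0 _ _))// mulr_ge0// normc_ge0.
have sup q z : good q -> csquare (m q) (s q) z -> exists2 x, csquare (cen q) (h n) x & phi x = z.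
  by move=> /asboolP G; exact: good_image_sup G.
have e : total_mass n = 64 * \sum_q c q * (pi^-1 * (2 * s q) ^+ 2).
  rewrite mulr_sumr; apply: eq_bigr => q _; rewrite /mass /c /s.
  case: ifP => _; last by rewrite !mul0r mulr0.
  by move: (g _) (u _) (modC _) (h n) (pi^-1) => x1 x2 x3 x4 x5; field.
rewrite e EFinM -(@integral_step_eq R _ c m s)//; last first.
  move=> q z; rewrite /c; case: ifP => [gq _ hz|]; last by rewrite eqxx.
  have [x hx <-] := sup q z gq hz; apply: a1; move/asboolP : gq => G; exact: good_disc G x hx.
apply: lee_wpmul2l; first by rewrite lee_fin.
apply: ge0_le_integral_sup => p Dp; first by rewrite lee_fin step_ge0.
pose P q := good q && `[< csquare (m q) (s q) (toC p) >].
have HP q : P q -> good q /\ exists2 z, csquare (cen q) (h n) z & phi z = toC p.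
  by move=> /andP[gq /asboolP hq]; split => //; exact: sup.
have g0 : (0 <= (g (toC p))%:E)%E by rewrite lee_fin dker_ge0.
apply: le_trans (lee_wpmul2r g0 (nevanlinna_lower HP)).
rewrite sumEFin -EFinM lee_fin mulr_suml /step [leRHS]big_mkcond/=; apply: ler_sum => q _.
rewrite indicE /P /c; case: (boolP (good q)) => gq; last by rewrite mul0r.
case: asboolP => hq; last by rewrite memNset// mulr0.
rewrite mem_set// mulr1; have [x hx px] := sup q _ gq hq.
move/asboolP : gq => G; have [_] := good_kernel G hx; rewrite px.
rewrite -/(m q); move: (g (m q)) (g (toC p)) (u (cen q)) (disc_weight_ge0 (cen q)) => x1 x2 x3 x30 hh.
have : x1 * x3 <= 2 * x2 * x3 by apply: ler_wpM2r.
by rewrite /=; lra.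
Qed.

Lemma dker_gt0 w : modC w < 1 -> 0 < g w.
Proof. by move=> w1; rewrite invr_gt0 powR_gt0// disc_gap_gt0. Qed.

(** Here the large image squares serve: 36 = 4 * 9, the factors 2 of weight and kernel times the
    square of 3. The critical values go into the exceptional null set, so that all preimages of the
    remaining points are eventually in good squares. *)
Lemma counting_integral_le (B : R) : (forall n, total_mass n <= B) ->
  (counting_integral <= (36 * B)%:E)%E.
Proof.
move=> HB.
pose c n (q : mesh_index n) := if good q then 4 * (g (phi (cen q)) * u (cen q)) else 0.
pose m n (q : mesh_index n) := phi (cen q).
pose s n (q : mesh_index n) := 3 * modC (dphi (cen q)) * h n.
have c0 n q : 0 <= c n q.
  rewrite /c; case: ifP => // _; apply: mulr_ge0 => //; exact: mulr_ge0 (dker_ge0 _ _) (disc_weight_ge0 _).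
have s0 n q : 0 <= s n q.
  by rewrite /s mulr_ge0 ?(ltW (mesh_half_gt0 _ _))// mulr_ge0// normc_ge0.
have [V [mV V0 HV]] := sard pa a1.
apply: (@integral_le_einf _ _ _ area D V (fun n p => (step (c n) (m n) (s n) p)%:E)) => //.
- by move=> n; apply/measurable_EFinP; exact: measurable_step.
- by move=> n p _; rewrite lee_fin; exact: step_ge0.
- by move=> p _; apply: mule_ge0; [exact: nevanlinna_ge0|rewrite lee_fin dker_ge0].
- move=> p Dp Vp; have gp : 0 < g (toC p) by apply: dker_gt0; exact: toC_lt1.
  (* The counting function is a supremum over finite parts of the fibre; each finite part is handled
     by its own threshold in [n]. *)
  rewrite -lee_pdivlMr//; apply: ge_ereal_sup => _ [X [finX XF] <-].
  have [l [ul lX ->]] := fsum_seq (fun z : C => (u z)%:E) finX.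
  rewrite sumEFin lee_pdivlMr//.
  have XP z : z \in l -> modC z < 1 /\ phi z = toC p by move=> /lX/XF[].
  have [z zX|M HM] := @good_eventually l.
    have [z1 pz] := XP z zX; split => //; apply/eqP => dz; exact: Vp (HV p z z1 dz pz).
  apply: limn_einf_ge; exists M => n Mn; rewrite -EFinM lee_fin mulr_suml.
  pose t z (q : mesh_index n) : R := if good q && `[< csquare (cen q) (h n) z >] then u z * g (toC p) else 0.
  have ug0 z : 0 <= u z * g (toC p) := mulr_ge0 (disc_weight_ge0 z) (ltW gp).
  have t0 z q : 0 <= t z q by rewrite /t; case: ifP.
  apply: (@le_trans _ _ (\sum_(z <- l) \sum_q t z q)).
    rewrite big_seq [leRHS]big_seq; apply: ler_sum => z zX.
    have [q [gq hq]] := HM n Mn z zX; rewrite (bigD1 q)//= /t gq asboolT//= lerDl.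
    by apply: sumr_ge0 => i _; exact: t0.
  (* After the exchange each cell is charged by at most one point of the fibre, since [phi] is
     injective on a good square, and its image square contains the value. *)
  rewrite exchange_big/= /step; apply: ler_sum => q _; rewrite /t -big_mkcond/=.
  apply: sum_uniq_le => //.
  + exact: mulr_ge0.
  + move=> x y xX yX /andP[/asboolP G /asboolP hx] /andP[_ /asboolP hy].
    by apply: (good_inj G hx hy); rewrite (XP x xX).2 (XP y yX).2.
  move=> z zX /andP[gq /asboolP hz]; have [z1 pz] := XP z zX.
  move/asboolP : (gq) => G; rewrite indicE mem_set; last first.
    by have := good_image_sub G hz; rewrite pz.
  rewrite mulr1 /c gq; have [w1 _] := good_weight G hz; have [k1 _] := good_kernel G hz.
  rewrite -pz (_ : 4 * _ = (2 * u (cen q)) * (2 * g (phi (cen q)))); last by ring.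
  exact: ler_pM (disc_weight_ge0 _) (dker_ge0 _ _) w1 k1.
move=> n; apply: (le_trans (integral_step_le _ _ _)) => //; rewrite lee_fin.
rewrite [leLHS](_ : _ = 36 * total_mass n); first by apply: ler_wpM2l => //; exact: HB.
rewrite mulr_sumr; apply: eq_bigr => q _; rewrite /mass /c /s.
case: ifP => _; last by rewrite !mul0r mulr0.
by move: (g _) (u _) (modC _) (h n) (pi^-1) => x1 x2 x3 x4 x5; ring.
Qed.

Lemma comp_energy_counting : (comp_energy al a < +oo)%E <-> (counting_integral < +oo)%E.
Proof.
split=> fin.
- have f : comp_energy al a \is a fin_num by rewrite ge0_fin_numE//; exact: comp_energy_ge0.
  apply: (@le_lt_trans _ _ (36 * (16 * fine (comp_energy al a)))%:E); last by rewrite ltry.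
  apply: counting_integral_le => n; rewrite -lee_fin EFinM fineK//; exact: total_mass_le.
- have N0 : (0 <= counting_integral)%E.
    by apply: integral_ge0 => p _; apply: mule_ge0; [exact: nevanlinna_ge0|rewrite lee_fin dker_ge0].
  have f : counting_integral \is a fin_num by rewrite ge0_fin_numE.
  apply: (@le_lt_trans _ _ (16 * (64 * fine counting_integral))%:E); last by rewrite ltry.
  apply: comp_energy_le => n; rewrite -lee_fin EFinM fineK//; exact: total_mass_counting.
Qed.

End Comparison.

(** * The Hilbert-Schmidt criterion *)

Section HilbertSchmidt.
Variables (R : realType) (al : R).
Local Notation C := R[i].
Hypothesis al0 : 0 < al.
Hypothesis al1 : al < 1.
Local Notation T := (measurableTypeR R * measurableTypeR R)%type.
Local Notation area := (@area R).
Local Notation D := (@unit_disc R).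
Local Notation c0 := (@area_ball1 R).
Local Notation wnorm2 := (wnorm2 al).
Variable phi : C -> C.
Hypothesis phiD : dirichlet al phi.
Hypothesis phi1 : forall z, modC z < 1 -> modC (phi z) < 1.
Let mD := @measurable_unit_disc R.
Let a := coef phi.

Let pa : psd a. Proof. by have [] := dirichletP phiD. Qed.

Let phiE z : modC z < 1 -> phi z = psum a z.
Proof. by have [_ h _] := dirichletP phiD; exact: h. Qed.

Let a1 z : modC z < 1 -> modC (psum a z) < 1.
Proof. by move=> z1; rewrite -phiE// phi1. Qed.

Lemma derive1_dirichlet f w : dirichlet al f -> modC w < 1 ->
  derive1 (f : Cplx R -> Cplx R) w = psum (psder (coef f)) w.
Proof.
move=> /dirichletP[pf fE _] w1.
by have [_ ->] := psum_derive (f := f : Cplx R -> Cplx R) pf fE w1.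
Qed.

Lemma comp_diffE f z : dirichlet al f -> modC z < 1 ->
  comp_diff phi f z = psum (psder (coef f)) (psum a z).
Proof. by move=> fD z1; rewrite /comp_diff (derive1_dirichlet fD (phi1 z1)) (phiE z1). Qed.

Definition second_derivative_energy (A : nat -> C) (p : T) : R :=
  modC (psum (psder (psder A)) (psum a (toC p))) ^+ 2 * energy_density al a p.

Lemma second_derivative_energy_ge0 A p : 0 <= second_derivative_energy A p.
Proof. exact: mulr_ge0 (sqr_ge0 _) (energy_density_ge0 _ _ _). Qed.

Lemma measurable_second_derivative_energy A : psd A ->
  measurable_fun D (fun p => (second_derivative_energy A p)%:E).
Proof.
move=> hA; apply/measurable_EFinP; apply: measurable_funM; last exact: measurable_energy_density.
apply: measurable_modC2; apply: mcfun_psum; first by do 2 apply: psd_der.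
  by apply: mcfun_psum; [exact: pa|exact: mcfun_toC|exact: toC_lt1].
by move=> p Dp; apply: a1; exact: toC_lt1.
Qed.

Lemma comp_energy_of_hilbert_schmidt : hilbert_schmidt al (comp_diff phi) -> (comp_energy al a < +oo)%E.
Proof.
move=> [[_ TD _] [e [onb fin]]]; have [eD _ _] := onb.
have c00 := area_ball1_pos R.
pose A k := coef (e k); pose B k := coef (comp_diff phi (e k)).
have pA k : psd (A k) by have [] := dirichletP (eD k).
have pB k : psd (B k) by have [] := dirichletP (TD _ (eD k)).
have BE k z : modC z < 1 -> psum (B k) z = psum (psder (A k)) (psum a z).
  move=> z1; have [_ hB _] := dirichletP (TD _ (eD k)).
  exact: etrans (esym (hB z z1)) (comp_diffE (eD k) z1).
have KL w (w1 : modC w < 1) : ((4 / 15 * ((1 - modC w ^+ 2) `^ (al + 4))^-1)%:E <=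
   \sum_(k <oo) (modC (psum (psder (psder (A k))) w) ^+ 2)%:E)%E := kernel_basis_lower al0 al1 onb w1.
have {}fin : (\sum_(k <oo) wnorm2 (B k) < +oo)%E := fin.
clearbody A B.
have E k : (\int[area]_(p in D) (second_derivative_energy (A k) p)%:E <= (2 * c0)%:E * wnorm2 (B k))%E.
  rewrite -(dirichlet_integral_comp al pa a1 (pA k) (pB k) (BE k)).
  exact: (dirichlet_integral_le al0 al1 (pB k)).
have J0 := comp_energy_ge0 al a.
suff h : ((4 / 15)%:E * comp_energy al a < +oo)%E.
  have [//|] := boolP (comp_energy al a < +oo)%E; rewrite -leNgt leye_eq => /eqP J.
  by move: h; rewrite J gt0_muley// lte_fin.
rewrite /comp_energy -ge0_integralZl_EFin//; last 2 first.
- by move=> p _; rewrite lee_fin; exact: comp_density_ge0.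
- exact: measurable_comp_energy.
(* The kernel bound holds at every point phi(z), for the basis at hand; monotone convergence then
   exchanges sum and integral. *)
apply: (@le_lt_trans _ _ (\int[area]_(p in D) \sum_(k <oo) (second_derivative_energy (A k) p)%:E)%E).
  apply: ge0_le_integral_sup => p Dp.
    by apply: mule_ge0; rewrite lee_fin//; exact: comp_density_ge0.
  have e0 := energy_density_ge0 al a p.
  have h := KL _ (a1 (toC_lt1 Dp)).
  rewrite (eq_eseriesr (g := fun k => (energy_density al a p)%:E * (modC (psum (psder (psder (A k))) (psum a (toC p))) ^+ 2)%:E)%E).
    rewrite nneseriesZl; last by move=> k _; rewrite lee_fin sqr_ge0.
    have e0' : (0 <= (energy_density al a p)%:E)%E by rewrite lee_fin.
    apply: le_trans (lee_wpmul2l e0' h).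
    by rewrite -!EFinM lee_fin /dker mulrA mulrC.
  by move=> k _; rewrite /second_derivative_energy mulrC EFinM.
rewrite integral_nneseries//; last 2 first.
- by move=> k; exact: measurable_second_derivative_energy.
- by move=> k p _; rewrite lee_fin second_derivative_energy_ge0.
apply: (@le_lt_trans _ _ (\sum_(k <oo) (2 * c0)%:E * wnorm2 (B k))%E).
  apply: lee_nneseries => [k _ _|k _]; last exact: E.
  by apply: integral_ge0 => p _; rewrite lee_fin second_derivative_energy_ge0.
rewrite nneseriesZl; last by move=> k _; exact: (wnorm2_ge0 al1).
apply: lte_mul_pinfty => //; first by rewrite lee_fin mulr_ge0// ltW.
Qed.

Hypothesis fin : (comp_energy al a < +oo)%E.

Lemma comp_diff_dirichlet f : dirichlet al f -> dirichlet al (comp_diff phi f).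
Proof.
move=> fD; have [_ _ ff] := dirichletP fD.
have [B [pB BE Bf]] := comp_series al0 al1 pa a1 ff fin.
apply: (psd_dirichlet pB _ Bf) => z z1; exact: etrans (comp_diffE fD z1) (esym (BE z z1)).
Qed.

Lemma comp_diff_linear : linear_operator al (comp_diff phi).
Proof.
split.
- move=> f g fD gD fg z z1; rewrite (comp_diffE fD z1) (comp_diffE gD z1).
  have [pf fE _] := dirichletP fD; have [pg gE _] := dirichletP gD.
  move: (coef f) (coef g) pf pg fE gE => A B pA pB fE gE; suff -> : A = B by [].
  by apply: psum_inj pA pB _ => w w1; rewrite -(fE w w1) -(gE w w1); exact: fg.
- exact: comp_diff_dirichlet.
move=> c f g fD gD z z1; have [pf fE _] := dirichletP fD; have [pg gE _] := dirichletP gD.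
have dF := derive1_dirichlet fD (phi1 z1); have dG := derive1_dirichlet gD (phi1 z1).
rewrite /comp_diff dF dG.
move: (coef f) (coef g) pf pg fE gE {dF dG} => A B pA pB fE gE.
have pl : psd (fun n => c * A n + B n) by exact: psd_lin.
have lE w : modC w < 1 -> c * f w + g w = psum (fun n => c * A n + B n) w.
  by move=> w1; rewrite (psum_lin c pA pB w1) -(fE w w1) -(gE w w1).
have [_ ->] := psum_derive (f := (fun z => c * f z + g z) : Cplx R -> Cplx R) pl lE (phi1 z1).
rewrite -(psum_lin c (psd_der pA) (psd_der pB) (phi1 z1)).
by congr (psum _ _); apply/funext => n; rewrite /psder mulrDr mulrCA.
Qed.

(** The constant terms of the images sum to at most [K], a bound at the single point phi(0). The
    derivative parts are summed under the integral, where [std_der2_sum] gives 30 times the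
    kernel. *)
Lemma std_basis_summable :
  (\sum_(0 <= n <oo) dirichlet_norm2 al (comp_diff phi (std_basis al n)) < +oo)%E.
Proof.
have c00 := area_ball1_pos R.
have w01 : modC (psum a 0) < 1 by apply: a1; rewrite Normc.normc0.
have [K K0 HK] := std_der_sum al1 w01.
have fJ : comp_energy al a \is a fin_num by rewrite ge0_fin_numE//; exact: comp_energy_ge0.
pose J := fine (comp_energy al a); pose M := 25 / 2 / c0.
have M0 : 0 <= M by rewrite !mulr_ge0// invr_ge0 ltW.
pose B k := coef (comp_diff phi (std_basis al k)).
have kD k := std_dirichlet al1 k.
have pB k : psd (B k) by have [] := dirichletP (comp_diff_dirichlet (kD k)).
have ps k : psd (std_coef al k) := std_psd al1 k.
have BE k z : modC z < 1 -> psum (B k) z = psum (psder (std_coef al k)) (psum a z).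
  move=> z1; have [_ hB _] := dirichletP (comp_diff_dirichlet (kD k)).
  by rewrite -(std_coefE al1 k); exact: etrans (esym (hB z z1)) (comp_diffE (kD k) z1).

apply: (@le_lt_trans _ _ (K + M * (30 * J))%:E); last by rewrite ltry.
rewrite [leLHS](_ : _ = \sum_(k <oo) wnorm2 (B k))%E//; clearbody B.
have W0 k : (0 <= wnorm2 (B k))%E by exact: (wnorm2_ge0 al1).
apply: lime_le; first by apply: is_cvg_nneseries => k _ _; exact: W0.
apply: nearW => n; rewrite big_mkord.
pose S k := second_derivative_energy (std_coef al k).
apply: (@le_trans _ _ (\sum_(k < n) ((modC (psum (psder (std_coef al k)) (psum a 0)) ^+ 2)%:E +
    M%:E * \int[area]_(p in D) (S k p)%:E))%E).
  apply: lee_sum => k _; apply: (le_trans (wnorm2_dirichlet_integral al0 al1 (pB k))).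
  rewrite (dirichlet_integral_comp al pa a1 (ps k) (pB k) (BE k)).
  rewrite -(psum_at0 (B k)) (BE k 0)//; last by rewrite Normc.normc0.
rewrite big_split/= EFinD; apply: leeD; first by rewrite sumEFin lee_fin; exact: HK.
have I0 k : (0 <= \int[area]_(p in D) (S k p)%:E)%E.
  by apply: integral_ge0 => p _; rewrite lee_fin second_derivative_energy_ge0.
rewrite -ge0_sume_distrr; last by move=> k _; exact: I0.
rewrite [leRHS]EFinM; apply: lee_wpmul2l; first by rewrite lee_fin.
rewrite -(big_mkord xpredT (fun k => \int[area]_(p in D) (S k p)%:E)%E).
rewrite -(@ge0_integral_sum _ _ _ area D mD nat (fun k p => (S k p)%:E)); last 2 first.
- by move=> k; exact: measurable_second_derivative_energy.
- by move=> k p _; rewrite lee_fin second_derivative_energy_ge0.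
have -> : ((30 * J)%:E = \int[area]_(p in D) (30%:E * (dker al (psum a (toC p)) * energy_density al a p)%:E))%E.
  rewrite ge0_integralZl_EFin//; first by rewrite EFinM /J fineK.
  - by move=> p _; rewrite lee_fin; exact: comp_density_ge0.
  - exact: measurable_comp_energy.
apply: ge0_le_integral_sup => p Dp.
  by apply: sume_ge0 => k _; rewrite lee_fin second_derivative_energy_ge0.
rewrite sumEFin -EFinM lee_fin big_mkord /S /second_derivative_energy -mulr_suml [leRHS]mulrA.
apply: ler_wpM2r; first exact: energy_density_ge0.
exact: (std_der2_sum al0 al1 n (a1 (toC_lt1 Dp))).
Qed.

Lemma hilbert_schmidt_of_comp_energy : hilbert_schmidt al (comp_diff phi).
Proof.
split; first exact: comp_diff_linear.
by exists (std_basis al); split; [exact: std_basis_onb|exact: std_basis_summable].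
Qed.

End HilbertSchmidt.

Theorem theorem1p4 (R : realType) (alpha : R) (phi : Cplx R -> Cplx R)
    (alpha_gt0 : 0 < alpha) (alpha_lt1 : alpha < 1)
    (phi_dirichlet : dirichlet alpha phi)
    (phi_self_map : holomorphic_self_map phi) :
  hilbert_schmidt alpha (comp_diff phi) <->
  (\int[area R]_(p in @toC R @^-1` @disc R)
     (nevanlinna alpha phi (toC p) *
      (((1 - modC (toC p) ^+ 2) `^ (alpha + 4)) ^-1)%:E) < +oo)%E.
Proof.
have phi1 z : modC z < 1 -> modC (phi z) < 1 by case: phi_self_map => _; exact.
have [pa phiE _] := dirichletP phi_dirichlet.
have a1 z : modC z < 1 -> modC (psum (coef phi) z) < 1 by move=> z1; rewrite -phiE// phi1.
(* [phi] and its power series agree only on the disc; the fibres are taken inside the disc, so the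
   counting functions coincide everywhere. *)
have NE w : nevanlinna alpha phi w = nevanlinna alpha (psum (coef phi)) w.
  rewrite /nevanlinna; congr (\esum_(z in _) _)%E.
  by apply/seteqP; split => z [z1 <-]; split => //; rewrite phiE.
have -> : (\int[area R]_(p in @toC R @^-1` @disc R)
     (nevanlinna alpha phi (toC p) * (((1 - modC (toC p) ^+ 2) `^ (alpha + 4)) ^-1)%:E))%E =
   counting_integral alpha (coef phi).
  by apply: eq_integral => p _; rewrite NE.
rewrite -(comp_energy_counting alpha_gt0 alpha_lt1 pa a1); split => h.
  exact: comp_energy_of_hilbert_schmidt.
exact: hilbert_schmidt_of_comp_energy.
Qed.
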